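(* Let $K$ be a positive definite kernel on the open unit disc $\mathbb D$ with $K(w,w)>0$ for all $w\in\mathbb D$, and assume that the adjoint $M^*$ of the operator $M$ of multiplication by the coordinate function on the reproducing kernel Hilbert space $\mathcal H_K$ belongs to $B_1(\mathbb D)$. Then the function $\frac{\partial^2}{\partial w\,\partial\bar w}\log\big((1-|w|^2)K(w,w)\big)$ is a positive definite function on $\mathbb D$, or equivalently $$\mathcal K_{M^*}(w)\preceq\mathcal K_{S^*}(w),\quad w\in\mathbb D,$$ if and only if the multiplication operator $M$ is an infinitely divisible contraction.
   Context: Positive definite kernel on a domain $U$: a function $L:U\times U\to\mathbb C$, holomorphic in the first variable and anti-holomorphic in the second, with $\sum_{p,q}\bar a_p a_q L(u_p,u_q)\ge 0$ for all finite choices $u_1,\ldots,u_l\in U$, $a_1,\ldots,a_l\in\mathbb C$. Positive definite function: a real analytic function $G$ on $U$ is a positive definite function on $U$ if its polarization $\widetilde G$ (the unique function on $U\times U$, holomorphic in the first variable, anti-holomorphic in the second, with $\widetilde G(w,w)=G(w)$) is a positive definite kernel on $U$ (this includes that $\widetilde G$ is defined on all of $U\times U$). For real analytic $G_1,G_2$ on $U$, $G_1\preceq G_2$ means that $G_2-G_1$ is a positive definite function on $U$. Infinite divisibility: let $L$ on $U\times U$ be holomorphic in the first variable, anti-holomorphic in the second, and positive on the diagonal. $L^t$ ($t>0$) is the polarization of $w\mapsto L(w,w)^t$, and $L$ is infinitely divisible if for every $t>0$, $L^t$ is (defined on $U\times U$ and) a positive definite kernel. $M$ (or $M^*$) on $\mathcal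 H_K$ is an infinitely divisible contraction if $(1-z\bar w)K(z,w)$ is infinitely divisible on $\mathbb D$. $B_1(\mathbb D)$: the bounded operators $T$ on a separable complex Hilbert space $\mathcal H$ with $\mathbb D\subset\sigma(T)$, $\mathrm{ran}(T-w)=\mathcal H$ and $\dim\ker(T-w)=1$ for $w\in\mathbb D$, and $\bigvee_{w\in\mathbb D}\ker(T-w)=\mathcal H$. Curvatures: $\mathcal K_{M^*}(w)=-\frac{\partial^2}{\partial w\,\partial\bar w}\log K(w,w)$ and, for the backward shift $S^*$ on $\ell^2$, $\mathcal K_{S^*}(w)=-\frac{\partial^2}{\partial w\,\partial\bar w}\log\frac{1}{1-|w|^2}=-\frac{1}{(1-|w|^2)^2}$. *)

(* Defs.v *)
From HB Require Import structures.
From mathcomp Require Import all_boot all_order all_algebra.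
From mathcomp Require Import sesquilinear.
From mathcomp Require Import all_classical all_reals all_analysis.
From mathcomp Require Import complex.

Set Implicit Arguments.
Unset Strict Implicit.
Unset Printing Implicit Defensive.

Import Order.TTheory GRing.Theory Num.Theory.
Import numFieldNormedType.Exports.

Local Open Scope classical_set_scope.
Local Open Scope ring_scope.

(* Order on R[i]: [0 <= x] (resp. [0 < x]) says that x is real and nonnegative
   (resp. positive); [`|x|] is the modulus, seen in R[i]. *)

Definition disc (R : realType) : set R[i] := [set z | `|z| < 1].
Arguments disc : clear implicits.

Section Kernels.
Context {R : realType}.
Implicit Types (U : set R[i]) (f G : R[i] -> R[i]) (L : R[i] -> R[i] -> R[i]).

(* U is meant to be open; [^o] selects R[i] as a normed space over itself, so
   that [derivable] is complex differentiability. *)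
Definition holomorphic_on U f : Prop :=
  forall z, U z -> derivable (f : R[i]^o -> R[i]^o) z 1.

Definition antiholomorphic_on U f : Prop :=
  holomorphic_on U (fun z => (f z)^*).

Definition sesquiholomorphic U L : Prop :=
  (forall w, U w -> holomorphic_on U (fun z => L z w)) /\
  (forall z, U z -> antiholomorphic_on U (fun w => L z w)).

Definition positive_definite_kernel U L : Prop :=
  sesquiholomorphic U L /\
  forall (l : nat) (u a : 'I_l -> R[i]), (forall p, U (u p)) ->
    0 <= \sum_p \sum_q (a p)^* * a q * L (u p) (u q).

Definition is_polarization U G L : Prop :=
  sesquiholomorphic U L /\ forall w, U w -> L w w = G w.

(* On a domain there is at most one polarization, and G is real analytic as
   soon as it has one, so real analyticity of G need not be required apart. *)
Definition positive_definite_function U G : Prop :=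
  exists L, is_polarization U G L /\ positive_definite_kernel U L.

Definition pd_le U G1 G2 : Prop :=
  positive_definite_function U (fun w => G2 w - G1 w).

Definition infinitely_divisible U L : Prop :=
  [/\ sesquiholomorphic U L,
      forall w, U w -> 0 < L w w &
      forall t : R, 0 < t -> exists Lt : R[i] -> R[i] -> R[i],
        is_polarization U (fun w => real_complex R (complex.Re (L w w) `^ t)) Lt
        /\ positive_definite_kernel U Lt].

(* By definition this is the property "M is an infinitely divisible
   contraction" of multiplication by z on the space with kernel K. *)
Definition infinitely_divisible_contraction (K : R[i] -> R[i] -> R[i]) : Prop :=
  infinitely_divisible (disc R) (fun z w => (1 - z * w^*) * K z w).

End Kernels.

Section Curvature.
Context {R : realType}.
Implicit Types (g k : R[i] -> R[i]) (v w : R[i]).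

Definition dir_derive v g w : R[i] :=
  Complex (derive1 (fun t : R => complex.Re (g (w + real_complex R t * v))) 0)
          (derive1 (fun t : R => complex.Im (g (w + real_complex R t * v))) 0).

Definition d_w g w : R[i] :=
  (dir_derive 1 g w - 'i%C * dir_derive 'i%C g w) / 2.

Definition d_wbar g w : R[i] :=
  (dir_derive 1 g w + 'i%C * dir_derive 'i%C g w) / 2.

Definition log_of k w : R[i] := real_complex R (ln (complex.Re (k w))).

Definition ddbar_log k w : R[i] := d_w (d_wbar (log_of k)) w.

(* [curvature k] is the curvature attached to the squared norm
   [k w = K w w] of the section [w |-> K(., w)] of eigenvectors. *)
Definition curvature k w : R[i] := - ddbar_log k w.

Definition curvature_Mstar (K : R[i] -> R[i] -> R[i]) : R[i] -> R[i] :=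
  curvature (fun w => K w w).

Definition curvature_Sstar : R[i] -> R[i] :=
  curvature (fun w => 1 / (1 - `|w| ^+ 2)).

End Curvature.

Section Operators.
Context {R : realType} {H : completeNormedModType R[i]}.
Implicit Types (ip : {dot H for @Num.conj R[i]}) (T S : {linear H -> H}).

(* [ip] is linear in its first argument and conjugate-linear in the second. *)
Definition hilbert_product ip : Prop := forall x : H, `|x| ^+ 2 = ip x x.

Definition separable : Prop :=
  exists A : set H, countable A /\ dense A.

Definition bounded_operator T : Prop :=
  exists r : R[i], forall x : H, `|T x| <= r * `|x|.

Definition is_adjoint ip T S : Prop := forall x y : H, ip (T x) y = ip x (S y).

Definition shifted T (w : R[i]) (x : H) : H := T x - w *: x.

Definition spectrum T : set R[i] :=
  [set w | ~ exists S, [/\ bounded_operator S,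
                          cancel (shifted T w) S & cancel S (shifted T w)]].

Definition ker_shifted T (w : R[i]) : set H := [set x | shifted T w x = 0].

Definition one_dimensional (A : set H) : Prop :=
  exists2 e : H, e != 0 & A = range (fun c : R[i] => c *: e).

Definition linear_span (A : set H) : set H :=
  [set x | exists (n : nat) (c : 'I_n -> R[i]) (v : 'I_n -> H),
      (forall i, A (v i)) /\ x = \sum_i c i *: v i].

(* The Cowen-Douglas class B_1(Omega). *)
Definition in_B1 (Omega : set R[i]) T : Prop :=
  separable /\ bounded_operator T /\
  [/\ Omega `<=` spectrum T,
      forall w, Omega w -> range (shifted T w) = setT,
      forall w, Omega w -> one_dimensional (ker_shifted T w) &
      closure (linear_span (\bigcup_(w in Omega) ker_shifted T w)) = setT].

(* H, read through [ev], is the Hilbert space of functions on U with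
   reproducing kernel K: [ev f z] is the value at z of the element f. This
   determines H up to an isometry compatible with [ev]; values of [ev f]
   outside U are irrelevant. *)
Definition is_rkhs (U : set R[i]) (K : R[i] -> R[i] -> R[i])
    ip (ev : H -> R[i] -> R[i]) : Prop :=
  [/\ hilbert_product ip,
      forall (c : R[i]) (f g : H) z, U z ->
        ev (c *: f + g) z = c * ev f z + ev g z,
      forall f : H, (forall z, U z -> ev f z = 0) -> f = 0 &
      forall w, U w -> exists2 kw : H,
        (forall z, U z -> ev kw z = K z w) & (forall f : H, ip f kw = ev f w)].

Definition is_coordinate_mult (U : set R[i]) (ev : H -> R[i] -> R[i]) T : Prop :=
  forall (f : H) z, U z -> ev (T f) z = z * ev f z.

End Operators.
Arguments separable {R} H.

(* Main.v *)
Require Import Defs.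
From HB Require Import structures.
From mathcomp Require Import all_boot all_order all_algebra.
From mathcomp Require Import sesquilinear spectral.
From mathcomp Require Import all_classical all_reals all_analysis.
From mathcomp Require Import complex ring lra.

Set Implicit Arguments.
Unset Strict Implicit.
Unset Printing Implicit Defensive.

Import Order.TTheory GRing.Theory Num.Theory.
Import numFieldNormedType.Exports.

Local Open Scope classical_set_scope.
Local Open Scope ring_scope.

(** Put L(z, w) = (1 - z conj w) K(z, w), so that the function in question is
    d dbar log L(w, w). It is the sum of d dbar log (1 - |w|^2) and of
    d dbar log K(w, w), that is, the difference of the two curvatures; this
    pointwise identity is the first equivalence.

    For the second one, suppose first that d dbar log L(w, w) has a positive
    definite polarization N ([pd_powers]). Integrating N from 0 in both
    variables gives a kernel Psi, again positive definite as a limit of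
    Riemann sums ([double_primitive]). Then log L(w, w) - Psi(w, w) is
    harmonic, hence equal to F + conj F + c for some holomorphic F and some
    real constant c, and L^t is the product of the rank one kernel
    E(z) conj (E(w)), with E = exp (t (F + c / 2)), and of exp (t Psi). Both
    are positive definite, and so is their product, by the Schur product
    theorem ([pdM], [pd_cexp]).

    Conversely, suppose that every L^t is positive definite ([pd_ddlog]). So
    is N_t, the mixed derivative of L^t divided by t, being a limit of second
    differences ([limF_second_diff]), and its diagonal tends to
    d dbar log L(w, w) as t tends to 0. A positive definite kernel is
    controlled by its diagonal ([pd_bound]), so the N_t are locally bounded
    and converge along an ultrafilter to a kernel polarizing that function.

    These arguments need kernels that are jointly smooth, and for this it is
    enough that they be holomorphic in each variable separately and bounded
    on compact sets ([bihol]). For K the bound is where the operator enters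
    ([kernel_local_bound]): as Mstar - conj z0 is onto with a one-dimensional
    kernel, the open mapping theorem keeps the norm of the kernel function at
    w bounded for w near z0.

    The complex analysis rests on one estimate, Taylor's formula of order two
    with a remainder depending only on a bound of the function ([taylor]). It
    comes from Cauchy's formula on a circle, and this from Goursat's theorem
    on rectangles ([goursat], [cauchy_formula]). *)

(** * The modulus as a real number *)

Section Modulus.
Variable R : realType.
Local Notation C := R[i].
Implicit Types (x y : R) (z w u : C).

(** The modulus of [R[i]] is a number of [R[i]]; estimates are made in the
    ordered field [R]. *)
Definition cabs z : R := complex.Re `|z|.

Lemma cabsE z : `|z| = (cabs z)%:C%C. Proof. by []. Qed.

Lemma cabs_ge0 z : 0 <= cabs z.
Proof. by rewrite -lecR -cabsE normr_ge0. Qed.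

Lemma cabs0 : cabs 0 = 0. Proof. by rewrite /cabs normr0. Qed.
Lemma cabs1 : cabs 1 = 1. Proof. by rewrite /cabs normr1. Qed.

Lemma cabs_eq0 z : (cabs z == 0) = (z == 0).
Proof.
by apply/eqP/eqP => [h|->]; [apply/eqP; rewrite -normr_eq0 cabsE h|exact: cabs0].
Qed.

Lemma cabs_gt0 z : (0 < cabs z) = (z != 0).
Proof. by rewrite lt_def cabs_eq0 cabs_ge0 andbT. Qed.

Lemma cabsM z w : cabs (z * w) = cabs z * cabs w.
Proof. by apply: (@complexI R); rewrite rmorphM -!cabsE normrM. Qed.

Lemma cabsX z n : cabs (z ^+ n) = cabs z ^+ n.
Proof. by apply: (@complexI R); rewrite rmorphXn -!cabsE normrX. Qed.

Lemma cabsV z : cabs z^-1 = (cabs z)^-1.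
Proof. by apply: (@complexI R); rewrite fmorphV -!cabsE normfV. Qed.

Lemma cabsN z : cabs (- z) = cabs z.
Proof. by rewrite /cabs normrN. Qed.

Lemma cabsBC z w : cabs (z - w) = cabs (w - z).
Proof. by rewrite -cabsN opprB. Qed.

Lemma cabsD z w : cabs (z + w) <= cabs z + cabs w.
Proof. by rewrite -lecR rmorphD -!cabsE ler_normD. Qed.

Lemma cabsB z w : cabs (z - w) <= cabs z + cabs w.
Proof. by rewrite -(cabsN w) cabsD. Qed.

Lemma cabs_le_dist z w : cabs z <= cabs w + cabs (z - w).
Proof. by rewrite -{1}[z](subrKC w) cabsD. Qed.

Lemma cabs_real x : cabs x%:C%C = `|x|.
Proof.
by apply: (@complexI R); rewrite -cabsE normc_def/= expr0n addr0 sqrtr_sqr.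
Qed.

Lemma cabs_conj z : cabs z^* = cabs z.
Proof. by rewrite /cabs norm_conjC. Qed.

Lemma conj_realC x : (x%:C%C : C)^* = x%:C%C.
Proof. exact: conjc_real. Qed.

Lemma cabs_i : cabs 'i%C = 1.
Proof.
by apply: (@complexI R); rewrite -cabsE normc_def/= expr0n add0r expr1n sqrtr1.
Qed.

Lemma cabs_Re z : `|complex.Re z| <= cabs z.
Proof. by rewrite -lecR -cabsE normc_ge_Re. Qed.

Lemma cabs_Im z : `|complex.Im z| <= cabs z.
Proof.
by rewrite -normrN -ReiNIm (le_trans (cabs_Re _))// cabsM cabs_i mulr1.
Qed.

Lemma cabs_le_ReIm z : cabs z <= `|complex.Re z| + `|complex.Im z|.
Proof.
rewrite {1}(complexE z) (le_trans (cabsD _ _))// cabsM cabs_i mul1r.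
by rewrite !cabs_real.
Qed.

Lemma cabs_sqr z : cabs z ^+ 2 = complex.Re z ^+ 2 + complex.Im z ^+ 2.
Proof. by apply: (@complexI R); rewrite add_Re2_Im2 cabsE -rmorphXn. Qed.

Lemma cabs_sum (I : Type) (r : seq I) (P : pred I) (F : I -> C) :
  cabs (\sum_(i <- r | P i) F i) <= \sum_(i <- r | P i) cabs (F i).
Proof.
elim/big_rec2: _ => [|i y1 y2 _ h]; first by rewrite cabs0.
by rewrite (le_trans (cabsD _ _))// lerD2l.
Qed.

Lemma discE z : disc R z <-> cabs z < 1.
Proof. by rewrite /disc/= cabsE -ltcR. Qed.

Lemma cabs_small z : (forall e, 0 < e -> cabs z <= e) -> z = 0.
Proof.
move=> h; apply/eqP; rewrite -cabs_eq0 eq_le cabs_ge0 andbT.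
by apply/ler_addgt0Pr => e e0; rewrite add0r h.
Qed.

End Modulus.

(** * Wirtinger derivatives *)

Section Wirtinger.
Variable R : realType.
Local Notation C := R[i].
Implicit Types (e d x : R) (z w p q : C) (f g : C -> C).

Definition little (r : C -> C) := forall e, 0 < e ->
  exists2 d, 0 < d & forall h, cabs h < d -> cabs (r h) <= e * cabs h.

(** Real differentiability of [g] at [w], where [p] and [q] are the Wirtinger
    derivatives dg and dbar g; holomorphy is the case [q = 0]. *)
Definition hasW g w p q := little (fun h => g (w + h) - g w - (p * h + q * h^*)).
Definition hasD f z l := hasW f z l 0.

Lemma little_ext r1 r2 d : 0 < d -> (forall h, cabs h < d -> r1 h = r2 h) ->
  little r1 -> little r2.
Proof.
move=> d0 E L e e0; have [d1 d10 H] := L e e0.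
exists (Num.min d d1); first by rewrite lt_min d0.
by move=> h; rewrite lt_min => /andP[h1 h2]; rewrite -E// H.
Qed.

Lemma littleD r1 r2 : little r1 -> little r2 -> little (fun h => r1 h + r2 h).
Proof.
move=> L1 L2 e e0; have e20 : 0 < e / 2 by lra.
have [d1 d10 H1] := L1 _ e20; have [d2 d20 H2] := L2 _ e20.
exists (Num.min d1 d2); first by rewrite lt_min d10.
move=> h; rewrite lt_min => /andP[h1 h2]; rewrite (le_trans (cabsD _ _))//.
by have := H1 _ h1; have := H2 _ h2; lra.
Qed.

Lemma little_bounded r r2 K d : 0 < d ->
    (forall h, cabs h < d -> cabs (r2 h) <= K * cabs (r h)) ->
  little r -> little r2.
Proof.
move=> d0 E L e e0; have K1 : 0 < `|K| + 1 by rewrite ltr_wpDl.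
have [d1 d10 H] := L (e / (`|K| + 1)) (divr_gt0 e0 K1).
exists (Num.min d d1); first by rewrite lt_min d0.
move=> h; rewrite lt_min => /andP[h1 h2]; rewrite (le_trans (E _ h1))//.
have := H _ h2; rewrite mulrAC ler_pdivlMr//.
have := ler_norm K; have := cabs_ge0 (r h); nra.
Qed.

Lemma littleM r a : little r -> little (fun h => a * r h).
Proof.
by apply: (@little_bounded _ _ (cabs a) 1) => // h _; rewrite cabsM.
Qed.

Lemma little_sqr r K d : 0 < d ->
  (forall h, cabs h < d -> cabs (r h) <= K * cabs h ^+ 2) -> little r.
Proof.
move=> d0 H e e0; have K1 : 0 < `|K| + 1 by rewrite ltr_wpDl.
exists (Num.min d (e / (`|K| + 1))); first by rewrite lt_min d0 divr_gt0.
move=> h; rewrite lt_min => /andP[h1]; rewrite ltr_pdivlMr// => h2.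
rewrite (le_trans (H _ h1))// expr2 mulrA ler_wpM2r ?cabs_ge0//.
have := ler_norm K; have := cabs_ge0 h; nra.
Qed.

(** Along the real and the imaginary direction the form reads h (p + q) and i
    h (p - q). *)
Lemma little_lin_eq0 p q : little (fun h => p * h + q * h^*) -> p = 0 /\ q = 0.
Proof.
move=> L.
have H (v : C) : cabs v = 1 -> p * v + q * v^* = 0.
  move=> v1; apply: cabs_small => e e0; have [d d0 H] := L e e0.
  pose t : C := (d / 2)%:C%C.
  have ct : t^* = t by exact: conj_realC.
  have at_ : cabs t = d / 2 by rewrite cabs_real gtr0_norm; lra.
  have := H (t * v); rewrite rmorphM/= ct.
  have -> : p * (t * v) + q * (t * v^*) = t * (p * v + q * v^*) by ring.
  rewrite !cabsM at_ v1 mulr1 => /(_ ltac:(lra)).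
  by rewrite mulrC ler_pM2r; lra.
have H1 := H 1 (cabs1 R); have H2 := H 'i%C (cabs_i R).
rewrite conjC1 !mulr1 in H1.
have ic : Num.conj ('i%C : C) = - 'i%C by apply/eqP; rewrite eq_complex/= oppr0 !eqxx.
rewrite ic in H2.
have q0 : q = - p by apply/eqP; rewrite -addr_eq0 addrC H1.
move: H2; rewrite q0 mulrNN -mulrDr => /eqP; rewrite mulf_eq0.
have -> : ('i%C + 'i%C == 0 :> C) = false.
  by rewrite eq_complex/= addr0 eqxx/= -mulr2n pnatr_eq0.
by rewrite orbF => /eqP ->; rewrite oppr0.
Qed.

Lemma hasW_uniq g w p q p' q' : hasW g w p q -> hasW g w p' q' ->
  p = p' /\ q = q'.
Proof.
move=> H H'; have := littleD H' (littleM (- 1) H).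
move=> /(@little_ext _ (fun h => (p - p') * h + (q - q') * h^*) 1 ltr01).
case/(_ _)/little_lin_eq0; first by move=> h _; ring.
by move=> /subr0_eq -> /subr0_eq ->.
Qed.

Lemma hasD_uniq f z l l' : hasD f z l -> hasD f z l' -> l = l'.
Proof. by move=> H /(hasW_uniq H)[]. Qed.

Lemma hasW_ext g1 g2 w p q d : 0 < d ->
    (forall z, cabs (z - w) < d -> g1 z = g2 z) ->
  hasW g1 w p q -> hasW g2 w p q.
Proof.
move=> d0 E; apply: (little_ext d0) => h hd.
by rewrite !E// ?subrr ?cabs0// addrAC subrr add0r.
Qed.

Lemma hasW_eq g w p q p' q' : hasW g w p q -> p = p' -> q = q' -> hasW g w p' q'.
Proof. by move=> ? <- <-. Qed.

Lemma hasW_cst c w : hasW (cst c) w 0 0.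
Proof.
by move=> e e0; exists 1 => // h _; rewrite subrr !mul0r addr0 subr0 cabs0 mulr_ge0 ?cabs_ge0// ltW.
Qed.

Lemma hasW_id w : hasW id w 1 0.
Proof.
move=> e e0; exists 1 => // h _.
by rewrite /= mul0r mul1r addr0 [w + h]addrC addrK subrr cabs0 mulr_ge0 ?cabs_ge0// ltW.
Qed.

Lemma hasW_conj w : hasW (@Num.conj C) w 0 1.
Proof.
move=> e e0; exists 1 => // h _.
by rewrite rmorphD/= mul0r add0r mul1r [w^* + _]addrC addrK subrr cabs0
  mulr_ge0 ?cabs_ge0// ltW.
Qed.

Lemma hasW_lip g w p q : hasW g w p q ->
  exists2 d, 0 < d & forall h, cabs h < d ->
    cabs (g (w + h) - g w) <= (cabs p + cabs q + 1) * cabs h.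
Proof.
move=> H; have [d d0 Hd] := H 1 ltr01; exists d => // h /Hd.
have := cabs_le_dist (g (w + h) - g w) (p * h + q * h^*).
have := cabsD (p * h) (q * h^*); rewrite !cabsM cabs_conj; lra.
Qed.

Lemma hasW_cont g w p q : hasW g w p q -> forall e, 0 < e ->
  exists2 d, 0 < d & forall z, cabs (z - w) < d -> cabs (g z - g w) < e.
Proof.
move=> /hasW_lip[d d0 H] e e0; pose K := cabs p + cabs q + 1.
have K0 : 0 < K by rewrite /K ltr_wpDl// addr_ge0 ?cabs_ge0.
exists (Num.min d (e / K)); first by rewrite lt_min d0 divr_gt0.
move=> z; rewrite lt_min => /andP[/H + h2].
by rewrite subrKC => /le_lt_trans; apply; rewrite mulrC -ltr_pdivlMr.
Qed.

Lemma hasWD g1 g2 w p1 q1 p2 q2 : hasW g1 w p1 q1 -> hasW g2 w p2 q2 ->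
  hasW (fun z => g1 z + g2 z) w (p1 + p2) (q1 + q2).
Proof.
move=> H1 H2; apply: little_ext ltr01 _ (littleD H1 H2) => h _; ring.
Qed.

Lemma hasWZ a g w p q : hasW g w p q -> hasW (fun z => a * g z) w (a * p) (a * q).
Proof. move=> H; apply: little_ext ltr01 _ (littleM a H) => h _; ring. Qed.

Lemma hasWN g w p q : hasW g w p q -> hasW (fun z => - g z) w (- p) (- q).
Proof.
move=> H; apply: little_ext ltr01 _ (littleM (-1) H) => h _; ring.
Qed.

Lemma hasWB g1 g2 w p1 q1 p2 q2 : hasW g1 w p1 q1 -> hasW g2 w p2 q2 ->
  hasW (fun z => g1 z - g2 z) w (p1 - p2) (q1 - q2).
Proof. by move=> H1 H2; apply: hasWD => //; apply: hasWN. Qed.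

Lemma hasWM g1 g2 w p1 q1 p2 q2 : hasW g1 w p1 q1 -> hasW g2 w p2 q2 ->
  hasW (fun z => g1 z * g2 z) w (p1 * g2 w + g1 w * p2) (q1 * g2 w + g1 w * q2).
Proof.
move=> H1 H2.
have [d1 d10 L1] := hasW_lip H1; have [d2 d20 L2] := hasW_lip H2.
set K1 := _ + 1 in L1; set K2 := _ + 1 in L2.
have L : little (fun h => (g1 (w + h) - g1 w) * (g2 (w + h) - g2 w)).
  apply: (@little_sqr _ (K1 * K2) (Num.min d1 d2)); first by rewrite lt_min d10.
  move=> h; rewrite lt_min => /andP[/L1 h1 /L2 h2].
  by rewrite cabsM expr2 mulrACA ler_pM ?cabs_ge0.
have := littleD L (littleD (littleM (g1 w) H2) (littleM (g2 w) H1)).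
apply: little_ext ltr01 _ => h _; ring.
Qed.

Lemma hasW_comp f g w a b p q : hasW f (g w) a b -> hasW g w p q ->
  hasW (f \o g) w (a * p + b * q^*) (a * q + b * p^*).
Proof.
move=> Hf Hg; have [d1 d10 L1] := hasW_lip Hg; set K := _ + 1 in L1.
have K0 : 0 < K by rewrite /K ltr_wpDl// addr_ge0 ?cabs_ge0.
pose k h := g (w + h) - g w.
have L : little (fun h => f (g w + k h) - f (g w) - (a * k h + b * (k h)^*)).
  move=> e e0; have [d2 d20 L2] := Hf (e / K) (divr_gt0 e0 K0).
  exists (Num.min d1 (d2 / K)); first by rewrite lt_min d10 divr_gt0.
  move=> h; rewrite lt_min => /andP[/L1 h1]; rewrite ltr_pdivlMr// => h2.
  have kd : cabs (k h) < d2 by apply: le_lt_trans h1 _; rewrite mulrC.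
  rewrite (le_trans (L2 _ kd))// mulrAC ler_pdivrMr// -mulrA ler_wpM2l ?(ltW e0)//.
  by rewrite mulrC.
have Lc : little (fun h => (k h - (p * h + q * h^*))^*).
  by apply: (@little_bounded _ _ 1 1 ltr01 _ Hg) => h _; rewrite mul1r cabs_conj.
have := littleD L (littleD (littleM a Hg) (littleM b Lc)).
apply: little_ext ltr01 _ => h _.
rewrite /k /comp subrKC !rmorphB !rmorphD !rmorphM /= conjCK.
set x := Num.conj (g (w + h)); set y := Num.conj (g w); ring.
Qed.

Lemma hasW_inv w : w != 0 -> hasW (fun z => z^-1) w (- w^-2) 0.
Proof.
move=> w0; have c0 : 0 < cabs w by rewrite cabs_gt0.
apply: (@little_sqr _ (2 / cabs w ^+ 3) (cabs w / 2)); first lra.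
move=> h hd; have h0 : cabs w / 2 <= cabs (w + h).
  have := cabs_le_dist w (w + h).
  by rewrite opprD addNKr cabsN; lra.
have wh0 : w + h != 0 by rewrite -cabs_gt0; lra.
rewrite mul0r addr0.
have -> : (w + h)^-1 - w^-1 - - w ^- 2 * h = h ^+ 2 / (w ^+ 2 * (w + h)).
  by field; rewrite wh0 w0.
have hv : (cabs (w + h))^-1 <= 2 / cabs w.
  by rewrite -[2 / _]invrK invf_div lef_pV2 ?posrE ?divr_gt0//; lra.
rewrite cabsM cabsV cabsM !cabsX mulrC ler_wpM2r ?sqr_ge0//.
have -> : 2 / cabs w ^+ 3 = (cabs w ^+ 2)^-1 * (2 / cabs w) by field; lra.
by rewrite invfM ler_wpM2l// invr_ge0 sqr_ge0.
Qed.

Lemma hasW_invr g w p q : g w != 0 -> hasW g w p q ->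
  hasW (fun z => (g z)^-1) w (- p / g w ^+ 2) (- q / g w ^+ 2).
Proof.
move=> g0 H; apply: hasW_eq (hasW_comp (hasW_inv g0) H) _ _; rewrite mul0r addr0;
 by rewrite mulrC mulrN mulNr.
Qed.

Lemma hasW_conjr g w p q : hasW g w p q -> hasW (fun z => (g z)^*) w q^* p^*.
Proof.
by move=> H; apply: hasW_eq (hasW_comp (hasW_conj (g w)) H) _ _; rewrite mul0r mul1r add0r.
Qed.

(** Conjugation exchanges the two Wirtinger derivatives, so they are conjugate
    to each other for a real function. *)
Lemma hasW_real g w p q d : 0 < d ->
    (forall z, cabs (z - w) < d -> (g z)^* = g z) -> hasW g w p q ->
  p = q^*.
Proof.
by move=> d0 E H; case: (hasW_uniq H (hasW_ext d0 E (hasW_conjr H))).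
Qed.

Lemma hasDD f1 f2 z l1 l2 : hasD f1 z l1 -> hasD f2 z l2 ->
  hasD (fun u => f1 u + f2 u) z (l1 + l2).
Proof. by move=> H1 /(hasWD H1); rewrite addr0. Qed.
Lemma hasDB f1 f2 z l1 l2 : hasD f1 z l1 -> hasD f2 z l2 ->
  hasD (fun u => f1 u - f2 u) z (l1 - l2).
Proof. by move=> H1 /(hasWB H1); rewrite subr0. Qed.
Lemma hasDZ a f z l : hasD f z l -> hasD (fun u => a * f u) z (a * l).
Proof. by move=> /(hasWZ a); rewrite mulr0. Qed.
Lemma hasDM f1 f2 z l1 l2 : hasD f1 z l1 -> hasD f2 z l2 ->
  hasD (fun u => f1 u * f2 u) z (l1 * f2 z + f1 z * l2).
Proof. by move=> H1 /(hasWM H1); rewrite mul0r mulr0 addr0. Qed.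
Lemma hasD_comp f g z a p : hasD f (g z) a -> hasD g z p ->
  hasD (f \o g) z (a * p).
Proof. by move=> H1 /(hasW_comp H1); rewrite !mul0r mulr0 !addr0. Qed.
Lemma hasD_conjconj f z l : hasD f z^* l -> hasD (fun u => (f u^*)^*) z l^*.
Proof.
move=> H; apply: hasW_eq (hasW_conjr (hasW_comp H (hasW_conj z))) _ _.
  by rewrite mulr1 mul0r addr0.
by rewrite mulr0 mul0r addr0 rmorph0.
Qed.

End Wirtinger.

(** * Curves and directional derivatives *)

Section Bridges.
Variable R : realType.
Local Notation C := R[i].
Implicit Types (e d x t : R) (z w p q l : C) (f g : C -> C) (c : R -> C).

Lemma gt0_real_complex z : 0 < z -> exists2 x, 0 < x & z = x%:C%C.
Proof.
by case: z => a b; rewrite ltcE/= => /andP[/eqP -> ?]; exists a.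
Qed.

Lemma derivable_hasD f z :
  derivable (f : C^o -> C^o) z 1 <-> exists l, hasD f z l.
Proof.
split=> [/cvg_ex[l /cvgrPdist_lt H]|[l H]].
- exists l => e e0.
  have /H : 0 < e%:C%C :> C by rewrite ltcR.
  rewrite /dnbhs near_withinE => /nbhs_ballP[d /= /gt0_real_complex[x x0 ->] Hd].
  exists x => // h hx; have [->|h0] := eqVneq h 0.
    by rewrite addr0 subrr rmorph0 !mulr0 addr0 subr0 cabs0 mulr0.
  have /= := Hd h; rewrite -ball_normE/= sub0r normrN cabsE ltcR => /(_ hx h0).
  rewrite cabsE ltcR mul0r addr0 /shift/= => Hl.
  have -> : f (z + h) - f z - l * h = - h * (l - h^-1 *: (f (h *: 1 + z) - f z)).
    have -> : h *: 1 = h :> C by rewrite -[RHS]mulr1.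
    have -> : h^-1 *: (f (h + z) - f z) = h^-1 * (f (h + z) - f z) by [].
    by rewrite (addrC h z); field.
  by rewrite cabsM cabsN mulrC ler_wpM2r ?cabs_ge0// ltW.
- apply/cvg_ex; exists l; apply/cvgrPdist_le => e0 /gt0_real_complex[e e_gt0 ->].
  have [d d0 Hd] := H e e_gt0.
  rewrite /dnbhs near_withinE; apply/nbhs_ballP; exists d%:C%C => /=.
    by rewrite ltcR.
  move=> h; rewrite -ball_normE/= sub0r normrN cabsE ltcR => hd h0.
  rewrite cabsE lecR /shift/=.
  have := Hd _ hd; rewrite mul0r addr0.
  have -> : f (z + h) - f z - l * h = - h * (l - h^-1 *: (f (h *: 1 + z) - f z)).
    have -> : h *: 1 = h :> C by rewrite -[RHS]mulr1.
    have -> : h^-1 *: (f (h + z) - f z) = h^-1 * (f (h + z) - f z) by [].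
    by rewrite (addrC h z); field.
  by rewrite cabsM cabsN mulrC ler_pM2r// cabs_gt0.
Qed.

Lemma is_derive_eps (phi : R -> R) x (l : R) : is_derive x 1 phi l <->
  forall e, 0 < e -> exists2 d, 0 < d &
    forall h : R, `|h| < d -> `|phi (x + h) - phi x - l * h| <= e * `|h|.
Proof.
have E (h : R) : h != 0 -> phi (x + h) - phi x - l * h =
    - h * (l - h^-1 *: (phi (h *: 1 + x) - phi x)).
  move=> h0; have -> : h *: 1 = h :> R by rewrite -[RHS]mulr1.
  have -> : h^-1 *: (phi (h + x) - phi x) = h^-1 * (phi (h + x) - phi x) by [].
  by rewrite (addrC h x); field.
split=> [[dv v] e e0|H].
- move: dv; rewrite /derivable -[lim _]/('D_1 phi x) v => /cvgrPdist_lt/(_ e e0).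
  rewrite /dnbhs near_withinE => /nbhs_ballP[d /= d0 Hd].
  exists d => // h hx; have [->|h0] := eqVneq h 0.
    by rewrite addr0 subrr !mulr0 subr0 normr0 mulr0.
  have /= := Hd h; rewrite -ball_normE/= sub0r normrN => /(_ hx h0).
  rewrite E// normrM normrN mulrC => Hl.
  by rewrite ler_wpM2r// ltW.
- have Hc : h^-1 *: ((phi \o shift x) (h *: 1) - phi x) @[h --> 0^'] --> l.
    apply/cvgrPdist_le => e e0; have [d d0 Hd] := H e e0.
    rewrite /dnbhs near_withinE; apply/nbhs_ballP; exists d => //= h.
    rewrite -ball_normE/= sub0r normrN => hd h0.
    have := Hd _ hd; rewrite E// normrM normrN mulrC.
    by rewrite ler_pM2r// normr_gt0.
  split; first by apply/cvg_ex; exists l.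
  by apply: cvg_lim.
Qed.

Definition derR c t l := forall e, 0 < e -> exists2 d, 0 < d &
  forall h : R, `|h| < d -> cabs (c (t + h) - c t - h%:C%C * l) <= e * `|h|.

(** A curve is the restriction to the real axis of the function z |-> c (Re
    z); this deduces the rules of differentiation of curves from those of
    Wirtinger derivatives. *)
Lemma derR_hasW c t l :
  derR c t l <-> hasW (fun z => c (complex.Re z)) t%:C%C (l / 2) (l / 2).
Proof.
have ReE (h : C) : l / 2 * h + l / 2 * h^* = (complex.Re h)%:C%C * l.
  by rewrite ReJ_add -/(conjc h); field.
split=> H e e0; have [d d0 Hd] := H e e0; exists d => // h hd.
- rewrite raddfD/= ReE (le_trans (Hd _ (le_lt_trans (cabs_Re _) hd)))//.
  by rewrite ler_wpM2l ?(ltW e0)// cabs_Re.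
- by have := Hd h%:C%C; rewrite cabs_real raddfD/= ReE => /(_ hd).
Qed.

Lemma derR_eq c t l l' : derR c t l -> l = l' -> derR c t l'.
Proof. by move=> ? <-. Qed.

Lemma derR_ext c1 c2 t l d : 0 < d -> (forall s, `|s - t| < d -> c1 s = c2 s) ->
  derR c1 t l -> derR c2 t l.
Proof.
move=> d0 E H e e0; have [d1 d10 H1] := H e e0.
exists (Num.min d d1); first by rewrite lt_min d0.
move=> h; rewrite lt_min => /andP[h1 h2].
by rewrite -!E ?H1// ?subrr ?normr0// addrC addKr.
Qed.

Lemma derR_comp g c t p q l : hasW g (c t) p q -> derR c t l ->
  derR (g \o c) t (p * l + q * l^*).
Proof.
move=> Hg /derR_hasW Hc; apply/derR_hasW.
apply: hasW_eq (hasW_comp (g := fun z => c (complex.Re z)) Hg Hc) _ _;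
  by rewrite rmorphM fmorphV rmorph_nat; field.
Qed.

Lemma derR_compD f c t a l : hasD f (c t) a -> derR c t l ->
  derR (f \o c) t (a * l).
Proof. by move=> Hf /(derR_comp Hf); rewrite mul0r addr0. Qed.

Lemma derRD c1 c2 t l1 l2 : derR c1 t l1 -> derR c2 t l2 ->
  derR (fun s => c1 s + c2 s) t (l1 + l2).
Proof.
move=> /derR_hasW H1 /derR_hasW H2; apply/derR_hasW.
by apply: hasW_eq (hasWD H1 H2) _ _; field.
Qed.

Lemma derRB c1 c2 t l1 l2 : derR c1 t l1 -> derR c2 t l2 ->
  derR (fun s => c1 s - c2 s) t (l1 - l2).
Proof.
move=> /derR_hasW H1 /derR_hasW H2; apply/derR_hasW.
by apply: hasW_eq (hasWB H1 H2) _ _; field.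
Qed.

Lemma derRM c1 c2 t l1 l2 : derR c1 t l1 -> derR c2 t l2 ->
  derR (fun s => c1 s * c2 s) t (l1 * c2 t + c1 t * l2).
Proof.
move=> /derR_hasW H1 /derR_hasW H2; apply/derR_hasW.
by apply: hasW_eq (hasWM H1 H2) _ _ => /=; field.
Qed.

Lemma derRZ a c t l : derR c t l -> derR (fun s => a * c s) t (a * l).
Proof.
move=> /derR_hasW H; apply/derR_hasW.
by apply: hasW_eq (hasWZ a H) _ _; field.
Qed.

Lemma derR_cst a t : derR (cst a) t 0.
Proof. by apply/derR_hasW; rewrite mul0r; exact: hasW_cst. Qed.

Lemma derR_lin a b t : derR (fun s => a + s%:C%C * b) t b.
Proof.
move=> e e0; exists 1 => // h _; rewrite rmorphD/=.
have -> : a + (t%:C%C + h%:C%C) * b - (a + t%:C%C * b) - h%:C%C * b = 0 by ring.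
by rewrite cabs0 mulr_ge0 // ltW.
Qed.

Lemma derR_real (phi : R -> R) t (l : R) : is_derive t 1 phi l ->
  derR (fun s => (phi s)%:C%C) t l%:C%C.
Proof.
move=> /is_derive_eps H e e0; have [d d0 Hd] := H e e0; exists d => // h /Hd.
by rewrite -rmorphM -!rmorphB cabs_real (mulrC l).
Qed.

Lemma derR_Re c t l : derR c t l ->
  is_derive t 1 (fun s => complex.Re (c s)) (complex.Re l).
Proof.
move=> H; apply/is_derive_eps => e e0; have [d d0 Hd] := H e e0; exists d => // h /Hd.
apply: le_trans; rewrite (le_trans _ (cabs_Re _))// !raddfB/=.
suff -> : complex.Re (h%:C%C * l) = complex.Re l * h by [].
by case: l {H Hd} => a b /=; rewrite mul0r subr0 mulrC.
Qed.

Lemma derR_Im c t l : derR c t l ->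
  is_derive t 1 (fun s => complex.Im (c s)) (complex.Im l).
Proof.
move=> H; apply/is_derive_eps => e e0; have [d d0 Hd] := H e e0; exists d => // h /Hd.
apply: le_trans; rewrite (le_trans _ (cabs_Im _))// !raddfB/=.
suff -> : complex.Im (h%:C%C * l) = complex.Im l * h by [].
by case: l {H Hd} => a b /=; rewrite mul0r addr0 mulrC.
Qed.

Lemma derR_ReIm (phi psi : R -> R) t (l m : R) :
  is_derive t 1 phi l -> is_derive t 1 psi m ->
  derR (fun s => Complex (phi s) (psi s)) t (Complex l m).
Proof.
move=> /derR_real H1 /derR_real H2.
have := derRD H1 (derRZ 'i%C H2).
have -> : l%:C%C + 'i%C * m%:C%C = Complex l m by rewrite [RHS]complexE.
apply: derR_ext ltr01 _ => s _; by rewrite [RHS]complexE.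
Qed.

(** The real mean value theorem applies to the component of the curve in the
    direction of [c b - c a]. *)
Lemma derR_lip c dc (a b M : R) : a <= b ->
    (forall t, a <= t <= b -> derR c t (dc t)) ->
    (forall t, a <= t <= b -> cabs (dc t) <= M) ->
  cabs (c b - c a) <= M * (b - a).
Proof.
move=> ab H HM; set D := c b - c a.
have [->|D0] := eqVneq D 0.
  rewrite cabs0 mulr_ge0 ?subr_ge0// (le_trans (cabs_ge0 (dc a)))// HM//.
  by rewrite lexx.
pose phi t := complex.Re (D^* * c t).
have Hphi t : a <= t <= b -> is_derive t 1 phi (complex.Re (D^* * dc t)).
  by move=> /H/(derRZ D^*)/derR_Re.
have [||x xab] := @MVT_segment _ phi (fun t => complex.Re (D^* * dc t)) a b ab.
- by move=> x; rewrite in_itv/= => /andP[ax xb]; apply: Hphi; rewrite !ltW.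
- apply: derivable_within_continuous => x; rewrite in_itv/= => xab.
  by case: (Hphi x xab).
rewrite /phi -raddfB -mulrBr -/D => E.
have DD : complex.Re (D^* * D) = cabs D ^+ 2.
  by rewrite -normCKC cabsE -rmorphXn.
have := cabs_Re (D^* * dc x); rewrite cabsM cabs_conj.
have xab' : a <= x <= b by move: xab; rewrite in_itv.
have := HM _ xab'; have D1 : 0 < cabs D by rewrite cabs_gt0.
move=> h1 h2.
have {}E : cabs D ^+ 2 = complex.Re (D^* * dc x) * (b - a) by rewrite -DD; exact: E.
have h3 : complex.Re (D^* * dc x) <= cabs D * M.
  by rewrite (le_trans (ler_norm _))// (le_trans h2)// ler_wpM2l// ltW.
have ba0 : 0 <= b - a by rewrite subr_ge0.
have : cabs D * cabs D <= cabs D * (M * (b - a)).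
  by rewrite -expr2 E mulrA ler_wpM2r.
by rewrite ler_pM2l.
Qed.

Lemma derR0_cst c (a b : R) : (forall t, a <= t <= b -> derR c t 0) ->
  a <= b -> c b = c a.
Proof.
move=> H ab; apply/subr0_eq/cabs_small => e e0.
rewrite (le_trans (derR_lip ab H (M := 0) _))// ?mul0r ?(ltW e0)//.
by move=> t _; rewrite cabs0.
Qed.

Lemma dir_derive_hasW v g w p q : hasW g w p q ->
  dir_derive v g w = p * v + q * v^*.
Proof.
move=> H.
have := @derR_comp g (fun t => w + t%:C%C * v) 0 p q v.
rewrite mul0r addr0 => /(_ H (derR_lin w v 0)) Hd.
rewrite /dir_derive !derive1E.
rewrite (@derive_val _ _ _ _ _ _ _ (derR_Re Hd)).
rewrite (@derive_val _ _ _ _ _ _ _ (derR_Im Hd)).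
by case: (_ + _).
Qed.

Lemma conj_i : ('i%C : C)^* = - 'i%C.
Proof. by apply/eqP; rewrite eq_complex/= oppr0 !eqxx. Qed.

Lemma d_w_hasW g w p q : hasW g w p q -> d_w g w = p.
Proof.
move=> H; rewrite /d_w !(dir_derive_hasW _ H) conjC1 conj_i.
have ii : 'i%C * 'i%C = -1 :> C by rewrite -expr2 sqr_i.
rewrite !mulr1 mulrDr mulrCA ii mulrN (mulrCA _ q) mulrN ii.
by field.
Qed.

Lemma d_wbar_hasW g w p q : hasW g w p q -> d_wbar g w = q.
Proof.
move=> H; rewrite /d_wbar !(dir_derive_hasW _ H) conjC1 conj_i.
have ii : 'i%C * 'i%C = -1 :> C by rewrite -expr2 sqr_i.
rewrite !mulr1 mulrDr mulrCA ii mulrN (mulrCA _ q) mulrN ii.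
by field.
Qed.

Lemma hasW_Re (phi : R -> R) z (l : R) : is_derive (complex.Re z) 1 phi l ->
  hasW (fun u => (phi (complex.Re u))%:C%C) z (l%:C%C / 2) (l%:C%C / 2).
Proof.
move=> /derR_real /derR_hasW H e e0; have [d d0 Hd] := H e e0; exists d => // h /Hd.
by rewrite !raddfD.
Qed.

End Bridges.

(** * Goursat's theorem and holomorphic primitives *)

Section Goursat.
Variable R : realType.
Local Notation C := R[i].
Implicit Types (e d x y p q t u v : R) (z w a : C) (f g : C -> C) (c : R -> C).

Lemma exp2_gt (b : R) : exists n : nat, b < 2 ^+ n.
Proof.
exists (Num.truncn b).+1; apply: (lt_le_trans (Num.Theory.truncnS_gt b)).
by rewrite -natrX ler_nat ltnW// ltn_expl.
Qed.

Lemma nested_intervals (X : nat -> R) p : 0 <= p ->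
    (forall n, X n <= X n.+1 <= X n + p / 2 ^+ n.+1) ->
  exists u, forall n, X n <= u <= X n + p / 2 ^+ n.
Proof.
move=> p0 HX.
have up n k : X n <= X (n + k)%N.
  by elim: k => [|k /le_trans]; rewrite ?addn0// addnS; apply; case/andP: (HX (n + k)%N).
have dn n k : X (n + k)%N + p / 2 ^+ (n + k) <= X n + p / 2 ^+ n.
  elim: k => [|k IH]; rewrite ?addn0// addnS (le_trans _ IH)//.
  have /andP[_ h] := HX (n + k)%N.
  have -> : p / 2 ^+ (n + k) = p / 2 ^+ (n + k).+1 + p / 2 ^+ (n + k).+1.
    by rewrite exprS; field; rewrite expf_neq0.
  by rewrite addrA lerD2r.
have pn n : 0 <= p / 2 ^+ n by rewrite divr_ge0// exprn_ge0.
have XX m n : X m <= X n + p / 2 ^+ n.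
  case: (leqP m n) => mn.
    rewrite -(subnKC mn) (le_trans (up m (n - m)%N))// lerDl//.
  have := dn n (m - n)%N; rewrite subnKC ?(ltnW mn)//; apply: le_trans.
  by rewrite lerDl.
have nX : has_sup (range X).
  split; first by exists (X 0%N); exists 0%N.
  by exists (X 0%N + p / 2 ^+ 0) => _ [m _ <-].
exists (sup (range X)) => n; apply/andP; split.
  by apply: ub_le_sup; [case: nX | exists n].
by apply: ge_sup; [case: nX | move=> _ [m _ <-]].
Qed.

(** Cousin's lemma for rectangles with corner [(x, y)] and sides [p] and [q].
    A rectangle violating [P] has a quarter violating it, and so on; these
    quarters shrink to a point, near which [P] holds for all small rectangles.
    This is the form in which compactness is used: for Goursat's theorem, for
    uniform continuity, and to pass from local to uniform bounds. *)
Lemma rect_induction (P : R -> R -> R -> R -> Prop) :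
    (forall x y p q, P x y (p / 2) (q / 2) -> P (x + p / 2) y (p / 2) (q / 2) ->
      P x (y + q / 2) (p / 2) (q / 2) ->
      P (x + p / 2) (y + q / 2) (p / 2) (q / 2) -> P x y p q) ->
  forall x y p q, 0 <= p -> 0 <= q ->
    (forall u v, x <= u <= x + p -> y <= v <= y + q -> exists2 d, 0 < d &
      forall x' y' p' q', 0 <= p' -> 0 <= q' ->
        x <= x' -> x' + p' <= x + p -> y <= y' -> y' + q' <= y + q ->
        x' <= u <= x' + p' -> y' <= v <= y' + q' -> p' + q' < d ->
        P x' y' p' q') ->
  P x y p q.
Proof.
move=> HP x y p q p0 q0 loc; apply: contrapT => nP.
pose bad (n : nat) (s : R * R) := ~ P s.1 s.2 (p / 2 ^+ n) (q / 2 ^+ n).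
have half (b : R) n : b / 2 ^+ n / 2 = b / 2 ^+ n.+1.
  by rewrite exprS; field; rewrite expf_neq0.
have step (ns : nat * (R * R)) : exists s' : R * R, bad ns.1 ns.2 ->
   [/\ bad ns.1.+1 s', ns.2.1 <= s'.1 <= ns.2.1 + p / 2 ^+ ns.1.+1
     & ns.2.2 <= s'.2 <= ns.2.2 + q / 2 ^+ ns.1.+1].
  case: ns => n [x1 y1] /=; have [b|nb] := pselect (bad n (x1, y1)); last first.
    by exists (x1, y1).
  have pn : 0 <= p / 2 ^+ n.+1 by rewrite divr_ge0// exprn_ge0.
  have qn : 0 <= q / 2 ^+ n.+1 by rewrite divr_ge0// exprn_ge0.
  apply: contrapT => no; apply: b; apply: HP; rewrite !half;
    apply: contrapT => nq; apply: no.
  - by exists (x1, y1) => _; split=> //=; rewrite lexx lerDl.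
  - by exists (x1 + p / 2 ^+ n.+1, y1) => _; split=> //=; rewrite lexx ?lerDl ?pn.
  - by exists (x1, y1 + q / 2 ^+ n.+1) => _; split=> //=; rewrite lexx ?lerDl ?qn.
  - exists (x1 + p / 2 ^+ n.+1, y1 + q / 2 ^+ n.+1) => _.
    by split=> //=; rewrite lexx lerDl ?pn ?qn.
have [nxt Hnxt] := choice step.
pose fix s n : R * R := if n is m.+1 then nxt (m, s m) else (x, y).
have bs n : bad n (s n).
  elim: n => [|n IH]; first by rewrite /bad/= expr0 !divr1.
  by case: (Hnxt (n, s n) IH).
have sX n : (s n).1 <= (s n.+1).1 <= (s n).1 + p / 2 ^+ n.+1.
  by case: (Hnxt (n, s n) (bs n)).
have sY n : (s n).2 <= (s n.+1).2 <= (s n).2 + q / 2 ^+ n.+1.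
  by case: (Hnxt (n, s n) (bs n)).
have [u Hu] := nested_intervals p0 sX; have [v Hv] := nested_intervals q0 sY.
have inX n : x <= (s n).1 /\ (s n).1 + p / 2 ^+ n <= x + p.
  elim: n => [|n [h1 h2]]; first by rewrite /= expr0 divr1.
  have /andP[h3 h4] := sX n; split; first exact: le_trans h3.
  by apply: le_trans h2; rewrite -(half p n) in h4 *; lra.
have inY n : y <= (s n).2 /\ (s n).2 + q / 2 ^+ n <= y + q.
  elim: n => [|n [h1 h2]]; first by rewrite /= expr0 divr1.
  have /andP[h3 h4] := sY n; split; first exact: le_trans h3.
  by apply: le_trans h2; rewrite -(half q n) in h4 *; lra.
have [||d d0 Hd] := loc u v.
- by have := Hu 0%N; rewrite /= expr0 divr1.
- by have := Hv 0%N; rewrite /= expr0 divr1.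
have [n Hn] := exp2_gt ((p + q) / d).
apply: (bs n); apply: Hd => //; try by case: (inX n); case: (inY n).
- by rewrite divr_ge0// exprn_ge0.
- by rewrite divr_ge0// exprn_ge0.
by rewrite -mulrDl ltr_pdivrMr ?exprn_gt0// mulrC -ltr_pdivrMr.
Qed.

Definition cont_at f z := forall e, 0 < e ->
  exists2 d, 0 < d & forall w, cabs (w - z) < d -> cabs (f w - f z) < e.

Definition rcont c := forall t e, 0 < e ->
  exists2 d, 0 < d & forall s, `|s - t| < d -> cabs (c s - c t) < e.

Lemma hasW_cont_at f z (p q : C) : hasW f z p q -> cont_at f z.
Proof. exact: hasW_cont. Qed.

Lemma cont_at_lip_comp f (phi : R -> C) t (K : R) : 0 < K -> cont_at f (phi t) ->
    (forall s, cabs (phi s - phi t) <= K * `|s - t|) ->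
  forall e, 0 < e ->
  exists2 d, 0 < d & forall s, `|s - t| < d -> cabs (f (phi s) - f (phi t)) < e.
Proof.
move=> K0 Hf L e e0; have [d d0 Hd] := Hf e e0.
exists (d / K); first exact: divr_gt0.
move=> s; rewrite ltr_pdivlMr// => sd; apply: Hd.
by rewrite (le_lt_trans (L s))// mulrC.
Qed.

Lemma rcont_line f y : (forall z, cont_at f z) -> rcont (fun t => f (Complex t y)).
Proof.
move=> Hf t; apply: (@cont_at_lip_comp f (fun t => Complex t y) t 1) => // s.
rewrite mul1r; suff -> : Complex s y - Complex t y = (s - t)%:C%C by rewrite cabs_real.
by apply/eqP; rewrite eq_complex/= subrr !eqxx.
Qed.

Lemma rcont_vline f x : (forall z, cont_at f z) -> rcont (fun t => f (Complex x t)).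
Proof.
move=> Hf t; apply: (@cont_at_lip_comp f (fun t => Complex x t) t 1) => // s.
rewrite mul1r; suff -> : Complex x s - Complex x t = 'i%C * (s - t)%:C%C.
  by rewrite cabsM cabs_i mul1r cabs_real.
by rewrite [RHS]complexE; apply/eqP; rewrite eq_complex/=; apply/andP; split; apply/eqP; ring.
Qed.

(** The interval ]-10, 10[ contains [0, 2 pi], over which circles are
    parametrised, and the coordinates of all points of the unit disc. *)
Lemma primitive_real (phi : R -> R) : continuous phi ->
  exists G : R -> R, forall x, -10 < x < 10 -> is_derive x 1 G (phi x).
Proof.
move=> cphi.
have int : (@lebesgue_measure R).-integrable `[-10, 10] (EFin \o phi).
  apply: continuous_compact_integrable; first exact: segment_compact.
  exact: continuous_subspaceT.
exists (fun x => (\int[lebesgue_measure]_(t in [set` `[-10, x]]) phi t)%R).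
move=> x /andP[x1 x2].
have [h1 h2] := continuous_FTC1_closed x2 int x1 (cphi x).
by apply: DeriveDef; [exact: h1|rewrite -derive1E; exact: h2].
Qed.

Lemma primitive_curve c : rcont c ->
  exists G : R -> C, forall t, -10 < t < 10 -> derR G t (c t).
Proof.
move=> cc.
have H (phi : C -> R) : (forall z w, `|phi z - phi w| <= cabs (z - w)) ->
    continuous (phi \o c).
  move=> L t; apply/cvgrPdist_lt => e e0.
  have [d d0 Hd] := cc t e e0; apply/nbhs_ballP; exists d => //= s.
  move=> ts; rewrite (le_lt_trans (L _ _))// cabsBC Hd// distrC.
  exact: ts.
have [G1 H1] := @primitive_real (@complex.Re R \o c)
  ltac:(by apply: H => z w; rewrite -raddfB cabs_Re).
have [G2 H2] := @primitive_real (@complex.Im R \o c)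
  ltac:(by apply: H => z w; rewrite -raddfB cabs_Im).
exists (fun t => Complex (G1 t) (G2 t)) => t ht.
have := derR_ReIm (H1 t ht) (H2 t ht).
by rewrite /comp; case: (c t).
Qed.

Definition primc c : R -> C :=
  xget (cst 0) [set G | forall t, -10 < t < 10 -> derR G t (c t)].

Lemma primcP c t : rcont c -> -10 < t < 10 -> derR (primc c) t (c t).
Proof.
move=> cc; rewrite /primc; case: xgetP => [G _ H|no]; first exact: H.
by have [G HG] := primitive_curve cc; have := no G HG.
Qed.

Section Box.
Variable f : C -> C.
Hypothesis cf : forall z, cont_at f z.

(** Primitives of [f] along horizontal and vertical lines. Integrals over
    segments are differences of their values, so cutting a rectangle into
    pieces is pure algebra. *)
Definition hp y := primc (fun t => f (Complex t y)).
Definition vp x := primc (fun t => f (Complex x t)).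

(** The integral of [f] along the boundary of the rectangle [x1, x2] x [y1,
    y2], counterclockwise. *)
Definition box x1 x2 y1 y2 : C :=
  (hp y1 x2 - hp y1 x1) + 'i%C * (vp x2 y2 - vp x2 y1)
  - (hp y2 x2 - hp y2 x1) - 'i%C * (vp x1 y2 - vp x1 y1).

Lemma hpP y t : -10 < t < 10 -> derR (hp y) t (f (Complex t y)).
Proof. exact/primcP/rcont_line. Qed.
Lemma vpP x t : -10 < t < 10 -> derR (vp x) t (f (Complex x t)).
Proof. exact/primcP/rcont_vline. Qed.

Definition qaff (al be z : C) := al * z + be / 2 * (z * z).

Lemma hasD_qaff al be z : hasD (qaff al be) z (al + be * z).
Proof.
have := hasWD (hasWZ al (hasW_id z)) (hasWZ (be / 2) (hasWM (hasW_id z) (hasW_id z))).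
by move=> H; apply: hasW_eq H _ _ => /=; field.
Qed.

Lemma derR_hline y t : derR (fun t => Complex t y) t 1.
Proof.
apply: derR_ext ltr01 _ (derR_lin (Complex 0 y) 1 t) => s _.
by rewrite mulr1; apply/eqP; rewrite eq_complex/= addr0 add0r !eqxx.
Qed.

Lemma derR_vline x t : derR (fun t => Complex x t) t 'i%C.
Proof.
apply: derR_ext ltr01 _ (derR_lin (Complex x 0) 'i%C t) => s _.
by apply/eqP; rewrite eq_complex/=; apply/andP; split; apply/eqP; ring.
Qed.

Lemma hside al be x1 x2 y e : -10 < x1 -> x1 <= x2 -> x2 < 10 ->
    (forall t, x1 <= t <= x2 ->
       cabs (f (Complex t y) - (al + be * Complex t y)) <= e) ->
  cabs (hp y x2 - hp y x1 -
    (qaff al be (Complex x2 y) - qaff al be (Complex x1 y))) <= e * (x2 - x1).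
Proof.
move=> h1 h2 h3 He.
have := @derR_lip _ (fun t => hp y t - qaff al be (Complex t y))
  (fun t => f (Complex t y) - (al + be * Complex t y) * 1) x1 x2 e h2.
rewrite opprB addrACA -opprD => H; apply: le_trans (H _ _).
- by rewrite le_eqVlt; apply/orP; left; apply/eqP; congr cabs; ring.
- move=> t /andP[t1 t2]; apply: derRB; first by apply: hpP; lra.
  exact: derR_compD (hasD_qaff _ _ _) (derR_hline y t).
- by move=> t ht; rewrite mulr1 He.
Qed.

Lemma vside al be x y1 y2 e : -10 < y1 -> y1 <= y2 -> y2 < 10 ->
    (forall t, y1 <= t <= y2 ->
       cabs (f (Complex x t) - (al + be * Complex x t)) <= e) ->
  cabs ('i%C * (vp x y2 - vp x y1) -
    (qaff al be (Complex x y2) - qaff al be (Complex x y1))) <= e * (y2 - y1).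
Proof.
move=> h1 h2 h3 He.
have := @derR_lip _ (fun t => 'i%C * vp x t - qaff al be (Complex x t))
  (fun t => 'i%C * f (Complex x t) - (al + be * Complex x t) * 'i%C) y1 y2 e h2.
move=> H; apply: le_trans (H _ _).
- by rewrite le_eqVlt; apply/orP; left; apply/eqP; congr cabs; ring.
- move=> t /andP[t1 t2]; apply: derRB; first by apply/derRZ/vpP; lra.
  exact: derR_compD (hasD_qaff _ _ _) (derR_vline x t).
- by move=> t ht; rewrite mulrC -mulrBl cabsM cabs_i mulr1 He.
Qed.

(** An affine function has the primitive [qaff], so its integral around the
    rectangle is zero and only the deviation of [f] from it counts. *)
Lemma box_le al be x1 x2 y1 y2 e : -10 < x1 -> x1 <= x2 -> x2 < 10 ->
    -10 < y1 -> y1 <= y2 -> y2 < 10 ->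
    (forall u v, x1 <= u <= x2 -> y1 <= v <= y2 ->
      cabs (f (Complex u v) - (al + be * Complex u v)) <= e) ->
  cabs (box x1 x2 y1 y2) <= 2 * e * ((x2 - x1) + (y2 - y1)).
Proof.
move=> a1 a2 a3 b1 b2 b3 H.
have S1 := @hside al be x1 x2 y1 e a1 a2 a3 ltac:(by move=> t ht; apply: H; rewrite ?lexx ?b1).
have S2 := @hside al be x1 x2 y2 e a1 a2 a3 ltac:(by move=> t ht; apply: H; rewrite ?lexx ?b2).
have S3 := @vside al be x1 y1 y2 e b1 b2 b3 ltac:(by move=> t ht; apply: H; rewrite ?lexx ?a2).
have S4 := @vside al be x2 y1 y2 e b1 b2 b3 ltac:(by move=> t ht; apply: H; rewrite ?lexx ?a2).
set q11 := qaff al be (Complex x1 y1) in S1 S2 S3 S4 *.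
set q12 := qaff al be (Complex x1 y2) in S1 S2 S3 S4 *.
set q21 := qaff al be (Complex x2 y1) in S1 S2 S3 S4 *.
set q22 := qaff al be (Complex x2 y2) in S1 S2 S3 S4 *.
move: S1 S2 S3 S4; rewrite /box; set H1 := hp y1 x2 - _; set H2 := hp y2 x2 - _.
set V1 := 'i%C * (vp x1 y2 - _); set V2 := 'i%C * (vp x2 y2 - _) => S1 S2 S3 S4.
have -> : H1 + V2 - H2 - V1 = (H1 - (q21 - q11)) + (V2 - (q22 - q21))
   - (H2 - (q22 - q12)) - (V1 - (q12 - q11)) by ring.
apply: le_trans (cabsB _ _) _; have := cabsB (H1 - (q21 - q11) + (V2 - (q22 - q21))) (H2 - (q22 - q12)).
have := cabsD (H1 - (q21 - q11)) (V2 - (q22 - q21)); lra.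
Qed.

Lemma box_splitx x1 x2 x3 y1 y2 : box x1 x3 y1 y2 = box x1 x2 y1 y2 + box x2 x3 y1 y2.
Proof. rewrite /box; ring. Qed.
Lemma box_splity x1 x2 y1 y2 y3 : box x1 x2 y1 y3 = box x1 x2 y1 y2 + box x1 x2 y2 y3.
Proof. rewrite /box; ring. Qed.
Lemma box_swapx x1 x2 y1 y2 : box x2 x1 y1 y2 = - box x1 x2 y1 y2.
Proof. rewrite /box; ring. Qed.
Lemma box_swapy x1 x2 y1 y2 : box x1 x2 y2 y1 = - box x1 x2 y1 y2.
Proof. rewrite /box; ring. Qed.

(** Quadrisection of the bound e (p + q)^2 for the integral around a rectangle
    of sides p and q: the four quarters add up to that bound, and near a point
    where [f] is differentiable it holds because [f] is affine up to e times
    the distance. *)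
Lemma goursat x1 x2 y1 y2 : -10 < x1 -> x1 <= x2 -> x2 < 10 ->
    -10 < y1 -> y1 <= y2 -> y2 < 10 ->
    (forall u v, x1 <= u <= x2 -> y1 <= v <= y2 ->
      exists l, hasD f (Complex u v) l) ->
  box x1 x2 y1 y2 = 0.
Proof.
move=> a1 a2 a3 b1 b2 b3 H; apply: cabs_small => e0 e00.
pose S := x2 - x1 + (y2 - y1) + 1.
have S0 : 0 < S by rewrite /S; lra.
(* Chosen so that the bound 2 e S^2 obtained for the whole rectangle is e0. *)
pose e := e0 / (2 * S ^+ 2).
have e_gt0 : 0 < e by rewrite divr_gt0// mulr_gt0// exprn_gt0.
pose P x y p q : Prop := cabs (box x (x + p) y (y + q)) <= 2 * e * (p + q) ^+ 2.
have : P x1 y1 (x2 - x1) (y2 - y1).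
  apply: (@rect_induction P); rewrite ?subr_ge0//.
  - move=> x y p q; rewrite /P => h1 h2 h3 h4.
    rewrite (box_splitx x (x + p / 2) (x + p)) (box_splity x (x + p / 2) y (y + q / 2) (y + q)).
    rewrite (box_splity (x + p / 2) (x + p) y (y + q / 2) (y + q)).
    have E1 : x + p / 2 + p / 2 = x + p by field.
    have E2 : y + q / 2 + q / 2 = y + q by field.
    rewrite E1 in h2 h4; rewrite E2 in h3 h4.
    have -> : 2 * e * (p + q) ^+ 2 = 4 * (2 * e * (p / 2 + q / 2) ^+ 2) by field.
    apply: le_trans (cabsD _ _) _.
    have := cabsD (box x (x + p / 2) y (y + q / 2)) (box x (x + p / 2) (y + q / 2) (y + q)).
    have := cabsD (box (x + p / 2) (x + p) y (y + q / 2)) (box (x + p / 2) (x + p) (y + q / 2) (y + q)).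
    lra.
  - rewrite !subrKC => u v hu hv.
    have [l Hl] := H u v hu hv; have [d d0 Hd] := Hl e e_gt0.
    exists d => // x y p q p0 q0 h1 h2 h3 h4 /andP[h5 h6] /andP[h7 h8] pq.
    pose z : C := Complex u v.
    have := @box_le (f z - l * z) l x (x + p) y (y + q) (e * (p + q)) ltac:(lra) ltac:(lra) ltac:(lra) ltac:(lra) ltac:(lra) ltac:(lra).
    have -> : 2 * (e * (p + q)) * (x + p - x + (y + q - y)) = 2 * e * (p + q) ^+ 2.
      by ring.
    apply=> s t /andP[s1 s2] /andP[t1 t2].
    pose k : C := Complex (s - u) (t - v).
    have kE : Complex s t = z + k.
      by apply/eqP; rewrite eq_complex/=; apply/andP; split; apply/eqP; ring.
    have kle : cabs k <= p + q.
      rewrite (le_trans (cabs_le_ReIm _))//= lerD// ler_norml; lra.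
    rewrite kE; have := Hd k (le_lt_trans kle pq).
    have -> : f (z + k) - f z - (l * k + 0 * k^*) =
       f (z + k) - (f z - l * z + l * (z + k)) by ring.
    by move=> /le_trans; apply; rewrite ler_wpM2l// ltW.
rewrite /P !subrKC => /le_trans; apply.
have eS : 2 * e * S ^+ 2 = e0 by rewrite /e; field; rewrite gt_eqF.
have {P} : 2 * e * S ^+ 2 <= e0 by rewrite eS.
clearbody e; apply: le_trans; rewrite ler_pM2l ?mulr_gt0//.
have : 0 <= x2 - x1 + (y2 - y1) by lra.
by rewrite /S; set s := x2 - x1 + (y2 - y1) => s0; nra.
Qed.

Lemma unif_cont x1 x2 y1 y2 e : x1 <= x2 -> y1 <= y2 -> 0 < e ->
  exists2 d, 0 < d & forall u v (w : C), x1 <= u <= x2 -> y1 <= v <= y2 ->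
    cabs (w - Complex u v) < d -> cabs (f w - f (Complex u v)) < e.
Proof.
move=> a2 b2 e0.
pose P x y p q := exists2 d, 0 < d & forall u v (w : C), x <= u <= x + p ->
  y <= v <= y + q -> cabs (w - Complex u v) < d -> cabs (f w - f (Complex u v)) < e.
suff : P x1 y1 (x2 - x1) (y2 - y1) by rewrite /P !subrKC.
apply: (@rect_induction P); rewrite ?subr_ge0//.
- move=> x y p q [d1 ? H1] [d2 ? H2] [d3 ? H3] [d4 ? H4].
  exists (Num.min (Num.min d1 d2) (Num.min d3 d4)); first by rewrite !lt_min; apply/andP; split; apply/andP.
  move=> u v w /andP[u1 u2] /andP[v1 v2]; rewrite !lt_min => /andP[/andP[? ?] /andP[? ?]].
  have [ux|ux] := leP u (x + p / 2); have [vy|vy] := leP v (y + q / 2).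
  + by apply: H1 => //; lra.
  + by apply: H3 => //; lra.
  + by apply: H2 => //; lra.
  + by apply: H4 => //; lra.
- move=> u v _ _; have [d d0 Hd] := cf (Complex u v) (e := e / 2) ltac:(lra).
  exists (d / 2); first lra.
  move=> x y p q p0 q0 _ _ _ _ /andP[u1 u2] /andP[v1 v2] pq.
  exists (d / 2); first lra.
  move=> s t w /andP[s1 s2] /andP[t1 t2] hw.
  have kle : cabs (Complex s t - Complex u v) <= p + q.
    rewrite (le_trans (cabs_le_ReIm _))//= lerD// ler_norml; lra.
  have h1 := Hd (Complex s t) ltac:(lra).
  have h2 := Hd w.
  have := cabsD (w - Complex s t) (Complex s t - Complex u v); rewrite subrKA => h3.
  have {}h2 := h2 ltac:(lra).
  have := cabsB (f w - f (Complex u v)) (f (Complex s t) - f (Complex u v)).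
  by rewrite opprB subrKA; lra.
Qed.

Lemma rcont_derR c t l : derR c t l -> forall e, 0 < e ->
  exists2 d, 0 < d & forall s, `|s - t| < d -> cabs (c s - c t) < e.
Proof.
move=> /derR_hasW/hasW_cont H e /H[d d0 Hd]; exists d => // s sd.
by have := Hd s%:C%C; rewrite /= -rmorphB cabs_real; apply.
Qed.

(** The horizontal sides are short, and [f] takes close values on the two
    vertical ones, which are run in opposite directions. *)
Lemma box_thin x0 y1 y2 e : -10 < x0 < 10 -> -10 < y1 -> y1 <= y2 -> y2 < 10 ->
    0 < e ->
  exists2 d, 0 < d & forall x, `|x - x0| < d -> cabs (box x0 x y1 y2) <= e.
Proof.
move=> hx b1 b2 b3 e0.
have e3 : 0 < e / 3 by lra.
have [d1 d10 H1] := rcont_derR (@hpP y1 x0 hx) e3.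
have [d2 d20 H2] := rcont_derR (@hpP y2 x0 hx) e3.
have [d3 d30 H3] := @unif_cont x0 x0 y1 y2 (e / 3 / 20) (lexx _) b2 ltac:(lra).
exists (Num.min d1 (Num.min d2 d3)); first by rewrite !lt_min d10 d20.
move=> x; rewrite !lt_min => /and3P[/H1 {}H1 /H2 {}H2 hx3].
have H : cabs ((vp x y2 - vp x0 y2) - (vp x y1 - vp x0 y1)) <= e / 3 / 20 * (y2 - y1).
  apply: (@derR_lip _ (fun t => vp x t - vp x0 t)
    (fun t => f (Complex x t) - f (Complex x0 t))) => // t /andP[t1 t2].
    by apply: derRB; apply: vpP; lra.
  apply: ltW; apply: H3; rewrite ?lexx ?t1//.
  suff -> : Complex x t - Complex x0 t = (x - x0)%:C%C by rewrite cabs_real.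
  by apply/eqP; rewrite eq_complex/= subrr !eqxx.
have -> : box x0 x y1 y2 = (hp y1 x - hp y1 x0) - (hp y2 x - hp y2 x0) +
   'i%C * ((vp x y2 - vp x0 y2) - (vp x y1 - vp x0 y1)) by rewrite /box; ring.
apply: le_trans (cabsD _ _) _; rewrite cabsM cabs_i mul1r.
have := cabsB (hp y1 x - hp y1 x0) (hp y2 x - hp y2 x0).
have : e / 3 / 20 * (y2 - y1) <= e / 3 by rewrite -{2}[e / 3]mulr1 -mulrA ler_pM2l//; lra.
lra.
Qed.

(** Thin strips along the vertical sides are cut off, to stay where [f] is
    differentiable. *)
Lemma goursat_open x1 x2 y1 y2 : -10 < x1 -> x1 <= x2 -> x2 < 10 ->
    -10 < y1 -> y1 <= y2 -> y2 < 10 ->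
    (forall u v, x1 < u < x2 -> y1 <= v <= y2 ->
      exists l, hasD f (Complex u v) l) ->
  box x1 x2 y1 y2 = 0.
Proof.
move=> a1 a2 a3 b1 b2 b3 H; apply: cabs_small => e e0.
have [xx|xx] := leP x2 x1.
  have -> : x2 = x1 by apply/eqP; rewrite eq_le xx.
  by rewrite /box !subrr; rewrite add0r subr0 subrr cabs0 ltW.
have [d1 d10 H1] := @box_thin x1 y1 y2 (e / 2) ltac:(lra) b1 b2 b3 ltac:(lra).
have [d2 d20 H2] := @box_thin x2 y1 y2 (e / 2) ltac:(lra) b1 b2 b3 ltac:(lra).
pose n := Num.min (Num.min d1 d2) (x2 - x1) / 3.
have n0 : 0 < n by rewrite divr_gt0// !lt_min d10 d20 subr_gt0.
have [n1 n2 n3] : [/\ n < d1, n < d2 & n < (x2 - x1) / 2].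
  have : 3 * n <= Num.min (Num.min d1 d2) (x2 - x1) by rewrite /n; lra.
  by rewrite !le_min => /andP[/andP[? ?] ?]; split; lra.
rewrite (box_splitx _ (x1 + n)) (box_splitx (x1 + n) (x2 - n)).
rewrite [box (x1 + n) _ _ _]goursat; try lra; last first.
  by move=> u v hu hv; apply: H => //; lra.
rewrite add0r; apply: le_trans (cabsD _ _) _; rewrite (box_swapx x2) cabsN.
have h1 := H1 (x1 + n); have h2 := H2 (x2 - n).
rewrite addrAC subrr add0r gtr0_norm// in h1.
rewrite addrAC subrr add0r normrN gtr0_norm// in h2.
by have {}h1 := h1 n1; have {}h2 := h2 n2; lra.
Qed.

(** The rectangle is cut along the vertical line through the exceptional
    point, where [goursat_open] asks for nothing. The exception is needed for
    difference quotients, at their centre. *)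
Lemma goursat_but1 a x1 x2 y1 y2 : -10 < x1 -> x1 <= x2 -> x2 < 10 ->
    -10 < y1 -> y1 <= y2 -> y2 < 10 ->
    (forall u v, x1 <= u <= x2 -> y1 <= v <= y2 -> Complex u v != a ->
      exists l, hasD f (Complex u v) l) ->
  box x1 x2 y1 y2 = 0.
Proof.
move=> a1 a2 a3 b1 b2 b3 H; pose r := complex.Re a.
have ne u v : u != r -> Complex u v != a.
  by apply: contra_neq; rewrite /r => <-.
have [/andP[r1 r2]|nr] := boolP (x1 < r < x2).
  rewrite (box_splitx _ r) !goursat_open ?addr0//; try lra.
  - move=> u v hu hv; apply: H => //; [lra|apply: ne; apply/negP => /eqP ?; lra].
  - move=> u v hu hv; apply: H => //; [lra|apply: ne; apply/negP => /eqP ?; lra].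
apply: goursat_open => // u v hu hv; apply: H => //; first lra.
by apply: ne; apply: contraNneq nr => <-.
Qed.

Lemma cabs_mono (x1 y1 x2 y2 : R) : `|x1| <= `|x2| -> `|y1| <= `|y2| ->
  cabs (Complex x1 y1) <= cabs (Complex x2 y2).
Proof.
move=> hx hy; rewrite -ler_sqr ?nnegrE ?cabs_ge0// !cabs_sqr/=.
rewrite -[X in X + _ <= _]real_normK ?num_real// -[X in _ + X <= _]real_normK ?num_real//.
rewrite -[X in _ <= X + _]real_normK ?num_real// -[X in _ <= _ + X]real_normK ?num_real//.
by apply: lerD; rewrite ler_sqr ?nnegrE.
Qed.

(** The integral of [f] from 0 to [z] along a horizontal and then a vertical
    segment. *)
Definition Lprim z : C :=
  hp 0 (complex.Re z) - hp 0 0 +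
  'i%C * (vp (complex.Re z) (complex.Im z) - vp (complex.Re z) 0).

Lemma box0_signed a rho x1 x2 y : rho <= 1 ->
    cabs (Complex x1 y) < rho -> cabs (Complex x2 y) < rho ->
    (forall z, cabs z < rho -> z != a -> exists l, hasD f z l) ->
  box x1 x2 0 y = 0.
Proof.
move=> rho1 z1 z2 H.
wlog : x1 x2 z1 z2 / x1 <= x2.
  move=> W; have [/W ->//|/ltW/W E] := leP x1 x2.
  by rewrite box_swapx E// oppr0.
move=> x12.
have := le_lt_trans (cabs_Re _) z1; have := le_lt_trans (cabs_Re _) z2.
have := le_lt_trans (cabs_Im _) z1; rewrite /= !ltr_norml => /andP[? ?] /andP[? ?] /andP[? ?].
have K u v : x1 <= u <= x2 -> `|v| <= `|y| -> cabs (Complex u v) < rho.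
  move=> /andP[u1 u2] vy; have [u0|u0] := leP 0 u.
    by apply: le_lt_trans z2; apply: cabs_mono => //; rewrite !ger0_norm//; lra.
  by apply: le_lt_trans z1; apply: cabs_mono => //; rewrite !ltr0_norm//; lra.
have [y0|y0] := leP 0 y.
  apply: (@goursat_but1 a); try lra.
  move=> u v hu /andP[v1 v2] ne; apply: H => //; apply: K => //.
  by rewrite !ger0_norm//; lra.
rewrite box_swapy (@goursat_but1 a) ?oppr0//; try lra.
move=> u v hu /andP[v1 v2] ne; apply: H => //; apply: K => //.
by rewrite !ler0_norm//; lra.
Qed.

Lemma hside_signed al x1 x2 y e : -10 < x1 < 10 -> -10 < x2 < 10 ->
    (forall t, `|t - x1| <= `|x2 - x1| -> cabs (f (Complex t y) - al) <= e) ->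
  cabs (hp y x2 - hp y x1 - al * (x2 - x1)%:C%C) <= e * `|x2 - x1|.
Proof.
move=> /andP[? ?] /andP[? ?] H.
have qE (u w : C) : qaff al 0 u - qaff al 0 w = al * (u - w) by rewrite /qaff; field.
have cE (u w : R) : Complex u y - Complex w y = (u - w)%:C%C.
  by apply/eqP; rewrite eq_complex/= subrr !eqxx.
have [x12|x21] := leP x1 x2.
  rewrite ger0_norm ?subr_ge0//.
  have := @hside al 0 x1 x2 y e; rewrite qE cE; apply=> // t /andP[t1 t2].
  by rewrite mul0r addr0 H// !ger0_norm ?subr_ge0//; lra.
have -> : `|x2 - x1| = x1 - x2 by rewrite ltr0_norm; lra.
have -> : hp y x2 - hp y x1 - al * (x2 - x1)%:C%C =
  - (hp y x1 - hp y x2 - al * (x1 - x2)%:C%C) by rewrite !rmorphB/=; ring.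
rewrite cabsN; have := @hside al 0 x2 x1 y e; rewrite qE cE; apply=> //; first lra.
move=> t /andP[t1 t2]; rewrite mul0r addr0 H// distrC (distrC x2).
by rewrite !ger0_norm ?subr_ge0//; lra.
Qed.

Lemma vside_signed al x y1 y2 e : -10 < y1 < 10 -> -10 < y2 < 10 ->
    (forall t, `|t - y1| <= `|y2 - y1| -> cabs (f (Complex x t) - al) <= e) ->
  cabs ('i%C * (vp x y2 - vp x y1) - al * ('i%C * (y2 - y1)%:C%C)) <= e * `|y2 - y1|.
Proof.
move=> /andP[? ?] /andP[? ?] H.
have qE (u w : C) : qaff al 0 u - qaff al 0 w = al * (u - w) by rewrite /qaff; field.
have cE (u w : R) : Complex x u - Complex x w = 'i%C * (u - w)%:C%C.
  by apply/eqP; rewrite eq_complex/=; apply/andP; split; apply/eqP; ring.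
have [x12|x21] := leP y1 y2.
  rewrite ger0_norm ?subr_ge0//.
  have := @vside al 0 x y1 y2 e; rewrite qE cE; apply=> // t /andP[t1 t2].
  by rewrite mul0r addr0 H// !ger0_norm ?subr_ge0//; lra.
have -> : `|y2 - y1| = y1 - y2 by rewrite ltr0_norm; lra.
have -> : 'i%C * (vp x y2 - vp x y1) - al * ('i%C * (y2 - y1)%:C%C) =
  - ('i%C * (vp x y1 - vp x y2) - al * ('i%C * (y1 - y2)%:C%C)) by rewrite !rmorphB/=; ring.
rewrite cabsN; have := @vside al 0 x y2 y1 e; rewrite qE cE; apply=> //; first lra.
move=> t /andP[t1 t2]; rewrite mul0r addr0 H// distrC (distrC y2).
by rewrite !ger0_norm ?subr_ge0//; lra.
Qed.

(** By Goursat's theorem the path to [z + h] may be led through [z] and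
    continued along a horizontal and a vertical segment near [z], on which [f]
    is close to [f z]. *)
Lemma Lprim_hasD a rho : rho <= 1 ->
    (forall z, cabs z < rho -> z != a -> exists l, hasD f z l) ->
  forall z, cabs z < rho -> hasD Lprim z (f z).
Proof.
move=> rho1 H z zrho e e0; have [d d0 Hd] := @cf z (e / 2) ltac:(lra).
exists (Num.min (d / 2) (rho - cabs z)); first by rewrite lt_min subr_gt0 zrho andbT; lra.
move=> h; rewrite lt_min => /andP[hd hrho].
case: z zrho Hd hrho => x y; set z := Complex x y => zrho Hd hrho.
case: h hd hrho => p q; set h := Complex p q => hd hrho.
have zE : z + Complex p 0 = Complex (x + p) y.
  by apply/eqP; rewrite eq_complex/= addr0 !eqxx.
have hp_ : `|p| <= cabs h := cabs_Re h. have hq_ : `|q| <= cabs h := cabs_Im h.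
have pE : cabs (Complex p 0) = `|p| := cabs_real p.
have z'rho : cabs (Complex (x + p) y) < rho.
  by rewrite -zE (le_lt_trans (cabsD _ _))// pE; lra.
have z''rho : cabs (z + h) < rho by rewrite (le_lt_trans (cabsD _ _))//; lra.
have B0 := box0_signed rho1 zrho z'rho H.
have -> : Lprim (z + h) - Lprim z - (f z * h + 0 * h^*) =
   (hp y (x + p) - hp y x - f z * (x + p - x)%:C%C) +
   ('i%C * (vp (x + p) (y + q) - vp (x + p) y) - f z * ('i%C * (y + q - y)%:C%C))
   + box x (x + p) 0 y.
  have hE : h = (x + p - x)%:C%C + 'i%C * (y + q - y)%:C%C.
    by rewrite [LHS]complexE/= !(addrAC _ _ (- _)) !subrr !add0r.
  have LzE : Lprim z = hp 0 x - hp 0 0 + 'i%C * (vp x y - vp x 0) by [].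
  have LzhE : Lprim (z + h) = hp 0 (x + p) - hp 0 0 +
    'i%C * (vp (x + p) (y + q) - vp (x + p) 0) by [].
  rewrite LzhE LzE mul0r addr0 [in f z * h]hE /box; ring.
rewrite B0 addr0.
have := le_lt_trans (cabs_Re _) zrho; have := le_lt_trans (cabs_Re _) z'rho.
have := le_lt_trans (cabs_Im _) zrho; have := le_lt_trans (cabs_Im _) z''rho.
rewrite /= !ltr_norml => /andP[? ?] /andP[? ?] /andP[? ?] /andP[? ?].
apply: le_trans (cabsD _ _) _.
have S1 := @hside_signed (f z) x (x + p) y (e / 2) ltac:(lra) ltac:(lra).
have S2 := @vside_signed (f z) (x + p) y (y + q) (e / 2) ltac:(lra) ltac:(lra).
move: S1 S2; rewrite ![_ + p - x]addrAC ![_ + q - y]addrAC !subrr !add0r => S1 S2.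
apply: le_trans (lerD (S1 _) (S2 _)) _.
- move=> t tp; apply/ltW/Hd.
  suff -> : Complex t y - z = (t - x)%:C%C by rewrite cabs_real; lra.
  by apply/eqP; rewrite eq_complex/= subrr !eqxx.
- move=> t tq; apply/ltW/Hd; apply: le_lt_trans (cabs_le_ReIm _) _ => /=.
  by rewrite addrAC subrr add0r; lra.
nra.
Qed.

End Box.

(** The radial retraction onto a ball. Composing with it makes a function that
    is continuous on a larger ball continuous on the whole plane, as the
    integrals above require. *)
Definition retract (rho : R) (z : C) : C := (rho / Num.max rho (cabs z))%:C%C * z.

Lemma retract_id rho z : 0 < rho -> cabs z <= rho -> retract rho z = z.
Proof.
by move=> r0 zr; rewrite /retract max_l// divff ?gt_eqF// mul1r.
Qed.

Lemma cabs_retract rho z : 0 < rho -> cabs (retract rho z) <= rho.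
Proof.
move=> r0; set M := Num.max rho (cabs z).
have M0 : 0 < M by rewrite lt_max r0.
rewrite cabsM cabs_real ger0_norm ?divr_ge0 ?(ltW r0) ?(ltW M0)// mulrAC ler_pdivrMr//.
by rewrite ler_pM2l// le_max lexx orbT.
Qed.

Lemma retract_lip rho z w : 0 < rho ->
  cabs (retract rho z - retract rho w) <= 2 * cabs (z - w).
Proof.
move=> r0; rewrite /retract; set M := Num.max rho (cabs z); set M' := Num.max rho (cabs w).
have M0 : 0 < M by rewrite lt_max r0.
have M'0 : 0 < M' by rewrite lt_max r0.
have r'0 : rho <= M' by rewrite le_max lexx.
have zM : cabs z <= M by rewrite le_max lexx orbT.
have MM : `|M' - M| <= cabs (z - w).
  have h1 := cabs_le_dist z w; have h2 := cabs_le_dist w z; rewrite cabsBC in h2.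
  rewrite ler_norml /M /M' /Num.max; case: ltP => h3; case: ltP => h4; lra.
have -> : (rho / M)%:C%C * z - (rho / M')%:C%C * w =
   (rho / (M * M'))%:C%C * ((M' - M)%:C%C * z + M%:C%C * (z - w)).
  have -> : (rho / M)%:C%C = (rho / (M * M'))%:C%C * M'%:C%C :> C.
    by rewrite -rmorphM/=; congr (_ %:C%C); field; rewrite !gt_eqF.
  have -> : (rho / M')%:C%C = (rho / (M * M'))%:C%C * M%:C%C :> C.
    by rewrite -rmorphM/=; congr (_ %:C%C); field; rewrite !gt_eqF.
  rewrite rmorphB/=; ring.
rewrite cabsM cabs_real ger0_norm ?divr_ge0 ?mulr_ge0 ?(ltW r0) ?(ltW M0) ?(ltW M'0)//.
rewrite mulrAC ler_pdivrMr ?mulr_gt0//.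
have : cabs ((M' - M)%:C%C * z + M%:C%C * (z - w)) <= 2 * cabs (z - w) * M.
  apply: le_trans (cabsD _ _) _; rewrite !cabsM !cabs_real (ger0_norm (ltW M0)).
  have := ler_pM (normr_ge0 _) (cabs_ge0 _) MM zM; lra.
move=> h; have h0 := cabs_ge0 ((M' - M)%:C%C * z + M%:C%C * (z - w)).
by rewrite [rho * _]mulrC mulrA; apply: ler_pM => //; lra.
Qed.

(** [Lprim_hasD] applies to the composition of [f] with the retraction onto
    the ball of radius [rho]. *)
Lemma primitive_ball f r rho a : 0 < rho -> rho < r -> rho <= 1 ->
    (forall z, cabs z < r -> cont_at f z) ->
    (forall z, cabs z < r -> z != a -> exists l, hasD f z l) ->
  exists F, forall z, cabs z < rho -> hasD F z (f z).
Proof.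
move=> r0 rr r1 cf df; pose g := f \o retract rho.
have gE z : cabs z <= rho -> g z = f z by move=> h; rewrite /g/= retract_id.
have cg z : cont_at g z.
  move=> e e0; have zr : cabs (retract rho z) < r by apply: le_lt_trans (cabs_retract z r0) rr.
  have [d d0 Hd] := cf _ zr e e0; exists (d / 2); first lra.
  move=> w wz; apply: Hd; have := @retract_lip rho w z r0; lra.
exists (Lprim g) => z zr; rewrite -gE ?ltW//.
apply: (@Lprim_hasD g cg a rho r1 _ z zr) => w wr wa.
have [l Hl] := df w (lt_trans wr rr) wa; exists l.
apply: (@hasW_ext _ f g _ _ _ (rho - cabs w)) Hl; first by rewrite subr_gt0.
by move=> u uw; rewrite gE//; have := cabs_le_dist u w; lra.
Qed.

Lemma hasD_cst_ball f r z w : cabs z < r -> cabs w < r ->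
  (forall u : C, cabs u < r -> hasD f u 0) -> f z = f w.
Proof.
move=> zr wr H; pose c t := w + t%:C%C * (z - w).
have cE t : c t = (1 - t)%:C%C * w + t%:C%C * z.
  by rewrite /c rmorphB/=; ring.
have -> : z = c 1 by rewrite /c rmorph1 mul1r subrKC.
have -> : w = c 0 by rewrite /c rmorph0 mul0r addr0.
apply: (@derR0_cst _ (f \o c)) ler01.
move=> t /andP[t0 t1]; rewrite -(mul0r (z - w)).
apply: derR_compD (derR_lin w (z - w) t); apply: H; rewrite -/(c t) cE.
apply: le_lt_trans (cabsD _ _) _; rewrite !cabsM !cabs_real !ger0_norm ?subr_ge0//.
pose m := Num.max (cabs z) (cabs w).
have zm : cabs z <= m by rewrite le_max lexx.
have wm : cabs w <= m by rewrite le_max lexx orbT.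
have mr : m < r by rewrite gt_max zr.
have : 0 <= (1 - t) * (m - cabs w) by rewrite mulr_ge0// subr_ge0.
have : 0 <= t * (m - cabs z) by rewrite mulr_ge0// subr_ge0.
nra.
Qed.

(** Primitives on smaller balls that vanish at 0 agree where both are defined,
    so they can be glued. *)
Lemma primitive_disc f : (forall z, cabs z < 1 -> exists l, hasD f z l) ->
  exists F, forall z, cabs z < 1 -> hasD F z (f z).
Proof.
move=> H.
have /choice[G HG] : forall rho : R, exists F, 0 < rho < 1 -> F 0 = 0 /\
    forall z, cabs z < rho -> hasD F z (f z).
  move=> rho; have [hr|nr] := pselect (0 < rho < 1); last by exists f.
  have /andP[r0 r1] := hr.
  have [|z zr _|F HF] := @primitive_ball f 1 rho 0 r0 r1 (ltW r1).
  - by move=> z /H[l]; exact: hasW_cont_at.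
  - exact: H.
  - exists (fun z => F z - F 0) => _; split; first exact: subrr.
    by move=> z /HF Hz; rewrite -[f z]subr0; apply: hasDB Hz (hasW_cst _ _).
pose rr (z : C) := (1 + cabs z) / 2.
exists (fun z => G (rr z) z) => z z1.
have rz (w : C) : cabs w < 1 -> 0 < rr w < 1 /\ cabs w < rr w.
  by move=> w1; have := cabs_ge0 w; rewrite /rr; lra.
have [hr zr] := rz z z1.
apply: (@hasW_ext _ (G (rr z)) _ _ _ _ (rr z - cabs z)).
- by rewrite subr_gt0.
- move=> w wz; have w1 : cabs w < rr z by have := cabs_le_dist w z; lra.
  have [hr' wr'] := rz w ltac:(lra).
  pose m := Num.min (rr z) (rr w).
  have E : (G (rr z) w - G (rr w) w) = (G (rr z) 0 - G (rr w) 0).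
    have := @hasD_cst_ball (fun u : C => G (rr z) u - G (rr w) u) m w 0; apply.
    + by rewrite lt_min w1.
    + by rewrite lt_min cabs0; case/andP: hr => -> _; case/andP: hr' => -> _.
    + move=> u; rewrite lt_min => /andP[u1 u2]; rewrite -(subrr (f u)).
      by apply: hasDB; [case: (HG _ hr) => _; apply|case: (HG _ hr') => _; apply].
  by move: E; rewrite (HG _ hr).1 (HG _ hr').1 subrr => /subr0_eq.
- by case: (HG _ hr) => _; apply.
Qed.
End Goursat.

(** * Cauchy's formula and Taylor estimates *)

Section Cauchy.
Variable R : realType.
Local Notation C := R[i].
Implicit Types (e d r s t u : R) (z w a h l : C) (f g : C -> C) (c G : R -> C).

Definition dcurve c := forall t, exists l, derR c t l.

Lemma dcurve_rcont c : dcurve c -> rcont c.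
Proof. by move=> H t; have [l Hl] := H t; exact: rcont_derR Hl. Qed.

Lemma dcurveM c1 c2 : dcurve c1 -> dcurve c2 -> dcurve (fun t => c1 t * c2 t).
Proof.
by move=> H1 H2 t; have [l1 L1] := H1 t; have [l2 L2] := H2 t; exact: (ex_intro _ _ (derRM L1 L2)).
Qed.

Lemma dcurveB c1 c2 : dcurve c1 -> dcurve c2 -> dcurve (fun t => c1 t - c2 t).
Proof.
by move=> H1 H2 t; have [l1 L1] := H1 t; have [l2 L2] := H2 t; exact: (ex_intro _ _ (derRB L1 L2)).
Qed.

Lemma dcurveD c1 c2 : dcurve c1 -> dcurve c2 -> dcurve (fun t => c1 t + c2 t).
Proof.
by move=> H1 H2 t; have [l1 L1] := H1 t; have [l2 L2] := H2 t; exact: (ex_intro _ _ (derRD L1 L2)).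
Qed.

Lemma dcurve_cst a : dcurve (fun=> a).
Proof. by move=> t; exists 0; exact: derR_cst. Qed.

Lemma dcurveV c : dcurve c -> (forall t, c t != 0) -> dcurve (fun t => (c t)^-1).
Proof.
move=> H1 H2 t; have [l1 L1] := H1 t; eexists.
exact: (derR_compD (hasW_inv (H2 t)) L1).
Qed.

Lemma dcurve_comp f c : dcurve c -> (forall t, exists l, hasD f (c t) l) ->
  dcurve (f \o c).
Proof.
move=> H1 H2 t; have [l1 L1] := H1 t; have [l Hl] := H2 t; eexists.
exact: (derR_compD Hl L1).
Qed.

Let twopi : R := 2 * pi.

Lemma twopi_gt0 : 0 < twopi. Proof. by rewrite mulr_gt0// pi_gt0. Qed.
Lemma twopi_lt8 : twopi < 8.
Proof. by have := pihalf_lt2 R; rewrite /twopi; lra. Qed.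

Definition circint c : C := primc c twopi - primc c 0.

Lemma circint_primitive c G : rcont c ->
  (forall t, 0 <= t <= twopi -> derR G t (c t)) -> circint c = G twopi - G 0.
Proof.
move=> cc HG; have tp := twopi_gt0; have tp8 := twopi_lt8.
have D0 t : 0 <= t <= twopi -> derR (fun u => primc c u - G u) t 0.
  move=> ht; rewrite -(subrr (c t)); apply: derRB; last exact: HG.
  by apply: primcP => //; lra.
have /= E := derR0_cst D0 (ltW tp).
by rewrite /circint -[primc c twopi](subrK (G twopi)) E; ring.
Qed.

Lemma circint_derR c t : rcont c -> 0 <= t <= twopi -> derR (primc c) t (c t).
Proof.
by move=> cc ht; apply: primcP => //; have := twopi_lt8; lra.
Qed.

Lemma circintD c1 c2 : dcurve c1 -> dcurve c2 -> circint (fun t => c1 t + c2 t) = circint c1 + circint c2.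
Proof.
move=> h1 h2; rewrite (@circint_primitive _ (fun t => primc c1 t + primc c2 t)).
- by rewrite /circint; ring.
- exact/dcurve_rcont/dcurveD.
- by move=> t ht; apply: derRD; apply: circint_derR => //; exact: dcurve_rcont.
Qed.

Lemma circintZ a c : dcurve c -> circint (fun t => a * c t) = a * circint c.
Proof.
move=> h1; rewrite (@circint_primitive _ (fun t => a * primc c t)).
- by rewrite /circint; ring.
- by apply/dcurve_rcont/dcurveM => //; exact: dcurve_cst.
- by move=> t ht; apply: derRZ; apply: circint_derR => //; exact: dcurve_rcont.
Qed.

Lemma circint_cst a : circint (fun=> a) = twopi%:C%C * a.
Proof.
rewrite (@circint_primitive _ (fun t => 0 + t%:C%C * a)).
- by rewrite mul0r addr0 subr0 add0r.
- exact/dcurve_rcont/dcurve_cst.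
- by move=> t _; exact: derR_lin.
Qed.

Lemma circint_le c M : rcont c -> (forall t, cabs (c t) <= M) -> cabs (circint c) <= 8 * M.
Proof.
move=> cc H; have M0 : 0 <= M := le_trans (cabs_ge0 _) (H 0).
apply: le_trans (derR_lip (ltW twopi_gt0) (fun t => @circint_derR c t cc) (fun t _ => H t)) _.
by rewrite subr0 mulrC ler_wpM2r// ltW// twopi_lt8.
Qed.

Section Circle.
Variable s : R.
Hypothesis s0 : 0 < s.

Definition circ t : C := s%:C%C * Complex (cos t) (sin t).

Lemma circ_derR t : derR circ t ('i%C * circ t).
Proof.
have := derRZ s%:C%C (derR_ReIm (is_derive_cos t) (is_derive_sin t)).
move=> H; apply: derR_eq H _; rewrite /circ [RHS]mulrCA; congr (_ * _).
by apply/eqP; rewrite eq_complex/=; apply/andP; split; apply/eqP; ring.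
Qed.

Lemma dcurve_circ : dcurve circ.
Proof. by move=> t; eexists; exact: circ_derR. Qed.

Lemma cabs_circ t : cabs (circ t) = s.
Proof.
rewrite cabsM cabs_real gtr0_norm// -[RHS]mulr1; congr (_ * _).
apply/eqP; rewrite -(@eqrXn2 _ 2)// ?cabs_ge0//.
by rewrite cabs_sqr/= cos2Dsin2 expr1n.
Qed.

Lemma circ_closed : circ twopi = circ 0.
Proof.
by rewrite /circ /twopi mulr_natl cos2pi sin2pi cos0 sin0.
Qed.

Lemma circ_sub a t : cabs a < s -> s - cabs a <= cabs (circ t - a).
Proof. by move=> _; have := cabs_le_dist (circ t) a; rewrite cabs_circ; lra. Qed.

Lemma circ_neq a t : cabs a < s -> circ t - a != 0.
Proof. by move=> ha; rewrite -cabs_gt0; have := circ_sub t ha; lra. Qed.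

Lemma dcurve_kernel a : cabs a < s -> dcurve (fun t => (circ t - a)^-1).
Proof.
move=> ha; apply: dcurveV; last by move=> t; exact: circ_neq.
by apply: dcurveB; [exact: dcurve_circ|exact: dcurve_cst].
Qed.

(** The Cauchy transform of the density [c] on the circle and its derivative
    in [a]. *)
Definition cauchyT c a := circint (fun t => c t * (circ t - a)^-1).
Definition cauchyT' c a := circint (fun t => c t * ((circ t - a)^-1 * (circ t - a)^-1)).

(** Under the integral sign, with u = circ t - a, 1 / (u - h) = 1 / u + h /
    u^2 + h^2 / (u^2 (u - h)); the restriction on [h] bounds the last
    denominator from below. The factor 8 in [circint_le] is a bound of 2 pi.
    *)
Lemma cauchyT_taylor c M a h : dcurve c -> (forall t, cabs (c t) <= M) ->
    cabs a < s -> cabs h <= (s - cabs a) / 2 ->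
  cabs (cauchyT c (a + h) - cauchyT c a - h * cauchyT' c a) <=
    16 * M / (s - cabs a) ^+ 3 * cabs h ^+ 2.
Proof.
move=> dc cM ha hh; set k := s - cabs a in hh *.
have k0 : 0 < k by rewrite /k; lra.
have hah : cabs (a + h) < s by have := cabsD a h; rewrite /k in hh *; lra.
have M0 : 0 <= M := le_trans (cabs_ge0 _) (cM 0).
have d1 := dcurve_kernel ha; have d2 := dcurve_kernel hah.
pose rem t := c t * ((circ t - a)^-1 * (circ t - a)^-1 * (circ t - (a + h))^-1).
have drem : dcurve rem by do !apply: dcurveM.
have dcT2 : dcurve (fun t => c t * ((circ t - a)^-1 * (circ t - a)^-1)).
  by do !apply: dcurveM.
have dcT : dcurve (fun t => c t * (circ t - a)^-1) by do !apply: dcurveM.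
have -> : cauchyT c (a + h) = cauchyT c a + (h * cauchyT' c a + h ^+ 2 * circint rem).
  rewrite /cauchyT /cauchyT' -(circintZ h dcT2) -(circintZ (h ^+ 2) drem) -circintD//; last 2 first.
  - by apply: dcurveM => //; exact: dcurve_cst.
  - by apply: dcurveM => //; exact: dcurve_cst.
  rewrite -circintD//; last first.
    by apply: dcurveD; apply: dcurveM => //; exact: dcurve_cst.
  congr circint; apply/funext => t; rewrite /rem.
  have n1 := circ_neq t ha; have n2 := circ_neq t hah.
  by field; rewrite n2 n1.
have -> : cauchyT c a + (h * cauchyT' c a + h ^+ 2 * circint rem) - cauchyT c a - h * cauchyT' c a = h ^+ 2 * circint rem by ring.
rewrite cabsM cabsX mulrC ler_wpM2r ?exprn_ge0 ?cabs_ge0//.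
have -> : 16 * M / k ^+ 3 = 8 * (M * (k^-1 * k^-1 * (2 / k))).
  by field; rewrite gt_eqF.
apply: circint_le; first exact: dcurve_rcont.
move=> t; rewrite /rem !cabsM !cabsV.
have e1 : (cabs (circ t - a))^-1 <= k^-1.
  have := circ_sub t ha; rewrite -/k => ?; rewrite lef_pV2 ?posrE//; lra.
have e2 : (cabs (circ t - (a + h)))^-1 <= 2 / k.
  rewrite -[2 / k]invrK invf_div.
  have h1 := circ_sub t hah; have h2 := cabsD a h.
  by rewrite lef_pV2 ?posrE ?divr_gt0//; rewrite /k in hh *; lra.
by rewrite !ler_pM ?mulr_ge0 ?invr_ge0 ?cabs_ge0.
Qed.

Lemma cauchyT_hasD c M a : dcurve c -> (forall t, cabs (c t) <= M) -> cabs a < s ->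
  hasD (cauchyT c) a (cauchyT' c a).
Proof.
move=> dc cM ha; apply: (@little_sqr _ _ (16 * M / (s - cabs a) ^+ 3)
  ((s - cabs a) / 2)); first lra.
by move=> h hh; rewrite mul0r addr0 mulrC cauchyT_taylor// ltW.
Qed.

(** The integral computing the derivative in [a] has the primitive t |-> - 1 /
    (circ t - a), which takes the same values at 0 and 2 pi; so the transform
    is constant, and it is evaluated at [a = 0]. *)
Lemma cauchyT_winding a : cabs a < s -> cauchyT (fun t => 'i%C * circ t) a = twopi%:C%C * 'i%C.
Proof.
move=> ha.
have dc : dcurve (fun t => 'i%C * circ t).
  by apply: dcurveM; [exact: dcurve_cst|exact: dcurve_circ].
have cM t : cabs ('i%C * circ t) <= s by rewrite cabsM cabs_i mul1r cabs_circ.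
have z0 : cabs (0 : C) < s by rewrite cabs0.
rewrite (@hasD_cst_ball _ _ s a 0 ha z0).
- rewrite /cauchyT -circint_cst; congr circint; apply/funext => t; rewrite subr0.
  by have := circ_neq t z0; rewrite subr0 => n0; rewrite mulfK.
- move=> u us; have := cauchyT_hasD dc cM us.
  suff -> : cauchyT' (fun t => 'i%C * circ t) u = 0 by [].
  rewrite /cauchyT' (@circint_primitive _ (fun t => - (circ t - u)^-1)).
  + by rewrite circ_closed subrr.
  + by apply/dcurve_rcont; do !apply: dcurveM => //; exact: dcurve_kernel.
  + move=> t _; have H := derRB (circ_derR t) (derR_cst u t).
    have := derRZ (-1) (derR_compD (hasW_inv (circ_neq t us)) H).
    rewrite subr0 => K; apply: derR_ext ltr01 _ (derR_eq K _).
      by move=> v _ /=; rewrite mulN1r.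
    have n0 := circ_neq t us; by field.
Qed.

(** The difference quotient [g] of [f] at [a] is continuous at [a] and
    holomorphic elsewhere, hence it has a primitive near the circle and
    integrates to zero along it. What remains is [f a] times the winding
    number. *)
Lemma cauchy_formula f r a : s < r -> r <= 1 ->
    (forall z, cabs z < r -> exists l, hasD f z l) -> cabs a < s ->
  cauchyT (fun t => f (circ t) * ('i%C * circ t)) a = twopi%:C%C * 'i%C * f a.
Proof.
move=> sr r1 Hf ha; have [l Hl] := Hf a (lt_trans ha sr).
pose g z := if z == a then l else (f z - f a) / (z - a).
have gD z : cabs z < r -> z != a -> exists l', hasD g z l'.
  move=> zr za; have [l1 L1] := Hf z zr.
  have za' : z - a != 0 by rewrite subr_eq0.
  have H1 := hasWB L1 (hasW_cst (f a) z).
  have H2 := hasW_invr (g := fun u : C => u - a) za' (hasWB (hasW_id z) (hasW_cst a z)).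
  have := hasWM H1 H2; rewrite !subr0 oppr0 !mul0r !mulr0 addr0 => H.
  eexists; apply: (@hasW_ext _ _ g _ _ _ (cabs (z - a))) H; first by rewrite cabs_gt0.
  move=> w wz; rewrite /g /=; case: eqP => [E|//].
  by move: wz; rewrite E cabsBC ltxx.
have gc z : cabs z < r -> cont_at g z.
  move=> zr; have [->|za] := eqVneq z a; last first.
    by have [l' /hasW_cont_at] := gD z zr za.
  move=> e e0; have [d d0 Hd] := Hl (e / 2) ltac:(lra).
  exists d => // w wd; rewrite /g eqxx; have [|wa] := eqVneq w a.
    by rewrite subrr cabs0.
  have wa' : 0 < cabs (w - a) by rewrite cabs_gt0 subr_eq0.
  have := Hd _ wd; rewrite subrKC mul0r addr0.
  have -> : f w - f a - l * (w - a) = ((f w - f a) / (w - a) - l) * (w - a).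
    by field; rewrite subr_eq0.
  by rewrite cabsM ler_pM2r//; lra.
pose rho := (s + r) / 2.
have srho : s < rho by rewrite /rho; lra.
have rhor : rho < r by rewrite /rho; lra.
have [F HF] := @primitive_ball _ g r rho a (lt_trans s0 srho) rhor
  (le_trans (ltW rhor) r1) gc gD.
have dz : dcurve (fun t => 'i%C * circ t).
  by apply: dcurveM; [exact: dcurve_cst|exact: dcurve_circ].
have fD t : exists l, hasD f (circ t) l by apply: Hf; rewrite cabs_circ.
have dfz : dcurve (fun t => f (circ t) * ('i%C * circ t)).
  by apply: dcurveM => //; apply: dcurve_comp fD; exact: dcurve_circ.
have dk := dcurve_kernel ha.
have gE t : g (circ t) = (f (circ t) - f a) / (circ t - a).
  rewrite /g; case: eqP => // E; have := circ_neq t ha.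
  by rewrite E subrr eqxx.
have : circint (fun t => g (circ t) * ('i%C * circ t)) = 0.
  rewrite (@circint_primitive _ (F \o circ)).
  + by rewrite /= circ_closed subrr.
  + apply/dcurve_rcont; apply: dcurveM => //.
    apply: (@dcurve_comp g) dcurve_circ _ => t; apply: gD; rewrite ?cabs_circ//.
    by rewrite -subr_eq0 circ_neq.
  + move=> t _; apply: derR_compD (circ_derR t); apply: HF.
    by rewrite cabs_circ.
have -> : (fun t => g (circ t) * ('i%C * circ t)) = (fun t =>
   f (circ t) * ('i%C * circ t) * (circ t - a)^-1 +
   (- f a) * ('i%C * circ t * (circ t - a)^-1)).
  by apply/funext => t; rewrite gE; ring.
rewrite circintD; [|exact: dcurveM|by apply: dcurveM; [exact: dcurve_cst|exact: dcurveM]].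
rewrite circintZ; last exact: dcurveM.
have := cauchyT_winding ha; rewrite /cauchyT => -> /eqP.
by rewrite mulNr subr_eq0 => /eqP ->; rewrite mulrC.
Qed.

End Circle.

(** [cauchyT_taylor] for Cauchy's formula on the circle of radius [r / 2]. *)
Lemma taylor0 f r (B : R) l : 0 < r -> r <= 1 ->
    (forall z, cabs z < r -> exists l, hasD f z l) ->
    (forall z, cabs z < r -> cabs (f z) <= B) -> hasD f 0 l ->
  forall h, cabs h <= r / 4 ->
    cabs (f h - f 0 - l * h) <= 64 * B / r ^+ 2 * cabs h ^+ 2.
Proof.
move=> r0 r1 Hf fB Hl; pose s := r / 2.
have s0 : 0 < s by rewrite divr_gt0.
have sr : s < r by rewrite /s; lra.
pose c t := f (circ s t) * ('i%C * circ s t).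
have dc : dcurve c.
  apply: dcurveM; last by apply: dcurveM; [exact: dcurve_cst|exact: dcurve_circ].
  by apply: dcurve_comp (dcurve_circ s) _ => t; apply: Hf; rewrite cabs_circ.
have cM t : cabs (c t) <= B * s.
  rewrite /c cabsM cabsM cabs_i mul1r cabs_circ// ler_wpM2r ?(ltW s0)// fB//.
  by rewrite cabs_circ.
have B0 : 0 <= B := le_trans (cabs_ge0 _) (fB 0 ltac:(by rewrite cabs0)).
pose k : C := twopi%:C%C * 'i%C.
have tp1 : 1 < twopi by have := pi_ge2 R; rewrite /twopi; lra.
have kE : cabs k = twopi by rewrite cabsM cabs_i mulr1 cabs_real gtr0_norm// twopi_gt0.
have k0 : k != 0 by rewrite -cabs_gt0 kE twopi_gt0.
have CF a : cabs a < s -> f a = k^-1 * cauchyT s c a.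
  by move=> ha; rewrite (cauchy_formula s0 sr r1 Hf ha) -/k mulKf.
have z0 : cabs (0 : C) < s by rewrite cabs0.
pose l' := k^-1 * cauchyT' s c 0.
have T h : cabs h <= r / 4 ->
    cabs (f h - f 0 - l' * h) <= 64 * B / r ^+ 2 * cabs h ^+ 2.
  move=> hh; have hs : cabs h < s by rewrite /s; lra.
  rewrite CF// CF// /l'.
  have -> : k^-1 * cauchyT s c h - k^-1 * cauchyT s c 0 - k^-1 * cauchyT' s c 0 * h =
     k^-1 * (cauchyT s c (0 + h) - cauchyT s c 0 - h * cauchyT' s c 0) by rewrite add0r; ring.
  have hh' : cabs h <= (s - cabs 0) / 2 by rewrite cabs0 /s; lra.
  have := cauchyT_taylor s0 dc cM z0 hh'; rewrite cabs0 subr0.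
  have -> : 16 * (B * s) / s ^+ 3 = 64 * B / r ^+ 2.
    by rewrite /s; field; rewrite gt_eqF.
  rewrite cabsM cabsV kE => H; rewrite ler_pdivrMl ?twopi_gt0//.
  apply: le_trans H _; rewrite ler_peMl ?(ltW tp1)//.
  by rewrite mulr_ge0 ?exprn_ge0 ?cabs_ge0// divr_ge0 ?exprn_ge0 ?mulr_ge0// ltW.
suff -> : l = l' by [].
apply: hasD_uniq Hl _; apply: (@little_sqr _ _ (64 * B / r ^+ 2) (r / 4)); first lra.
by move=> h hh; rewrite add0r mul0r addr0 T// ltW.
Qed.

Lemma hasD_shift f a z l : hasD f (a + z) l -> hasD (fun u : C => f (a + u)) z l.
Proof.
move=> H; have := hasD_comp (g := fun u : C => a + u) H (hasDD (hasW_cst a z) (hasW_id z)).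
by rewrite add0r mulr1.
Qed.

(** The constant depends on [f] only through the bound [B]. This uniformity is
    what lets holomorphy pass to pointwise limits, and what gives joint
    differentiability of separately holomorphic functions. *)
Lemma taylor f r a (B : R) l : 0 < r -> r <= 1 ->
    (forall z, cabs (z - a) < r -> exists l, hasD f z l) ->
    (forall z, cabs (z - a) < r -> cabs (f z) <= B) -> hasD f a l ->
  forall h, cabs h <= r / 4 ->
    cabs (f (a + h) - f a - l * h) <= 64 * B / r ^+ 2 * cabs h ^+ 2.
Proof.
move=> r0 r1 Hf fB Hl h hh.
have := @taylor0 (fun u : C => f (a + u)) r B l r0 r1; rewrite addr0; apply=> //.
- move=> z zr; have [|m Hm] := Hf (a + z); first by rewrite addrC addKr.
  by exists m; exact: hasD_shift.
- by move=> z zr; apply: fB; rewrite addrC addKr.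
- by apply: hasD_shift; rewrite addr0.
Qed.

(** [taylor] with an increment of modulus [r / 4]. *)
Lemma cauchy_estimate f r a (B : R) l : 0 < r -> r <= 1 ->
    (forall z, cabs (z - a) < r -> exists l, hasD f z l) ->
    (forall z, cabs (z - a) < r -> cabs (f z) <= B) -> hasD f a l ->
  cabs l <= 24 * B / r.
Proof.
move=> r0 r1 Hf fB Hl; pose h : C := (r / 4)%:C%C.
have hE : cabs h = r / 4 by rewrite cabs_real gtr0_norm; lra.
have := taylor r0 r1 Hf fB Hl (h := h); rewrite hE lexx => /(_ isT).
have -> : 64 * B / r ^+ 2 * (r / 4) ^+ 2 = 4 * B by field; rewrite gt_eqF.
have f1 : cabs (f (a + h)) <= B by apply: fB; rewrite addrC addKr hE; lra.
have f0 : cabs (f a) <= B by apply: fB; rewrite subrr cabs0.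
have := cabs_le_dist (l * h) (f (a + h) - f a); rewrite cabsM hE.
rewrite (cabsBC (l * h)); have := cabsB (f (a + h)) (f a) => h1 h2 h3.
by rewrite ler_pdivlMr//; lra.
Qed.

End Cauchy.

(** * Limits of holomorphic functions along ultrafilters *)

Section Limits.
Variable R : realType.
Local Notation C := R[i].

Definition limF (I : Type) (F : set_system I) (u : I -> C) (l : C) :=
  forall e : R, 0 < e -> F [set i | cabs (u i - l) < e].

Section Rules.
Variables (I : Type) (F : set_system I).
Context {FF : ProperFilter F}.
Implicit Types (u v : I -> C) (l m : C).

Lemma filter_ex2 (A B : set I) : F A -> F B -> exists i, A i /\ B i.
Proof. by move=> FA FB; have [i [? ?]] := filter_ex (filterI FA FB); exists i. Qed.

Lemma limF_cst l : limF F (fun=> l) l.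
Proof. by move=> e e0; apply: filterS filterT => i _ /=; rewrite subrr cabs0. Qed.

Lemma limF_ext u v l : F [set i | u i = v i] -> limF F u l -> limF F v l.
Proof.
by move=> E H e e0; apply: filterS2 E (H e e0) => i /= <-.
Qed.

Lemma limFD u v l m : limF F u l -> limF F v m -> limF F (fun i => u i + v i) (l + m).
Proof.
move=> H1 H2 e e0; have e2 : 0 < e / 2 by lra.
apply: filterS2 (H1 _ e2) (H2 _ e2) => i /= h1 h2.
by have := cabsD (u i - l) (v i - m); rewrite addrACA -opprD; lra.
Qed.

Lemma limFZ a u l : limF F u l -> limF F (fun i => a * u i) (a * l).
Proof.
move=> H e e0; have a1 : 0 < cabs a + 1 by have := cabs_ge0 a; lra.
apply: filterS (H _ (divr_gt0 e0 a1)) => i /=.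
rewrite -mulrBr cabsM ltr_pdivlMr// => h.
have := cabs_ge0 (u i - l); have := cabs_ge0 a; nra.
Qed.

Lemma limFB u v l m : limF F u l -> limF F v m -> limF F (fun i => u i - v i) (l - m).
Proof.
move=> H1 H2; have := limFD H1 (limFZ (-1) H2).
by rewrite mulN1r; apply: limF_ext; apply: filterS filterT => i _ /=; rewrite mulN1r.
Qed.

Lemma limF_sum (J : finType) (u : J -> I -> C) (l : J -> C) :
  (forall j, limF F (u j) (l j)) -> limF F (fun i => \sum_j u j i) (\sum_j l j).
Proof.
move=> H; elim: (index_enum J) => [|j s IH].
  apply: limF_ext (limF_cst _); first by apply: filterS filterT => i _ /=; rewrite !big_nil.
rewrite big_cons; apply: limF_ext (limFD (H j) IH).
by apply: filterS filterT => i _ /=; rewrite big_cons.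
Qed.

Lemma limF_le u l (B : R) : limF F u l -> F [set i | cabs (u i) <= B] -> cabs l <= B.
Proof.
move=> H HB; apply/ler_addgt0Pr => e e0.
have [i /= [h1 h2]] := filter_ex2 (H e e0) HB.
by have := cabs_le_dist l (u i); rewrite cabsBC; lra.
Qed.

Lemma limF_uniq u l m : limF F u l -> limF F u m -> l = m.
Proof.
move=> H1 H2; apply/subr0_eq/cabs_small => e e0.
apply: limF_le (limFB H1 H2) _.
by apply: filterS filterT => i _ /=; rewrite subrr cabs0 ltW.
Qed.

Lemma limF_ge0 u l : limF F u l -> F [set i | 0 <= u i] -> 0 <= l.
Proof.
move=> H H0; rewrite lecE/=; apply/andP; split.
  rewrite -normr_eq0 eq_le normr_ge0 andbT; apply/ler_addgt0Pr => e e0.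
  have [i /= [h1]] := filter_ex2 (H e e0) H0.
  rewrite lecE/= => /andP[/eqP h2 _].
  have := cabs_Im (u i - l); rewrite raddfB/= h2 sub0r normrN add0r; lra.
apply/ler_addgt0Pr => e e0.
have [i /= [h1]] := filter_ex2 (H e e0) H0.
rewrite lecE/= => /andP[_ h2].
have := cabs_Re (u i - l); rewrite raddfB/= => h3.
by have := ler_norm (complex.Re (u i) - complex.Re l); lra.
Qed.

End Rules.

Lemma ultra_bounded_real (I : Type) (F : set_system I) (u : I -> R) (B : R) :
  UltraFilter F -> F [set i | `|u i| <= B] ->
  exists l, forall e, 0 < e -> F [set i | `|u i - l| < e].
Proof.
move=> UF HB; pose A := [set x : R | F [set i | x <= u i]].
have A0 : A (- B).
  by apply: filterS HB => i /=; rewrite ler_norml => /andP[].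
have AB x : A x -> x <= B.
  move=> Ax; have [i /= [h1]] := filter_ex2 Ax HB.
  by rewrite ler_norml => /andP[_]; apply: le_trans.
have sA : has_sup A by split; [exists (- B)|exists B => x /AB].
exists (sup A) => e e0.
have [x Ax xs] := sup_adherent (eps := e / 2) ltac:(lra) sA.
have [h|h] := in_ultra_setVsetC [set i | sup A + e / 2 <= u i] UF.
  have := ub_le_sup sA.2 h; lra.
apply: filterS2 Ax h => i /= h1 /negP; rewrite -ltNge => h2.
by rewrite ltr_norml; lra.
Qed.

(** Limits along an ultrafilter play the role of normal families: every
    bounded family converges, and no subsequence has to be extracted. *)
Lemma ultra_bounded (I : Type) (F : set_system I) (u : I -> C) (B : R) :
  UltraFilter F -> F [set i | cabs (u i) <= B] -> exists l, limF F u l.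
Proof.
move=> UF HB.
have [x Hx] := @ultra_bounded_real _ _ (fun i => complex.Re (u i)) B UF
  ltac:(by apply: filterS HB => i /=; apply: le_trans (cabs_Re _)).
have [y Hy] := @ultra_bounded_real _ _ (fun i => complex.Im (u i)) B UF
  ltac:(by apply: filterS HB => i /=; apply: le_trans (cabs_Im _)).
exists (Complex x y) => e e0; have e2 : 0 < e / 2 by lra.
apply: filterS2 (Hx _ e2) (Hy _ e2) => i /= h1 h2.
by have := cabs_le_ReIm (u i - Complex x y); rewrite !raddfB/=; lra.
Qed.

(** Quantities that are bounded for small positive t have a limit along such
    an ultrafilter. *)
Lemma ultra_at0 : exists2 U : set_system R, UltraFilter U &
  forall d, 0 < d -> U [set t | 0 < t < d].
Proof.
have [U [UU sU]] := @ultraFilterLemma R (at_right 0) _.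
exists U => // d d0; apply: sU.
have : \forall t \near (0 : R)^'+, 0 < t < d.
  by near=> t; apply/andP; split; near: t; [exact: nbhs_right_gt|exact: nbhs_right_lt].
by [].
Unshelve. all: by end_near. Qed.

Definition cderiv (f : C -> C) z : C := xget 0 [set l | hasD f z l].

Lemma cderivP f z : (exists l, hasD f z l) -> hasD f z (cderiv f z).
Proof. by move=> [l Hl]; rewrite /cderiv; case: xgetP => [l' _ //|/(_ l)]. Qed.

Lemma cderiv_eq f z l : hasD f z l -> cderiv f z = l.
Proof. by move=> H; apply: hasD_uniq (cderivP (ex_intro _ _ H)) H. Qed.

(** The estimates of [taylor] and [cauchy_estimate] pass to the limit, since
    their constants depend only on the common bound [B]. *)
Lemma ultra_hol (I : Type) (F : set_system I) (f : I -> C -> C) g a (r B : R) :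
    UltraFilter F -> 0 < r -> r <= 1 ->
    F [set i | (forall z, cabs (z - a) < r -> exists l, hasD (f i) z l) /\
               (forall z, cabs (z - a) < r -> cabs (f i z) <= B)] ->
    (forall z, cabs (z - a) < r -> limF F (fun i => f i z) (g z)) ->
  exists2 l, hasD g a l & limF F (fun i => cderiv (f i) a) l.
Proof.
move=> UF r0 r1 HF Hlim.
have a0 : cabs (a - a) < r by rewrite subrr cabs0.
have [l Hl] : exists l, limF F (fun i => cderiv (f i) a) l.
  apply: (@ultra_bounded _ _ _ (24 * B / r)) => //.
  apply: filterS HF => i /= [h1 h2].
  exact: cauchy_estimate r0 r1 h1 h2 (cderivP (h1 a a0)).
exists l => //; apply: (@little_sqr _ _ (64 * B / r ^+ 2) (r / 4)); first lra.
move=> h hr; rewrite mul0r addr0.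
have ah : cabs (a + h - a) < r by rewrite addrAC subrr add0r; lra.
rewrite [l * h]mulrC.
apply: limF_le (limFB (limFB (Hlim _ ah) (Hlim _ a0)) (limFZ h Hl) ) _.
apply: filterS HF => i /= [h1 h2]; rewrite [h * _]mulrC.
by apply: taylor r0 r1 h1 h2 (cderivP (h1 a a0)) _ _; exact: ltW.
Qed.

Lemma hol_lip f (r : R) a (B : R) : 0 < r -> r <= 1 ->
    (forall z, cabs (z - a) < r -> exists l, hasD f z l) ->
    (forall z, cabs (z - a) < r -> cabs (f z) <= B) ->
  forall h, cabs h <= r / 4 -> cabs (f (a + h) - f a) <= 40 * B / r * cabs h.
Proof.
move=> r0 r1 Hf fB h hr.
have a0 : cabs (a - a) < r by rewrite subrr cabs0.
have B0 : 0 <= B := le_trans (cabs_ge0 _) (fB a a0).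
have L := cderivP (Hf a a0).
have T := taylor r0 r1 Hf fB L hr; have E := cauchy_estimate r0 r1 Hf fB L.
have := cabs_le_dist (f (a + h) - f a) (cderiv f a * h); rewrite cabsM => H.
have h0 := cabs_ge0 h.
have E2 := ler_wpM2r h0 E.
have : 64 * B / r ^+ 2 * cabs h ^+ 2 <= 16 * B / r * cabs h.
  have -> : 16 * B / r * cabs h = 64 * B / r ^+ 2 * (r / 4 * cabs h).
    by field; rewrite gt_eqF.
  rewrite ler_wpM2l//; first by rewrite divr_ge0 ?mulr_ge0 ?exprn_ge0 ?(ltW r0).
  by rewrite expr2 ler_wpM2r.
move=> T2; apply: le_trans H _.
have -> : 40 * B / r * cabs h = 24 * B / r * cabs h + 16 * B / r * cabs h by ring.
by apply: lerD => //; apply: le_trans T T2.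
Qed.

End Limits.

(** * Holomorphic functions on the bidisc *)

Section Bidisc.
Variable R : realType.
Local Notation C := R[i].
Implicit Types (P Q : C -> C -> C) (z v w h k : C) (rho : R).

Lemma quot_sqr_ge0 (B r : R) : 0 <= B -> 0 < r -> 0 <= 64 * B / r ^+ 2.
Proof. by move=> B0 r0; rewrite divr_ge0 ?mulr_ge0 ?exprn_ge0 ?(ltW r0). Qed.

(** A sesquiholomorphic kernel [L] is studied through (z, v) |-> L z (conj v),
    which is holomorphic in each variable. Boundedness on compact sets makes
    the one-variable estimates uniform in the other variable, and so replaces
    Hartogs' theorem. *)
Definition bihol P := [/\ forall z v, cabs z < 1 -> cabs v < 1 -> exists l, hasD (fun u => P u v) z l,
  forall z v, cabs z < 1 -> cabs v < 1 -> exists l, hasD (P z) v l &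
  forall rho, 0 < rho -> rho < 1 -> exists B, forall z v, cabs z <= rho -> cabs v <= rho ->
    cabs (P z v) <= B].

Definition swapK P : C -> C -> C := fun v z => P z v.
Definition D1 P : C -> C -> C := fun z v => cderiv (fun u => P u v) z.
Definition D2 P : C -> C -> C := fun z v => cderiv (P z) v.

Lemma bihol_swap P : bihol P -> bihol (swapK P).
Proof.
move=> [H1 H2 H3]; split.
- by move=> z v z1 v1; exact: H2.
- by move=> z v z1 v1; exact: H1.
- by move=> rho r0 /(H3 _ r0)[B HB]; exists B => z v zr vr; exact: HB.
Qed.

Lemma D1P P z v : bihol P -> cabs z < 1 -> cabs v < 1 ->
  hasD (fun u => P u v) z (D1 P z v).
Proof. by move=> [H _ _] z1 v1; apply: cderivP; exact: H. Qed.

Lemma D2P P z v : bihol P -> cabs z < 1 -> cabs v < 1 -> hasD (P z) v (D2 P z v).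
Proof. by move=> [_ H _] z1 v1; apply: cderivP; exact: H. Qed.

(** The constants are uniform on the bidisc of radius [rho] because the
    one-variable estimates only involve a bound of [P] on a larger bidisc. *)
Lemma bihol_est P rho : bihol P -> 0 < rho -> rho < 1 ->
  exists K d : R, [/\ 0 <= K, 0 < d, rho + d < 1 &
   forall z v h, cabs z <= rho -> cabs v <= rho -> cabs h <= d ->
   [/\ cabs (P (z + h) v - P z v - h * D1 P z v) <= K * cabs h ^+ 2,
       cabs (P (z + h) v - P z v) <= K * cabs h,
       cabs (D1 P z v) <= K & cabs (P z v) <= K]].
Proof.
move=> nP r0 r1; have [H1 H2 H3] := nP.
pose r := (1 - rho) / 2; have rr0 : 0 < r by rewrite /r; lra.
have rr1 : r <= 1 by rewrite /r; lra.
have [B HB] := H3 (rho + r) ltac:(rewrite /r; lra) ltac:(rewrite /r; lra).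
have B0 : 0 <= B.
  by apply: le_trans (cabs_ge0 (P 0 0)) (HB _ _ _ _); rewrite cabs0; lra.
pose K := 64 * B / r ^+ 2 + 40 * B / r + B.
have K1 : 0 <= 64 * B / r ^+ 2 by exact: quot_sqr_ge0.
have K2 : 0 <= 40 * B / r by apply: divr_ge0 (ltW rr0); rewrite mulr_ge0.
exists K, (r / 4); split; [rewrite /K; lra|rewrite /r; lra|rewrite /r; lra|].
move=> z v h zr vr hr.
have Hh u : cabs (u - z) < r -> exists l, hasD (fun u => P u v) u l.
  by move=> uz; apply: H1; have := cabs_le_dist u z; rewrite /r in uz *; lra.
have Hb u : cabs (u - z) < r -> cabs (P u v) <= B.
  by move=> uz; apply: HB; have := cabs_le_dist u z; lra.
have z0 : cabs (z - z) < r by rewrite subrr cabs0.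
have L := D1P nP (v := v) (le_lt_trans zr r1) (le_lt_trans vr r1).
have h0 := cabs_ge0 h; have h20 : 0 <= cabs h ^+ 2 by rewrite exprn_ge0.
split.
- have := taylor rr0 rr1 Hh Hb L hr; rewrite [_ * h]mulrC.
  by move=> /le_trans; apply; rewrite ler_wpM2r// /K; lra.
- have := hol_lip rr0 rr1 Hh Hb hr.
  by move=> /le_trans; apply; rewrite ler_wpM2r// /K; lra.
- have := cauchy_estimate rr0 rr1 Hh Hb L.
  have : 24 * B / r <= 40 * B / r.
    by rewrite ler_wpM2r ?invr_ge0 ?(ltW rr0)// ler_wpM2r//; lra.
  rewrite /K; lra.
- have := Hb z z0; rewrite /K; lra.
Qed.

(** [ultra_hol] in each variable, on a small disc around each point. *)
Lemma ultra_bihol (I : Type) (F : set_system I) (f : I -> C -> C -> C) G :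
    UltraFilter F ->
    (forall rho, 0 < rho -> rho < 1 -> exists B, F [set i | forall z v,
      cabs z <= rho -> cabs v <= rho -> [/\ exists l, hasD (fun u => f i u v) z l,
        exists l, hasD (f i z) v l & cabs (f i z v) <= B]]) ->
    (forall z v, cabs z < 1 -> cabs v < 1 -> limF F (fun i => f i z v) (G z v)) ->
  bihol G.
Proof.
move=> UF HB HL.
have mid z v : cabs z < 1 -> cabs v < 1 -> exists rho r : R,
    [/\ 0 < rho, rho < 1, 0 < r, r <= 1 & forall u, (cabs (u - z) < r -> cabs u <= rho) /\
      (cabs (u - v) < r -> cabs u <= rho) ].
  move=> z1 v1; pose m := Num.max (cabs z) (cabs v).
  have zm : cabs z <= m by rewrite le_max lexx.
  have vm : cabs v <= m by rewrite le_max lexx orbT.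
  have m1 : m < 1 by rewrite gt_max z1.
  have z0 := cabs_ge0 z.
  exists ((1 + m) / 2), ((1 - m) / 2); split; try lra.
  by move=> u; split=> uz; [have := cabs_le_dist u z|have := cabs_le_dist u v]; lra.
split.
- move=> z v z1 v1; have [rho [r [r0 r1 rr0 rr1 Hr]]] := mid z v z1 v1.
  have vr : cabs v <= rho by case: (Hr v) => _; apply; rewrite subrr cabs0.
  have [B FB] := HB _ r0 r1.
  have [l Hl _] := @ultra_hol R _ F (fun i u => f i u v) (fun u => G u v) z r B
    UF rr0 rr1 ltac:(by apply: filterS FB => i Hi; split=> u /(Hr u).1 ur;
      case: (Hi u v ur vr)) ltac:(by move=> u /(Hr u).1 ur; apply: HL => //;
      exact: le_lt_trans r1).
  by exists l.
- move=> z v z1 v1; have [rho [r [r0 r1 rr0 rr1 Hr]]] := mid z v z1 v1.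
  have zr : cabs z <= rho by case: (Hr z) => + _; apply; rewrite subrr cabs0.
  have [B FB] := HB _ r0 r1.
  have [l Hl _] := @ultra_hol R _ F (fun i u => f i z u) (G z) v r B
    UF rr0 rr1 ltac:(by apply: filterS FB => i Hi; split=> u /(Hr u).2 ur;
      case: (Hi z u zr ur)) ltac:(by move=> u /(Hr u).2 ur; apply: HL => //;
      exact: le_lt_trans r1).
  by exists l.
- move=> rho r0 r1; have [B FB] := HB _ r0 r1; exists B => z v zr vr.
  apply: limF_le (HL z v (le_lt_trans zr r1) (le_lt_trans vr r1)) _.
  by apply: filterS FB => i /= Hi; case: (Hi z v zr vr).
Qed.

(** Difference quotients in the first variable are holomorphic in each
    variable, bounded by [bihol_est], and converge to [D1 P]. *)
Lemma bihol_D1 P : bihol P -> bihol (D1 P).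
Proof.
move=> nP; have [H1 H2 H3] := nP.
have [U UU U0] := ultra_at0 R.
pose f (t : R) z v : C := t%:C%C^-1 * (P (z + t%:C%C) v - P z v).
have tE (t : R) : 0 < t -> cabs (t%:C%C : C) = t.
  by move=> t0; rewrite cabs_real gtr0_norm.
apply: (@ultra_bihol _ U f) => //.
- move=> rho r0 r1; have [K [d [K0 d0 rd HK]]] := bihol_est nP r0 r1.
  exists K; apply: filterS (U0 _ d0) => t /= /andP[t0 td] z v zr vr.
  have z1 := le_lt_trans zr r1; have v1 := le_lt_trans vr r1.
  have zt1 : cabs (z + t%:C%C) < 1 by have := cabsD z t%:C%C; rewrite tE//; lra.
  split.
  + have [l Hl] := H1 z v z1 v1; have [m Hm] := H1 (z + t%:C%C) v zt1 v1.
    have Hm' : hasD (fun u => P (u + t%:C%C) v) z m.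
      have := @hasD_shift _ (fun u => P u v) t%:C%C z m; rewrite addrC => /(_ Hm).
      by under eq_fun do rewrite addrC.
    exact: (ex_intro _ _ (hasDZ _ (hasDB Hm' Hl))).
  + have [l Hl] := H2 z v z1 v1; have [m Hm] := H2 (z + t%:C%C) v zt1 v1.
    exact: (ex_intro _ _ (hasDZ _ (hasDB Hm Hl))).
  + have [_ h _ _] := HK z v t%:C%C zr vr ltac:(rewrite tE//; exact: ltW).
    by rewrite tE// in h; rewrite /f cabsM cabsV tE// ler_pdivrMl// mulrC.
- move=> z v z1 v1.
  pose rho := (1 + Num.max (cabs z) (cabs v)) / 2.
  have zm : cabs z <= Num.max (cabs z) (cabs v) by rewrite le_max lexx.
  have vm : cabs v <= Num.max (cabs z) (cabs v) by rewrite le_max lexx orbT.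
  have m1 : Num.max (cabs z) (cabs v) < 1 by rewrite gt_max z1.
  have z0 := cabs_ge0 z.
  have [K [d [K0 d0 rd HK]]] := @bihol_est P rho nP ltac:(rewrite /rho; lra) ltac:(rewrite /rho; lra).
  have zr : cabs z <= rho by rewrite /rho; lra.
  have vr : cabs v <= rho by rewrite /rho; lra.
  move=> e e0; have K1 : 0 < K + 1 by lra.
  have dd : 0 < Num.min d (e / (K + 1)) by rewrite lt_min d0 divr_gt0.
  apply: filterS (U0 _ dd) => t /= /andP[t0]; rewrite lt_min => /andP[td te].
  have [h _ _ _] := HK z v t%:C%C zr vr ltac:(rewrite tE//; exact: ltW).
  have tn0 : t%:C%C != 0 :> C by rewrite -cabs_gt0 tE.
  have -> : f t z v - D1 P z v =
    t%:C%C^-1 * (P (z + t%:C%C) v - P z v - t%:C%C * D1 P z v) by rewrite /f; field.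
  rewrite cabsM cabsV tE// ltr_pdivrMl//; apply: le_lt_trans h _.
  rewrite tE// expr2 mulrCA ltr_pM2l//.
  by move: te; rewrite ltr_pdivlMr//; nra.
Qed.

Lemma bihol_D2 P : bihol P -> bihol (D2 P).
Proof. by move=> /bihol_swap/bihol_D1/bihol_swap. Qed.

Lemma bihol_est2 P rho : bihol P -> 0 < rho -> rho < 1 ->
  exists K d : R, [/\ 0 <= K, 0 < d, rho + d < 1 &
   forall z v h, cabs z <= rho -> cabs v <= rho -> cabs h <= d ->
   [/\ cabs (P z (v + h) - P z v - h * D2 P z v) <= K * cabs h ^+ 2,
       cabs (P z (v + h) - P z v) <= K * cabs h,
       cabs (D2 P z v) <= K & cabs (P z v) <= K]].
Proof.
move=> nP r0 r1; have [K [d [K0 d0 rd H]]] := bihol_est (bihol_swap nP) r0 r1.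
by exists K, d; split=> // z v h zr vr hd; exact: (H v z h vr zr hd).
Qed.

(** The increment is split into one in the first variable at conj (w + h) and
    one in the second variable at w. Replacing D1 P w (conj (w + h)) by its
    value at conj w costs O(|h|^2), because D1 P is Lipschitz in the second
    variable. *)
Lemma hasW_diag P w : bihol P -> cabs w < 1 ->
  hasW (fun u => P u u^*) w (D1 P w w^*) (D2 P w w^*).
Proof.
move=> nP w1; pose rho := (1 + cabs w) / 2; have w0 := cabs_ge0 w.
have r0 : 0 < rho by rewrite /rho; lra.
have r1 : rho < 1 by rewrite /rho; lra.
have [K1 [d1 [K10 d10 _ E1]]] := bihol_est nP r0 r1.
have [K2 [d2 [K20 d20 _ E2]]] := bihol_est2 nP r0 r1.
have [K3 [d3 [K30 d30 _ E3]]] := bihol_est2 (bihol_D1 nP) r0 r1.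
pose d := Num.min (Num.min d1 d2) (Num.min d3 (rho - cabs w)).
apply: (@little_sqr _ _ (K1 + K2 + K3) d).
  by rewrite !lt_min d10 d20 d30 subr_gt0 /rho; lra.
move=> h; rewrite !lt_min => /andP[/andP[h1 h2] /andP[h3 h4]].
have wr : cabs w <= rho by rewrite /rho; lra.
have wr' : cabs w^* <= rho by rewrite cabs_conj.
have whr : cabs (w^* + h^*) <= rho by have := cabsD w^* h^*; rewrite !cabs_conj; lra.
have [A1 _ _ _] := E1 w (w^* + h^*) h wr whr (ltW h1).
have [A2 _ _ _] := E2 w w^* h^* wr wr' ltac:(rewrite cabs_conj; exact: ltW).
have [_ A3 _ _] := E3 w w^* h^* wr wr' ltac:(rewrite cabs_conj; exact: ltW).
rewrite !cabs_conj in A2 A3; rewrite rmorphD/=.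
have -> : P (w + h) (w^* + h^*) - P w w^* - (D1 P w w^* * h + D2 P w w^* * h^*) =
  (P (w + h) (w^* + h^*) - P w (w^* + h^*) - h * D1 P w (w^* + h^*)) +
  (P w (w^* + h^*) - P w w^* - h^* * D2 P w w^*) +
  h * (D1 P w (w^* + h^*) - D1 P w w^*) by ring.
have h0 := cabs_ge0 h.
have : cabs (h * (D1 P w (w^* + h^*) - D1 P w w^*)) <= K3 * cabs h ^+ 2.
  by rewrite cabsM expr2 mulrCA ler_wpM2l.
move: A1 A2; set X := _ - h * _; set Y := _ - h^* * _; set Z := h * _ => A1 A2 A4.
rewrite !mulrDl; apply: le_trans (cabsD _ _) _.
by have := cabsD X Y; lra.
Qed.

(** The first difference [g] is O(t) uniformly in the second variable, so by
    [taylor] its increment in that variable is linear up to O(t^3). *)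
Lemma limF_second_diff P z v (U : set_system R) : ProperFilter U ->
    (forall d, 0 < d -> U [set t | 0 < t < d]) -> bihol P ->
    cabs z < 1 -> cabs v < 1 ->
  limF U (fun t : R => (t%:C%C ^+ 2)^-1 * (P (z + t%:C%C) (v + t%:C%C) -
    P (z + t%:C%C) v - P z (v + t%:C%C) + P z v)) (D1 (D2 P) z v).
Proof.
move=> PU U0 nP z1 v1.
pose m := Num.max (cabs z) (cabs v).
have zm : cabs z <= m by rewrite le_max lexx.
have vm : cabs v <= m by rewrite le_max lexx orbT.
have m1 : m < 1 by rewrite gt_max z1.
have z0 := cabs_ge0 z.
pose rho := (1 + m) / 2; pose r := (1 - m) / 2.
have r0 : 0 < rho by rewrite /rho; lra.
have r1 : rho < 1 by rewrite /rho; lra.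
have rr0 : 0 < r by rewrite /r; lra.
have rr1 : r <= 1 by rewrite /r; lra.
have [K1 [d1 [K10 d10 rd1 E1]]] := bihol_est nP r0 r1.
have [K2 [d2 [K20 d20 _ E2]]] := bihol_est (bihol_D2 nP) r0 r1.
pose K := 64 * K1 / r ^+ 2 + K2.
have KK0 : 0 <= 64 * K1 / r ^+ 2 by exact: quot_sqr_ge0.
move=> e e0; have Kp : 0 < K + 1 by rewrite /K; lra.
have dd : 0 < Num.min (Num.min d1 d2) (Num.min (r / 4) (e / (K + 1))).
  by rewrite !lt_min d10 d20 (divr_gt0 e0 Kp) andbT/=; lra.
apply: filterS (U0 _ dd) => t /= /andP[t0].
rewrite !lt_min => /andP[/andP[t1 t2] /andP[t3 t4]].
have tE : cabs (t%:C%C : C) = t by rewrite cabs_real gtr0_norm.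
have tn0 : t%:C%C != 0 :> C by rewrite -cabs_gt0 tE.
have zr : cabs z <= rho by rewrite /rho; lra.
have vr : cabs v <= rho by rewrite /rho; lra.
pose g u := P (z + t%:C%C) u - P z u.
have zt1 : cabs (z + t%:C%C) < 1 by have := cabsD z t%:C%C; rewrite tE; lra.
have near_v u : cabs (u - v) < r -> cabs u <= rho /\ cabs u < 1.
  by move=> uv; have := cabs_le_dist u v; rewrite /rho /r in uv *; lra.
have gD u : cabs u < 1 -> hasD g u (D2 P (z + t%:C%C) u - D2 P z u).
  by move=> u1; apply: hasDB; apply: D2P.
have T := @taylor _ g r v (K1 * t) _ rr0 rr1
  (fun u uv => ex_intro _ _ (gD u (near_v u uv).2)) _ (gD v v1) t%:C%C.
have {}T : cabs (g (v + t%:C%C) - g v - (D2 P (z + t%:C%C) v - D2 P z v) * t%:C%C)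
    <= 64 * (K1 * t) / r ^+ 2 * t ^+ 2.
  rewrite tE in T; apply: T; last exact: ltW.
  move=> u uv; have [_ h _ _] := E1 z u t%:C%C zr (near_v u uv).1 ltac:(rewrite tE; exact: ltW).
  by rewrite tE in h.
have [A _ _ _] := E2 z v t%:C%C zr vr ltac:(rewrite tE; exact: ltW).
rewrite tE in A.
pose S := P (z + t%:C%C) (v + t%:C%C) - P (z + t%:C%C) v - P z (v + t%:C%C) + P z v.
have -> : (t%:C%C ^+ 2)^-1 * S - D1 (D2 P) z v = (t%:C%C ^+ 2)^-1 *
  ((g (v + t%:C%C) - g v - (D2 P (z + t%:C%C) v - D2 P z v) * t%:C%C) +
   t%:C%C * (D2 P (z + t%:C%C) v - D2 P z v - t%:C%C * D1 (D2 P) z v)).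
  by rewrite /g /S; field.
rewrite cabsM cabsV cabsX tE ltr_pdivrMl ?exprn_gt0//.
move: A T; set X := _ - t%:C%C * _; set Y := _ - _ * t%:C%C => A T.
have B : cabs (t%:C%C * X) <= t * (K2 * t ^+ 2) by rewrite cabsM tE ler_pM2l.
have -> : t ^+ 2 * e = t * t * e by rewrite expr2.
apply: le_lt_trans (cabsD _ _) _.
pose kk := 64 * K1 / r ^+ 2.
have {}T : cabs Y <= kk * (t * t * t) by apply: le_trans T _; rewrite le_eqVlt; apply/orP; left; apply/eqP; rewrite /kk; ring.
have {}B : cabs (t%:C%C * X) <= K2 * (t * t * t).
  by apply: le_trans B _; rewrite le_eqVlt; apply/orP; left; apply/eqP; ring.
have t4' : (kk + K2 + 1) * t < e by rewrite mulrC -ltr_pdivlMr.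
have H : t * t * ((kk + K2 + 1) * t) < t * t * e by rewrite ltr_pM2l// mulr_gt0.
have t3' : 0 < t * t * t by rewrite !mulr_gt0.
apply: le_lt_trans (lerD T B) _; apply: lt_trans H.
have -> : t * t * ((kk + K2 + 1) * t) = kk * (t * t * t) + K2 * (t * t * t) + t * t * t by ring.
by rewrite ltrDl.
Qed.

End Bidisc.

(** * Positive definite kernels *)

Section PositiveDefinite.
Variable R : realType.
Local Notation C := R[i].

(** The algebraic half of [positive_definite_kernel], without holomorphy. *)
Definition pdT (T : Type) (X : set T) (K : T -> T -> C) :=
  forall (l : nat) (u : 'I_l -> T) (a : 'I_l -> C), (forall p, X (u p)) ->
    0 <= \sum_p \sum_q (a p)^* * a q * K (u p) (u q).

Variables (T : Type) (X : set T).
Implicit Types (K L : T -> T -> C).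

Lemma pd_fin K (J : finType) (u : J -> T) (a : J -> C) : pdT X K ->
  (forall p, X (u p)) -> 0 <= \sum_p \sum_q (a p)^* * a q * K (u p) (u q).
Proof.
move=> pK Xu.
have E (F : J -> C) : \sum_p F p = \sum_(i < #|J|) F (enum_val i).
  rewrite (reindex (@enum_val J J)) /=; last exact/onW_bij/enum_val_bij.
  by apply: eq_big => //.
rewrite E; under eq_bigr do rewrite E.
exact: (pK #|J| (u \o enum_val) (a \o enum_val) (fun p => Xu _)).
Qed.

Lemma pd_ext K L : (forall z w, X z -> X w -> K z w = L z w) -> pdT X K -> pdT X L.
Proof.
move=> E pK l u a Xu; have := pK l u a Xu; congr (_ <= _).
by apply: eq_bigr => p _; apply: eq_bigr => q _; rewrite E.
Qed.

Lemma pdD K L : pdT X K -> pdT X L -> pdT X (fun z w => K z w + L z w).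
Proof.
move=> pK pL l u a Xu; have := addr_ge0 (pK l u a Xu) (pL l u a Xu).
rewrite -big_split/=; congr (_ <= _); apply: eq_bigr => p _.
by rewrite -big_split/=; apply: eq_bigr => q _; rewrite mulrDr.
Qed.

Lemma pdZ (c : C) K : 0 <= c -> pdT X K -> pdT X (fun z w => c * K z w).
Proof.
move=> c0 pK l u a Xu; have := mulr_ge0 c0 (pK l u a Xu).
rewrite mulr_sumr; congr (_ <= _); apply: eq_bigr => p _.
by rewrite mulr_sumr; apply: eq_bigr => q _; rewrite mulrCA.
Qed.

Lemma pd_rank1 (g : T -> C) : pdT X (fun z w => g z * (g w)^*).
Proof.
move=> l u a _.
have -> : \sum_p \sum_q (a p)^* * a q * (g (u p) * (g (u q))^*) =
   (\sum_p (a p)^* * g (u p)) * (\sum_p (a p)^* * g (u p))^*.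
  rewrite mulr_suml; apply: eq_bigr => p _; rewrite rmorph_sum mulr_sumr.
  apply: eq_bigr => q _; rewrite rmorphM/= conjCK; ring.
by rewrite -normCK exprn_ge0.
Qed.

(** The values of [K] at the points [phi b z] are combined with the weights [s
    b z]. Riemann sums and second differences of kernels have this form. *)
Lemma pd_comb (T' : Type) (X' : set T') K (B : finType) (phi : B -> T' -> T)
    (s : B -> T' -> C) : (forall b z, X' z -> X (phi b z)) -> pdT X K ->
  pdT X' (fun z w => \sum_b \sum_c s b z * (s c w)^* * K (phi b z) (phi c w)).
Proof.
move=> Hphi pK l u a Xu.
have := @pd_fin K ('I_l * B)%type (fun pb => phi pb.2 (u pb.1))
  (fun pb => a pb.1 * (s pb.2 (u pb.1))^*) pK ltac:(by move=> [p b]; exact: Hphi).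
congr (_ <= _).
rewrite -(pair_bigA _ (fun p b => \sum_(q : 'I_l * B) (a p * (s b (u p))^*)^* *
   (a q.1 * (s q.2 (u q.1))^*) * K (phi b (u p)) (phi q.2 (u q.1))))/=.
apply: eq_bigr => p _; under [RHS]eq_bigr do rewrite mulr_sumr.
rewrite [RHS]exchange_big/=; apply: eq_bigr => b _.
rewrite -(pair_bigA _ (fun q c => (a p * (s b (u p))^*)^* *
   (a q * (s c (u q))^*) * K (phi b (u p)) (phi c (u q))))/=.
apply: eq_bigr => q _; rewrite mulr_sumr; apply: eq_bigr => c _.
rewrite rmorphM/= conjCK; ring.
Qed.

Lemma pd_lim (I : Type) (F : set_system I) (f : I -> T -> T -> C) K :
    ProperFilter F -> F [set i | pdT X (f i)] ->
    (forall z w, X z -> X w -> limF F (fun i => f i z w) (K z w)) ->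
  pdT X K.
Proof.
move=> PF Ff HL l u a Xu.
apply: (@limF_ge0 _ _ F PF (fun i => \sum_p \sum_q (a p)^* * a q * f i (u p) (u q))).
  by do 2!apply: limF_sum => ?; apply: limFZ; exact: HL.
by apply: filterS Ff => i /= /(_ l u a Xu).
Qed.

Lemma pd2 K z w (c : C) : pdT X K -> X z -> X w ->
  0 <= K z z + c * K z w + c^* * K w z + c * c^* * K w w.
Proof.
move=> pK Xz Xw.
have := @pd_fin K bool (fun b => if b then z else w) (fun b => if b then 1 else c) pK.
have -> : \sum_(p : bool) \sum_(q : bool)
   (if p then 1 else c)^* * (if q then 1 else c) *
   K (if p then z else w) (if q then z else w) =
   K z z + c * K z w + c^* * K w z + c * c^* * K w w.
  by rewrite !big_bool/= conjC1; ring.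
by apply; case.
Qed.

Lemma pd_ge0 K z : pdT X K -> X z -> 0 <= K z z.
Proof. by move=> pK Xz; have := @pd2 K z z 0 pK Xz Xz; rewrite conjC0 !mul0r !addr0. Qed.

(** The form of [pd2] is real for [c = 1] and for [c = 'i]. *)
Lemma pd_herm K z w : pdT X K -> X z -> X w -> K w z = (K z w)^*.
Proof.
move=> pK Xz Xw.
have /ger0_Im h1 := @pd2 K z w 1 pK Xz Xw; have /ger0_Im h2 := @pd2 K z w 'i%C pK Xz Xw.
have /ger0_Im h3 := pd_ge0 pK Xz; have /ger0_Im h4 := pd_ge0 pK Xw.
move: h1 h2; rewrite conjC1 conj_i !mul1r.
case: (K z z) h3 => a1 b1 /= ->; case: (K w w) h4 => a2 b2 /= ->.
case: (K z w) => a3 b3; case: (K w z) => a4 b4 /= h1 h2.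
by apply/eqP; rewrite eq_complex/=; apply/andP; split; apply/eqP; lra.
Qed.

(** In [pd2], [c] is taken unimodular with c K(z, w) = - |K(z, w)|. Thus
    bounds on the diagonal control the whole kernel. *)
Lemma pd_bound K z w : pdT X K -> X z -> X w ->
  2 * cabs (K z w) <= cabs (K z z) + cabs (K w w).
Proof.
move=> pK Xz Xw; have [->|k0] := eqVneq (K z w) 0.
  by rewrite cabs0 mulr0 addr_ge0 ?cabs_ge0.
have k1 : cabs (K z w) != 0 by rewrite cabs_eq0.
pose c : C := - ((cabs (K z w))^-1)%:C%C * (K z w)^*.
have kk : K z w * (K z w)^* = (cabs (K z w) ^+ 2)%:C%C.
  by rewrite -normCK cabsE -rmorphXn.
have e1 : c * K z w = - (cabs (K z w))%:C%C.
  have -> : c * K z w = - (((cabs (K z w))^-1)%:C%C * (K z w * (K z w)^*)).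
    by rewrite /c; ring.
  by rewrite kk -rmorphM/=; congr (- (_ %:C%C)); field.
have e2 : c^* * K w z = - (cabs (K z w))%:C%C.
  by rewrite (pd_herm pK Xz Xw) -rmorphM e1 rmorphN/= conj_realC.
have e3 : c * c^* = 1.
  rewrite -normCK cabsE /c !(cabsM, cabsN, cabs_conj) cabs_real.
  by rewrite ger0_norm ?invr_ge0 ?cabs_ge0// mulVf// expr1n.
have := @pd2 K z w c pK Xz Xw; rewrite e1 e2 e3 mul1r lecE/= => /andP[_].
rewrite !raddfD/= => h.
have := cabs_Re (K z z); have := cabs_Re (K w w).
have := ler_norm (complex.Re (K z z)); have := ler_norm (complex.Re (K w w)).
lra.
Qed.

(** The Schur product theorem. The spectral decomposition of the matrix of [K]
    writes the form of the product as a combination of forms of [L] whose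
    coefficients are the eigenvalues, and these are nonnegative. *)
Lemma pdM K L : pdT X K -> pdT X L -> pdT X (fun z w => K z w * L z w).
Proof.
move=> pK pL l u a Xu; pose A : 'M[C]_l := \matrix_(p, q) K (u p) (u q).
have Ah : A \is hermsymmx.
  apply/is_hermitianmxP; rewrite expr0 scale1r; apply/matrixP => p q.
  by rewrite !mxE (pd_herm pK (Xu q) (Xu p)).
have /orthomx_spectralP AE := hermitian_normalmx Ah.
set P := spectralmx A in AE; set d := spectral_diag A in AE.
have Pu : P \is unitarymx := spectral_unitarymx A.
have AE2 p q : K (u p) (u q) = \sum_k d 0 k * ((P k p)^* * P k q).
  have := congr1 (fun M => fun_of_matrix M p q) AE; rewrite /= !mxE => ->.
  apply: eq_bigr => k _; rewrite mul_mx_diag !mxE invmx_unitary// !mxE.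
  by rewrite mulrAC mulrC.
have d0 k : 0 <= d 0 k.
  have := pK l u (fun q => (P k q)^*) Xu; congr (_ <= _).
  transitivity ((P *m A *m map_mx (@Num.conj C) P^T) k k).
    rewrite !mxE exchange_big/=; apply: eq_bigr => q _; rewrite !mxE mulr_suml.
    by apply: eq_bigr => p _; rewrite !mxE conjCK mulrAC.
  have PP := unitarymxP Pu.
  rewrite AE invmx_unitary// !mulmxA PP mul1mx -mulmxA PP.
  by rewrite mulmx1 mxE eqxx mulr1n.
have -> : \sum_p \sum_q (a p)^* * a q * (K (u p) (u q) * L (u p) (u q)) =
  \sum_k d 0 k * \sum_p \sum_q (a p * P k p)^* * (a q * P k q) * L (u p) (u q).
  under [RHS]eq_bigr do rewrite mulr_sumr.
  rewrite [RHS]exchange_big/=; apply: eq_bigr => p _.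
  under [RHS]eq_bigr do rewrite mulr_sumr.
  rewrite [RHS]exchange_big/=; apply: eq_bigr => q _.
  rewrite AE2 mulr_suml mulr_sumr; apply: eq_bigr => k _; rewrite rmorphM/=; ring.
apply: sumr_ge0 => k _; apply: mulr_ge0; first exact: d0.
exact: (pL l u (fun q => a q * P k q) Xu).
Qed.

Lemma pd1 : pdT X (fun _ _ => 1).
Proof. by have := pd_rank1 (fun=> 1); rewrite conjC1 mulr1. Qed.

Lemma pdXn K n : pdT X K -> pdT X (fun z w => K z w ^+ n).
Proof.
move=> pK; elim: n => [|n IH]; first exact: pd1.
by apply: pd_ext (pdM pK IH) => z w _ _; rewrite exprS.
Qed.

End PositiveDefinite.

(** * Sesquiholomorphic kernels *)

Section Sesquiholomorphic.
Variable R : realType.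
Local Notation C := R[i].
Implicit Types (P Q : C -> C -> C) (z v w h k : C) (rho : R) (g q r : C -> C).

Definition conj2 (L : C -> C -> C) : C -> C -> C := fun z v => L z v^*.

Lemma conj2E L z w : conj2 L z w^* = L z w.
Proof. by rewrite /conj2 conjCK. Qed.

Lemma sesqui_conj2 L : sesquiholomorphic (disc R) L <->
  (forall z v, cabs z < 1 -> cabs v < 1 -> exists l, hasD (fun u => conj2 L u v) z l) /\
  (forall z v, cabs z < 1 -> cabs v < 1 -> exists l, hasD (conj2 L z) v l).
Proof.
split=> -[H1 H2]; split.
- move=> z v z1 v1; apply/derivable_hasD; apply: (H1 v^*); apply/discE => //.
  by rewrite cabs_conj.
- move=> z v z1 v1.
  have /derivable_hasD[l Hl] := H2 z ((discE z).2 z1) v^* ltac:(by apply/discE; rewrite cabs_conj).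
  have := hasD_conjconj Hl.
  by under eq_fun do rewrite conjCK; move=> H; exists l^*.
- move=> w /discE w1 z /discE z1; apply/derivable_hasD.
  have [l Hl] := H1 z w^* z1 ltac:(by rewrite cabs_conj).
  by exists l; move: Hl; under eq_fun do rewrite conj2E.
- move=> z /discE z1 w /discE w1; apply/derivable_hasD.
  have [l Hl] := H2 z w^* z1 ltac:(by rewrite cabs_conj).
  by have := hasD_conjconj Hl; under eq_fun do rewrite conj2E; move=> H; exists l^*.
Qed.

Lemma bihol_sesqui P : bihol P -> sesquiholomorphic (disc R) (fun z w => P z w^*).
Proof.
move=> [H1 H2 _]; apply/sesqui_conj2.
by have -> : conj2 (fun z w => P z w^*) = P
  by apply/funext => z; apply/funext => v; rewrite /conj2 conjCK.
Qed.

(** By [pd_bound] it suffices to bound the kernel on the diagonal. *)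
Lemma bihol_of_pd L : positive_definite_kernel (disc R) L ->
    (forall rho, 0 < rho -> rho < 1 -> exists B : R, forall w, cabs w <= rho -> cabs (L w w) <= B) ->
  bihol (conj2 L).
Proof.
move=> [/sesqui_conj2[H1 H2] pL] HB; split=> // rho r0 r1.
have [B HB'] := HB rho r0 r1; exists B => z v zr vr.
have := @pd_bound _ _ (disc R) L z v^* pL.
move=> /(_ ltac:(by apply/discE; lra) ltac:(by apply/discE; rewrite cabs_conj; lra)).
have := HB' z zr; have := HB' v^* ltac:(by rewrite cabs_conj).
rewrite /conj2; lra.
Qed.

(** Compactness of the disc of radius [rho], through [rect_induction] on a
    square containing it. *)
Lemma local_bounded (phi : C -> R) :
    (forall w, cabs w < 1 -> exists d B : R, 0 < d /\
       forall z, cabs (z - w) < d -> phi z <= B) ->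
  forall rho, 0 < rho -> rho < 1 -> exists B, forall w, cabs w <= rho -> phi w <= B.
Proof.
move=> loc rho r0 r1.
pose P (x y p q : R) := exists B : R, forall u v : R, x <= u <= x + p -> y <= v <= y + q ->
   cabs (Complex u v) <= rho -> phi (Complex u v) <= B.
have [B HB] : P (- rho) (- rho) (2 * rho) (2 * rho).
  apply: (@rect_induction R P); try lra.
  - move=> x y p q [B1 H1] [B2 H2] [B3 H3] [B4 H4].
    exists (Num.max (Num.max B1 B2) (Num.max B3 B4)) => u v /andP[u1 u2] /andP[v1 v2] uv.
    rewrite !le_max.
    have [ux|ux] := leP u (x + p / 2); have [vy|vy] := leP v (y + q / 2).
    + by rewrite H1//; lra.
    + by rewrite (H3 u v) ?orbT//; lra.
    + by rewrite (H2 u v) ?orbT//; lra.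
    + by rewrite (H4 u v) ?orbT//; lra.
  - move=> u v hu hv; have [uv|uv] := leP (cabs (Complex u v)) rho.
      have [d [B [d0 Hd]]] := loc _ (le_lt_trans uv r1).
      exists d => // x y p q p0 q0 _ _ _ _ /andP[? ?] /andP[? ?] pq.
      exists B => s t /andP[? ?] /andP[? ?] _; apply: Hd.
      apply: le_lt_trans (cabs_le_ReIm _) _ => /=; apply: le_lt_trans pq.
      by apply: lerD; rewrite ler_norml; lra.
    exists (cabs (Complex u v) - rho); first lra.
    move=> x y p q p0 q0 _ _ _ _ /andP[? ?] /andP[? ?] pq.
    exists 0 => s t /andP[? ?] /andP[? ?] st.
    have := cabs_le_dist (Complex u v) (Complex s t).
    have : cabs (Complex u v - Complex s t) <= p + q.
      apply: le_trans (cabs_le_ReIm _) _ => /=.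
      by apply: lerD; rewrite ler_norml; lra.
    lra.
exists B => -[u v] uv; apply: HB => //.
- by have := le_trans (cabs_Re _) uv; rewrite /= ler_norml; lra.
- by have := le_trans (cabs_Im _) uv; rewrite /= ler_norml; lra.
Qed.

Lemma hasW_local_bound g w (p q : C) : hasW g w p q ->
  exists d : R, 0 < d /\ forall z, cabs (z - w) < d -> cabs (g z) <= cabs (g w) + 1.
Proof.
move=> /hasW_cont/(_ 1 ltr01)[d d0 H]; exists d; split=> // z /H.
by have := cabs_le_dist (g z) (g w); lra.
Qed.

Lemma hasW_bounded g : (forall w, cabs w < 1 -> exists p q : C, hasW g w p q) ->
  forall rho, 0 < rho -> rho < 1 -> exists B : R, forall w, cabs w <= rho -> cabs (g w) <= B.
Proof.
move=> H; apply: local_bounded => w /H[p [q /hasW_local_bound[d [d0 Hd]]]].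
by exists d, (cabs (g w) + 1).
Qed.

Lemma bihol_mul P Q : bihol P -> bihol Q -> bihol (fun z v => P z v * Q z v).
Proof.
move=> [P1 P2 P3] [Q1 Q2 Q3]; split.
- move=> z v z1 v1; have [l Hl] := P1 z v z1 v1; have [m Hm] := Q1 z v z1 v1.
  exact: (ex_intro _ _ (hasDM Hl Hm)).
- move=> z v z1 v1; have [l Hl] := P2 z v z1 v1; have [m Hm] := Q2 z v z1 v1.
  exact: (ex_intro _ _ (hasDM Hl Hm)).
- move=> rho r0 r1; have [B1 H1] := P3 rho r0 r1; have [B2 H2] := Q3 rho r0 r1.
  exists (B1 * B2) => z v zr vr; rewrite cabsM.
  by apply: ler_pM; rewrite ?cabs_ge0//; [exact: H1|exact: H2].
Qed.

Lemma bihol_1B : bihol (fun z v => 1 - z * v).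
Proof.
split.
- move=> z v _ _; have := hasDB (hasW_cst 1 z) (hasDM (hasW_id z) (hasW_cst v z)).
  by move=> H; exact: (ex_intro _ _ H).
- move=> z v _ _; have := hasDB (hasW_cst 1 v) (hasDZ z (hasW_id v)).
  by move=> H; exact: (ex_intro _ _ H).
- move=> rho r0 r1; exists 2 => z v zr vr; apply: le_trans (cabsB _ _) _.
  rewrite cabs1 cabsM; have : cabs z * cabs v <= 1 * 1 by apply: ler_pM; rewrite ?cabs_ge0//; lra.
  lra.
Qed.


(** * Logarithms of positive functions *)

Lemma pos_real (x : C) : 0 < x -> x = (complex.Re x)%:C%C /\ 0 < complex.Re x.
Proof. by case: x => a b; rewrite ltcE/= => /andP[/eqP ->]. Qed.

Lemma hasW_log g w (p q : C) : cabs w < 1 -> (forall z, cabs z < 1 -> 0 < g z) ->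
  hasW g w p q -> hasW (log_of g) w (p / g w) (q / g w).
Proof.
move=> w1 g0 H.
have d0 : 0 < 1 - cabs w by rewrite subr_gt0.
have gr z : cabs (z - w) < 1 - cabs w -> (g z)^* = g z.
  move=> zw; have z1 : cabs z < 1 by have := cabs_le_dist z w; lra.
  by rewrite (pos_real (g0 z z1)).1 conj_realC.
have pq := hasW_real d0 gr H.
have [gE gp] := pos_real (g0 w w1).
have := hasW_comp (hasW_Re (is_derive1_ln gp)) H.
have nz : (complex.Re (g w))%:C%C != 0 :> C by rewrite -gE gt_eqF// g0.
move=> K; apply: hasW_eq K _ _; rewrite pq ?conjCK fmorphV [in RHS]gE; by field.
Qed.

(** On the disc, [q] is dbar log g and [r] is d dbar log g; the other
    derivatives exist but are left unnamed. *)
Definition logW g q r := forall w, cabs w < 1 ->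
  (exists p, hasW (log_of g) w p (q w)) /\ (exists s, hasW q w (r w) s).

Lemma logW_ddbar g q r w : logW g q r -> cabs w < 1 -> ddbar_log g w = r w.
Proof.
move=> H w1; have [_ [s Hs]] := H w w1; apply: (@d_w_hasW _ _ _ _ s).
apply: (hasW_ext (d := 1 - cabs w) _ _ Hs); first by rewrite subr_gt0.
move=> z zw; have z1 : cabs z < 1 by have := cabs_le_dist z w; lra.
by have [[p Hp] _] := H z z1; rewrite (d_wbar_hasW Hp).
Qed.

Lemma logWD g1 g2 g q1 q2 r1 r2 : logW g1 q1 r1 -> logW g2 q2 r2 ->
    (forall w, cabs w < 1 -> log_of g w = log_of g1 w + log_of g2 w) ->
  logW g (fun w => q1 w + q2 w) (fun w => r1 w + r2 w).
Proof.
move=> H1 H2 E w w1; have [[p1 P1] [s1 S1]] := H1 w w1; have [[p2 P2] [s2 S2]] := H2 w w1.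
split; last by exists (s1 + s2); exact: hasWD.
exists (p1 + p2); apply: (hasW_ext (d := 1 - cabs w) _ _ (hasWD P1 P2)); first by rewrite subr_gt0.
by move=> z zw; rewrite E//; have := cabs_le_dist z w; lra.
Qed.

Lemma logWN g1 g q r : logW g1 q r ->
    (forall w, cabs w < 1 -> log_of g w = - log_of g1 w) ->
  logW g (fun w => - q w) (fun w => - r w).
Proof.
move=> H1 E w w1; have [[p1 P1] [s1 S1]] := H1 w w1.
split; last by exists (- s1); exact: hasWN.
exists (- p1); apply: (hasW_ext (d := 1 - cabs w) _ _ (hasWN P1)); first by rewrite subr_gt0.
by move=> z zw; rewrite E//; have := cabs_le_dist z w; lra.
Qed.

(** The functions dbar log g and d dbar log g for g w = P w (conj w). *)
Definition dlog P w := D2 P w w^* / P w w^*.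
Definition ddlog P w := D1 (D2 P) w w^* / P w w^* -
  D2 P w w^* * D1 P w w^* / P w w^* ^+ 2.

Lemma logW_bihol P : bihol P -> (forall w, cabs w < 1 -> 0 < P w w^*) ->
  logW (fun w => P w w^*) (dlog P) (ddlog P).
Proof.
move=> nP P0 w w1; have HP := hasW_diag nP w1; split.
  by exists (D1 P w w^* / P w w^*); exact: hasW_log w1 P0 HP.
have Pn : P w w^* != 0 by rewrite gt_eqF ?P0.
have := hasWM (hasW_diag (bihol_D2 nP) w1) (hasW_invr (g := fun w => P w w^*) Pn HP).
move=> H; eexists; apply: hasW_eq H _ (erefl _).
by rewrite /ddlog; field.
Qed.

Lemma log_ofM g1 g2 w : 0 < g1 w -> 0 < g2 w ->
  log_of (fun z => g1 z * g2 z) w = log_of g1 w + log_of g2 w.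
Proof.
move=> /pos_real[E1 p1] /pos_real[E2 p2]; rewrite /log_of -rmorphD/= -lnM ?posrE//.
move: E1 E2 {p1 p2}; case: (g1 w) => a b [->]; case: (g2 w) => c d [->] /=.
by rewrite mulr0 subr0.
Qed.

Lemma log_ofV g w : 0 < g w -> log_of (fun z => (g z)^-1) w = - log_of g w.
Proof.
move=> /pos_real[E1 p1]; rewrite /log_of -rmorphN/= -lnV ?posrE//.
by rewrite [in X in X = _]E1 -fmorphV.
Qed.

(** * The complex exponential *)

Definition cexp z : C :=
  (expR (complex.Re z))%:C%C * Complex (cos (complex.Im z)) (sin (complex.Im z)).

Lemma cexp0 : cexp 0 = 1.
Proof. by rewrite /cexp/= expR0 cos0 sin0 mul1r. Qed.

Lemma cexpD z w : cexp (z + w) = cexp z * cexp w.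
Proof.
rewrite /cexp !raddfD/= expRD rmorphM/= cosD sinD mulrACA; congr (_ * _).
by apply/eqP; rewrite eq_complex/= eqxx addrC eqxx.
Qed.

Lemma cexp_real (x : R) : cexp x%:C%C = (expR x)%:C%C.
Proof. by rewrite /cexp/= cos0 sin0 mulr1. Qed.

Lemma conj_cexp z : (cexp z)^* = cexp z^*.
Proof.
rewrite /cexp rmorphM/= conj_realC; case: z => a b /=; congr (_ * _).
by apply/eqP; rewrite eq_complex/= cosN sinN !eqxx.
Qed.

Lemma cabs_cexp z : cabs (cexp z) = expR (complex.Re z).
Proof.
rewrite cabsM cabs_real gtr0_norm ?expR_gt0// -[RHS]mulr1; congr (_ * _).
apply/eqP; rewrite -(@eqrXn2 _ 2)// ?cabs_ge0//.
by rewrite cabs_sqr/= cos2Dsin2 expr1n.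
Qed.

Lemma hasW_Im (phi : R -> R) z (l : R) : is_derive (complex.Im z) 1 phi l ->
  hasW (fun u => (phi (complex.Im u))%:C%C) z (- 'i%C * l%:C%C / 2) ('i%C * l%:C%C / 2).
Proof.
have Im_ u : complex.Re (- 'i%C * u) = complex.Im u.
  by case: u => a b /=; ring.
move=> H; have Hm : hasW (fun u => - 'i%C * u) z (- 'i%C) 0.
  by apply: hasW_eq (hasWZ (- 'i%C) (hasW_id z)) _ _; rewrite ?mulr1 ?mulr0.
have := hasW_comp (g := fun u => - 'i%C * u) (@hasW_Re R phi (- 'i%C * z) l _) Hm.
rewrite Im_ => /(_ H) K.
have {}K := hasW_ext (g2 := fun u => (phi (complex.Im u))%:C%C) ltr01 (fun u _ => _) K.
apply: hasW_eq (K _) _ _; first by move=> u; rewrite /= Im_.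
- by rewrite rmorph0 mulr0 addr0; field.
- by rewrite rmorphN/= conj_i opprK mulr0 add0r; field.
Qed.

Lemma cexp_hasD0 : hasD cexp 0 1.
Proof.
have ii : 'i%C * 'i%C = -1 :> C by rewrite -expr2 sqr_i.
have He := @hasW_Re R expR 0 _ (is_derive_expR _).
have Hc := @hasW_Im cos 0 _ (is_derive_cos _).
have Hs := @hasW_Im sin 0 _ (is_derive_sin _).
have := hasWM He (hasWD Hc (hasWZ 'i%C Hs)) => /=.
rewrite expR0 cos0 sin0 oppr0 => H.
have {}H := hasW_ext (g2 := cexp) ltr01 (fun u _ => _) H.
apply: hasW_eq (H _) _ _.
- move=> u; rewrite /cexp; congr (_ * _).
  by rewrite [RHS]complexE.
- rewrite !rmorph1 !rmorph0 !mulr0 !addr0 !mul0r !add0r !mulr1 !mul1r mulrA mulrN ii opprK.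
  by field.
- rewrite !rmorph1 !rmorph0 !mulr0 !addr0 !mul0r !add0r !mulr1 !mul1r mulrA ii.
  by field.
Qed.

Lemma cexp_hasD z : hasD cexp z (cexp z).
Proof.
have := hasDZ (cexp z) (hasD_shift (f := cexp) (a := - z) (z := z) (l := 1) _).
rewrite mulr1 addNr => /(_ cexp_hasD0) H; apply: hasW_ext ltr01 _ H => u _.
by rewrite -cexpD addrA subrr add0r.
Qed.

Lemma expn_diff (a b : C) (M : R) n : 1 <= M -> cabs a <= M -> cabs b <= M ->
  cabs (a ^+ n - b ^+ n) <= n%:R * M ^+ n * cabs (a - b).
Proof.
move=> M1 aM bM; have M0 : 0 <= M by lra.
elim: n => [|n IH]; first by rewrite subrr cabs0 !mul0r.
have -> : a ^+ n.+1 - b ^+ n.+1 = a * (a ^+ n - b ^+ n) + (a - b) * b ^+ n.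
  by rewrite !exprS; ring.
apply: le_trans (cabsD _ _) _; rewrite !cabsM cabsX.
have h1 : cabs a * cabs (a ^+ n - b ^+ n) <= M * (n%:R * M ^+ n * cabs (a - b)).
  by apply: ler_pM; rewrite ?cabs_ge0.
have h2 : cabs b ^+ n <= M ^+ n.+1.
  apply: (@le_trans _ _ (M ^+ n)); first by rewrite lerXn2r ?nnegrE ?cabs_ge0.
  by rewrite exprS ler_peMl// exprn_ge0.
have h3 : cabs (a - b) * cabs b ^+ n <= cabs (a - b) * M ^+ n.+1.
  by rewrite ler_wpM2l ?cabs_ge0.
apply: le_trans (lerD h1 h3) _; rewrite le_eqVlt; apply/orP; left; apply/eqP.
by rewrite exprS -[n.+1]addn1 natrD; ring.
Qed.

(** Compared with the power cexp (z / n) ^ n, the two bases differ by o(1 / n)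
    and have modulus at most exp (|z| / n). *)
Lemma limF_cexp z : limF \oo (fun n : nat => (1 + z / n.+1%:R) ^+ n.+1) (cexp z).
Proof.
move=> e e0; pose M := expR (cabs z); have M0 : 0 < M := expR_gt0 _.
pose e' := e / (2 * M * (cabs z + 1)).
have z1 : 0 < cabs z + 1 by rewrite ltr_wpDl ?cabs_ge0.
have e'0 : 0 < e' by rewrite divr_gt0// !mulr_gt0.
have [d d0 Hd] := cexp_hasD0 e'0.
have n0 n : (n.+1%:R : C) = (n.+1%:R : R)%:C%C by rewrite rmorph_nat.
have np n : 0 < n.+1%:R :> R by rewrite ltr0n.
have zn n : cabs (z / n.+1%:R) = cabs z / n.+1%:R.
  by rewrite cabsM cabsV n0 cabs_real ger0_norm.
exists (Num.truncn (cabs z / d)) => // n /= hn.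
have hd : cabs (z / n.+1%:R) < d.
  rewrite zn ltr_pdivrMr// mulrC -ltr_pdivrMr//.
  by apply: lt_le_trans (Num.Theory.truncnS_gt _) _; rewrite ler_nat ltnS.
have -> : cexp z = cexp (z / n.+1%:R) ^+ n.+1.
  suff H m : cexp (m%:R * (z / n.+1%:R)) = cexp (z / n.+1%:R) ^+ m.
    by rewrite -H; congr cexp; rewrite mulrC divfK ?pnatr_eq0.
  elim: m => [|m IH]; first by rewrite mul0r cexp0.
  by rewrite exprS -IH -cexpD -{1}[m.+1]add1n natrD mulrDl mul1r.
pose Mn := expR (cabs z / n.+1%:R).
have Mn1 : 1 <= Mn by rewrite -expR0 ler_expR divr_ge0 ?cabs_ge0.
have MnE : Mn ^+ n.+1 = M.
  by rewrite -expRM_natl mulrC divfK// gt_eqF.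
have b1 : cabs (1 + z / n.+1%:R) <= Mn.
  apply: le_trans (cabsD _ _) _; rewrite cabs1 zn; exact: expR_ge1Dx.
have a1 : cabs (cexp (z / n.+1%:R)) <= Mn.
  rewrite cabs_cexp ler_expR; apply: le_trans (ler_norm _) _.
  by rewrite -zn; exact: cabs_Re.
rewrite cabsBC; apply: le_lt_trans (expn_diff n.+1 Mn1 a1 b1) _; rewrite MnE.
have := Hd _ hd; rewrite add0r cexp0 mul1r mul0r addr0 -addrA -opprD => h.
apply: (@le_lt_trans _ _ (n.+1%:R * M * (e' * (cabs z / n.+1%:R)))).
  by rewrite -zn ler_wpM2l// mulr_ge0// ltW.
have -> : n.+1%:R * M * (e' * (cabs z / n.+1%:R)) = e * (cabs z / (2 * (cabs z + 1))).
  by rewrite /e'; field; rewrite !gt_eqF.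
rewrite gtr_pMr// ltr_pdivrMr ?mulr_gt0//; have := cabs_ge0 z; lra.
Qed.

(** The powers of 1 + K / n are positive definite by the Schur product
    theorem, and they converge to the exponential of [K]. *)
Lemma pd_cexp (T : Type) (X : set T) (K : T -> T -> C) : pdT X K ->
  pdT X (fun z w : T => cexp (K z w)).
Proof.
move=> pK; apply: (@pd_lim _ _ _ _ \oo (fun n (z w : T) => (1 + K z w / n.+1%:R) ^+ n.+1)).
  apply: filterS filterT => n _ /=; apply: pdXn; apply: pdD; first exact: pd1.
  apply: (@pd_ext _ _ _ (fun z w : T => n.+1%:R^-1 * K z w)).
    by move=> z w _ _; rewrite mulrC.
  by apply: pdZ => //; rewrite invr_ge0 ler0n.
by move=> z w _ _; exact: limF_cexp.
Qed.


(** * Primitives of kernels *)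

(** The Riemann sum, for n equal steps, of the integral of [Q] in its first
    variable along the segment from 0 to [z]. *)
Definition riemann n Q z v : C := \sum_(j < n) z / n%:R * Q (j%:R / n%:R * z) v.

Lemma ratio_le1 n (j : 'I_n) : cabs ((j%:R / n%:R) : C) <= 1.
Proof.
have n0 : (0 < n)%N by apply: leq_ltn_trans (ltn_ord j).
have -> : (j%:R / n%:R : C) = (j%:R / n%:R : R)%:C%C by rewrite fmorph_div !rmorph_nat.
rewrite cabs_real ger0_norm ?divr_ge0// ler_pdivrMr ?ltr0n// mul1r ler_nat ltnW//.
Qed.

Lemma riemann_le n Q z v (B : R) : (0 < n)%N ->
    (forall u, cabs u <= cabs z -> cabs (Q u v) <= B) ->
  cabs (riemann n Q z v) <= cabs z * B.
Proof.
move=> n0 HB; apply: le_trans (cabs_sum _ _ _) _.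
have nE : cabs (n%:R : C) = n%:R.
  by rewrite -(rmorph_nat (real_complex R)) cabs_real ger0_norm.
apply: (@le_trans _ _ (\sum_(j < n) cabs z / n%:R * B)).
  apply: ler_sum => j _; rewrite !cabsM cabsV nE ler_wpM2l//.
    by rewrite divr_ge0 ?cabs_ge0.
  apply: HB; rewrite cabsM -[leRHS]mul1r ler_wpM2r ?cabs_ge0//.
  exact: ratio_le1.
rewrite sumr_const card_ord -mulr_natl le_eqVlt; apply/orP; left; apply/eqP.
by field; rewrite pnatr_eq0 -lt0n.
Qed.

(** The primitive in the first variable that vanishes at 0. Its approximation
    by Riemann sums, with a rate uniform on compact sets, shows that it is
    holomorphic in the second variable as well, and will transfer positive
    definiteness to it. *)
Lemma bihol_primitive Q : bihol Q -> exists G, [/\ bihol G,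
  forall z v, cabs z < 1 -> cabs v < 1 -> hasD (fun u => G u v) z (Q z v) &
  forall rho, 0 < rho -> rho < 1 -> exists (K : R) (N : nat), forall n z v, (N < n)%N ->
    cabs z <= rho -> cabs v <= rho -> cabs (G z v - riemann n Q z v) <= K / n%:R].
Proof.
move=> nQ; have [Q1 Q2 Q3] := nQ.
have /choice[F HF] : forall v, exists F : C -> C, cabs v < 1 ->
    forall z, cabs z < 1 -> hasD F z (Q z v).
  move=> v; have [v1|v1] := pselect (cabs v < 1); last by exists id.
  have [F HF] := @primitive_disc R (fun u => Q u v) (fun z hz => Q1 z v hz v1).
  by exists F.
pose G z v := F v z - F v 0.
have GD z v : cabs z < 1 -> cabs v < 1 -> hasD (fun u => G u v) z (Q z v).
  move=> z1 v1; rewrite -[Q z v]subr0; apply: hasDB; first exact: HF.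
  exact: hasW_cst.
have GR rho : 0 < rho -> rho < 1 -> exists (K : R) (N : nat), forall n z v, (N < n)%N ->
    cabs z <= rho -> cabs v <= rho -> cabs (G z v - riemann n Q z v) <= K / n%:R.
  move=> r0 r1; have [K [d [K0 d0 rd HK]]] := bihol_est nQ r0 r1.
  exists K, (Num.truncn d^-1) => n z v nN zr vr.
  have n0 : (0 < n)%N by apply: leq_ltn_trans nN.
  have nR0 : 0 < n%:R :> R by rewrite ltr0n.
  have z1 := le_lt_trans zr r1; have v1 := le_lt_trans vr r1.
  have nE : (n%:R : C) = (n%:R : R)%:C%C by rewrite rmorph_nat.
  have nC : cabs (n%:R : C) = n%:R by rewrite nE cabs_real ger0_norm.
  pose h := z / n%:R.
  have hE : cabs h = cabs z / n%:R by rewrite cabsM cabsV nC.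
  have hn : cabs h <= n%:R^-1 by rewrite hE ler_piMl ?invr_ge0// ltW.
  have hd : cabs h <= d.
    apply: le_trans hn _; rewrite -[d]invrK lef_pV2 ?posrE ?invr_gt0//.
    by apply: ltW; apply: lt_le_trans (Num.Theory.truncnS_gt _) _; rewrite ler_nat.
  have step (a : C) : cabs a <= rho -> cabs (a + h) <= rho ->
      cabs (G (a + h) v - G a v - h * Q a v) <= K * cabs h ^+ 2.
    move=> ar ahr.
    pose c t := G (a + t%:C%C * h) v - (G a v + t%:C%C * (h * Q a v)).
    have -> : G (a + h) v - G a v - h * Q a v = c 1 - c 0.
      by rewrite /c rmorph1 !mul1r rmorph0 !mul0r !addr0 subrr subr0; ring.
    have := @derR_lip _ c (fun t => Q (a + t%:C%C * h) v * h - h * Q a v) 0 1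
      (K * cabs h ^+ 2) ler01.
    rewrite subr0 mulr1; apply.
      move=> t /andP[t0 t1]; apply: derRB; last exact: derR_lin.
      apply: (@derR_compD _ (fun u => G u v) (fun t => a + t%:C%C * h)) (derR_lin a h t).
      apply: GD => //; apply: le_lt_trans r1.
      have -> : a + t%:C%C * h = (1 - t)%:C%C * a + t%:C%C * (a + h).
        by rewrite rmorphB/=; ring.
      apply: le_trans (cabsD _ _) _; rewrite !cabsM !cabs_real !ger0_norm ?subr_ge0//.
      have : (1 - t) * cabs a <= (1 - t) * rho by rewrite ler_wpM2l// subr_ge0.
      have : t * cabs (a + h) <= t * rho by rewrite ler_wpM2l.
      lra.
    move=> t /andP[t0 t1].
    have -> : Q (a + t%:C%C * h) v * h - h * Q a v = h * (Q (a + t%:C%C * h) v - Q a v).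
      by ring.
    have th : cabs (t%:C%C * h) <= cabs h.
      by rewrite cabsM cabs_real ger0_norm// ler_piMl ?cabs_ge0.
    have [_ E _ _] := HK a v (t%:C%C * h) ar vr (le_trans th hd).
    have -> : K * cabs h ^+ 2 = cabs h * (K * cabs h) by ring.
    rewrite (cabsM h); apply: ler_wpM2l (cabs_ge0 h) _ _ _; apply: le_trans E _.
    exact: ler_wpM2l.
  have -> : G z v - riemann n Q z v = \sum_(j < n)
      (G (j.+1%:R * h) v - G (j%:R * h) v - h * Q (j%:R * h) v).
    rewrite [RHS]sumrB; congr (_ - _); last first.
      apply: eq_bigr => j _; congr (_ * Q _ _); rewrite /h mulrCA; ring.
    have -> : z = n%:R * h by rewrite mulrC divfK// pnatr_eq0 -lt0n.
    rewrite -(big_mkord xpredT (fun j => G (j.+1%:R * h) v - G (j%:R * h) v)).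
    by rewrite telescope_sumr// mul0r [X in _ - X]subrr subr0.
  apply: le_trans (cabs_sum _ _ _) _.
  have jr j : (j <= n)%N -> cabs (j%:R * h) <= rho.
    move=> jn; rewrite cabsM hE -(rmorph_nat (real_complex R)) cabs_real ger0_norm//.
    rewrite mulrCA; apply: le_trans zr; rewrite ler_piMr ?cabs_ge0// ler_pdivrMr// mul1r.
    by rewrite ler_nat.
  apply: (@le_trans _ _ (\sum_(j < n) K * n%:R^-1 ^+ 2)).
    apply: ler_sum => j _.
    have E : j.+1%:R * h = j%:R * h + h by rewrite -addn1 natrD mulrDl mul1r.
    rewrite E; apply: le_trans (step _ _ _) _.
    - by apply: jr; exact: ltnW.
    - by rewrite -E; exact: jr.
    - by rewrite ler_wpM2l// lerXn2r ?nnegrE ?cabs_ge0 ?invr_ge0.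
  rewrite sumr_const card_ord -mulr_natl le_eqVlt; apply/orP; left; apply/eqP.
  by field; rewrite gt_eqF.
exists G; split=> //.
have [U [UU sU]] := @ultraFilterLemma nat \oo _.
have Ugt N : U [set n | (N < n)%N] by apply: sU; exists N.+1.
apply: (@ultra_bihol _ _ U (fun n => riemann n Q)).
- move=> rho r0 r1; have [B HB] := Q3 rho r0 r1.
  exists (rho * B); apply: filterS (Ugt 0%N) => n /= n0 z v zr vr.
  have z1 := le_lt_trans zr r1; have v1 := le_lt_trans vr r1.
  have jz (u : C) (j : 'I_n) : cabs (j%:R / n%:R * u) <= cabs u.
    by rewrite cabsM -[leRHS]mul1r ler_wpM2r ?cabs_ge0// ratio_le1.
  split.
  + have H (s : seq 'I_n) : exists l, hasD (fun u =>
        \sum_(j <- s) u / n%:R * Q (j%:R / n%:R * u) v) z l.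
      elim: s => [|j s [l IH]].
        by exists 0; apply: hasW_ext ltr01 _ (hasW_cst 0 z) => u _; rewrite big_nil.
      have [m Hm] := Q1 (j%:R / n%:R * z) v (le_lt_trans (jz z j) z1) v1.
      have H1 := hasDM (hasDM (hasW_id z) (hasW_cst n%:R^-1 z))
        (hasD_comp (g := fun u => j%:R / n%:R * u) Hm (hasDZ _ (hasW_id z))).
      eexists; apply: hasW_ext ltr01 _ (hasDD H1 IH) => u _.
      by rewrite big_cons.
    exact: H.
  + have H (s : seq 'I_n) : exists l, hasD (fun u =>
        \sum_(j <- s) z / n%:R * Q (j%:R / n%:R * z) u) v l.
      elim: s => [|j s [l IH]].
        by exists 0; apply: hasW_ext ltr01 _ (hasW_cst 0 v) => u _; rewrite big_nil.
      have [m Hm] := Q2 (j%:R / n%:R * z) v (le_lt_trans (jz z j) z1) v1.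
      eexists; apply: hasW_ext ltr01 _ (hasDD (hasDZ (z / n%:R) Hm) IH) => u _.
      by rewrite big_cons.
    exact: H.
  + apply: le_trans (@riemann_le n Q z v B n0 _) _.
      by move=> u uz; apply: HB => //; exact: le_trans zr.
    rewrite ler_wpM2r//.
    by apply: le_trans (cabs_ge0 (Q z v)) (HB _ _ _ _).
- move=> z v z1 v1 e e0.
  pose m := Num.max (cabs z) (cabs v).
  have zm : cabs z <= m by rewrite le_max lexx.
  have vm : cabs v <= m by rewrite le_max lexx orbT.
  have m1 : m < 1 by rewrite gt_max z1.
  have z0 := cabs_ge0 z.
  have [K [N HK]] := GR ((1 + m) / 2) ltac:(lra) ltac:(lra).
  apply: filterS2 (Ugt N) (Ugt (Num.truncn (K / e))) => n /= nN nK.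
  have n0 : 0 < n%:R :> R by rewrite ltr0n (leq_ltn_trans _ nN).
  rewrite cabsBC; apply: le_lt_trans (HK n z v nN _ _) _; try lra.
  rewrite ltr_pdivrMr// mulrC -ltr_pdivrMr//.
  by apply: lt_le_trans (Num.Theory.truncnS_gt _) _; rewrite ler_nat.
Qed.

End Sesquiholomorphic.

(** * Powers of a kernel and the Laplacian of its logarithm *)

Section Powers.
Variable R : realType.
Local Notation C := R[i].
Implicit Types (P Q : C -> C -> C) (z v w h k : C) (rho : R).

Lemma riemannB n P Q z v :
  riemann n P z v - riemann n Q z v = riemann n (fun z v => P z v - Q z v) z v.
Proof. by rewrite /riemann -sumrB; apply: eq_bigr => j _; rewrite mulrBr. Qed.

(** Integrating from 0 in both variables yields the limit of double sums of
    values of [Q] at the points (j z / n, k conj w / n) with weights (z / n)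
    conj (w / n). These are positive definite by [pd_comb]. *)
Lemma double_primitive Q : bihol Q -> pdT (disc R) (fun z w => Q z w^*) ->
  exists Psi, [/\ bihol Psi, pdT (disc R) (fun z w => Psi z w^*) &
    forall z v, cabs z < 1 -> cabs v < 1 -> D1 (D2 Psi) z v = Q z v].
Proof.
move=> nQ pQ.
have [G1 [nG1 dG1 rG1]] := bihol_primitive nQ.
have [G2 [nG2 dG2 rG2]] := bihol_primitive (bihol_swap nG1).
pose Psi := swapK G2; exists Psi; split.
- exact: bihol_swap.
- apply: (@pd_lim _ _ _ _ \oo (fun n z w => \sum_(j < n) \sum_(k < n)
    z / n%:R * (w / n%:R)^* * Q (j%:R / n%:R * z) (k%:R / n%:R * w)^*)).
    apply: filterS filterT => n _ /=.
    apply: (@pd_comb R C (disc R) C (disc R) (fun z w => Q z w^*) 'I_n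
      (fun j z => j%:R / n%:R * z) (fun j z => z / n%:R)) pQ.
    move=> j z /discE z1; apply/discE; rewrite cabsM; apply: le_lt_trans z1.
    by rewrite -[leRHS]mul1r ler_wpM2r ?cabs_ge0// ratio_le1.
  move=> z w /discE z1 /discE w1 e e0.
  pose v := w^*; have v1 : cabs v < 1 by rewrite cabs_conj.
  pose m := Num.max (cabs z) (cabs v).
  have zm : cabs z <= m by rewrite le_max lexx.
  have vm : cabs v <= m by rewrite le_max lexx orbT.
  have m1 : m < 1 by rewrite gt_max z1.
  have z0 := cabs_ge0 z; have v0 := cabs_ge0 v.
  have rr0 : 0 < (1 + m) / 2 by lra.
  have rr1 : (1 + m) / 2 < 1 by lra.
  have zr : cabs z <= (1 + m) / 2 by lra.
  have vr : cabs v <= (1 + m) / 2 by lra.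
  have [K1 [N1 H1]] := rG1 _ rr0 rr1; have [K2 [N2 H2]] := rG2 _ rr0 rr1.
  pose K := `|K1| + `|K2| + 1.
  have K0 : 0 < K by rewrite /K ltr_wpDl// addr_ge0.
  exists (maxn (maxn N1 N2) (Num.truncn (K / e))).+1 => // n /=.
  rewrite !gtn_max => /andP[/andP[n1 n2] n3].
  have n0 : (0 < n)%N by exact: leq_ltn_trans n1.
  have nR : 0 < n%:R :> R by rewrite ltr0n.
  have -> : \sum_(j < n) \sum_(k < n) z / n%:R * (w / n%:R)^* *
      Q (j%:R / n%:R * z) (k%:R / n%:R * w)^* =
      riemann n (swapK (riemann n Q)) v z.
    rewrite /riemann exchange_big/=; apply: eq_bigr => k _.
    rewrite /swapK mulr_sumr; apply: eq_bigr => j _.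
    rewrite !rmorphM/= !fmorphV/= !rmorph_nat -/v; ring.
  have E1 := H2 n v z n2 vr zr.
  have E2 : cabs (riemann n (swapK G1) v z - riemann n (swapK (riemann n Q)) v z)
      <= cabs v * (K1 / n%:R).
    rewrite riemannB; apply: riemann_le n0 _ => u uv; rewrite /swapK.
    by apply: H1 => //; exact: le_trans vr.
  have K1n : cabs v * (K1 / n%:R) <= `|K1| / n%:R.
    have a1 : K1 / n%:R <= `|K1| / n%:R by rewrite ler_pM2r ?invr_gt0// ler_norm.
    have a2 : 0 <= `|K1| / n%:R by rewrite divr_ge0// ltW.
    have a3 : cabs v * (`|K1| / n%:R) <= `|K1| / n%:R by rewrite ler_piMl// ltW.
    exact: le_trans (ler_wpM2l v0 a1) a3.
  have K2n : K2 / n%:R <= `|K2| / n%:R by rewrite ler_pM2r ?invr_gt0// ler_norm.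
  have Kn : K / n%:R < e.
    rewrite ltr_pdivrMr// mulrC -ltr_pdivrMr//.
    by apply: lt_le_trans (Num.Theory.truncnS_gt _) _; rewrite ler_nat.
  have KE : K / n%:R = `|K1| / n%:R + `|K2| / n%:R + 1 / n%:R by rewrite /K; ring.
  have n_1 : 0 < 1 / n%:R :> R by rewrite divr_gt0.
  rewrite cabsBC /Psi {1}/swapK.
  have := cabsD (G2 v z - riemann n (swapK G1) v z)
    (riemann n (swapK G1) v z - riemann n (swapK (riemann n Q)) v z).
  rewrite addrA subrK; lra.
- move=> z v z1 v1.
  have D2E u : cabs u < 1 -> D2 Psi u v = G1 u v.
    by move=> u1; apply: cderiv_eq; exact: (dG2 v u v1 u1).
  apply: cderiv_eq; apply: (hasW_ext (d := 1 - cabs z) _ _ (dG1 z v z1 v1)).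
    by rewrite subr_gt0.
  by move=> u uz; rewrite D2E//; have := cabs_le_dist u z; lra.
Qed.

(** Through continuity this bounds [ddlog P] on compact discs. *)
Lemma hasW_ddlog P w : bihol P -> (forall w, cabs w < 1 -> 0 < P w w^*) ->
  cabs w < 1 -> exists p q, hasW (ddlog P) w p q.
Proof.
move=> nP P0 w1.
have HP := hasW_diag nP w1; have H1 := hasW_diag (bihol_D1 nP) w1.
have H2 := hasW_diag (bihol_D2 nP) w1.
have H12 := hasW_diag (bihol_D1 (bihol_D2 nP)) w1.
have Pn : P w w^* != 0 by rewrite gt_eqF ?P0.
have HV := hasW_invr (g := fun w => P w w^*) Pn HP.
have := hasWB (hasWM H12 HV) (hasWM (hasWM H2 H1) (hasWM HV HV)).
move=> H; do 2 eexists; apply: hasW_ext ltr01 _ H => u _.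
by rewrite /ddlog expr2 invfM.
Qed.

Lemma polarization_bihol_pd P G : bihol P -> pdT (disc R) (fun z w => P z w^*) ->
    (forall w, cabs w < 1 -> P w w^* = G w) ->
  is_polarization (disc R) G (fun z w => P z w^*) /\
  positive_definite_kernel (disc R) (fun z w => P z w^*).
Proof.
move=> nP pP PG; have S := bihol_sesqui nP; split; split=> //.
by move=> w /discE; exact: PG.
Qed.

Lemma psd_diag_real Q w : pdT (disc R) (fun z w => Q z w^*) -> cabs w < 1 ->
  (Q w w^*)^* = Q w w^*.
Proof.
move=> pQ /discE w1; have := pd_ge0 pQ w1 => /ger0_Im; case: (Q w w^*) => a b /= ->.
exact: conj_realC.
Qed.

(** Let Psi be the double primitive of the kernel [N] polarizing [ddlog P]. On
    the diagonal, u = log P - Psi satisfies d dbar u = 0, so conj (dbar u) is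
    holomorphic; if F is a primitive of it, then u - F - conj F has zero
    derivatives and is a real constant c. Hence P^t = E conj E exp (t Psi) on
    the diagonal, with E = exp (t (F + c / 2)), and the right-hand side
    polarizes to a product of a kernel of rank one and the exponential of a
    positive definite kernel. *)
Lemma pd_powers P : bihol P -> (forall w, cabs w < 1 -> 0 < P w w^*) ->
    positive_definite_function (disc R) (ddlog P) ->
  forall t : R, 0 < t -> exists Lt,
    is_polarization (disc R) (fun w => real_complex R (complex.Re (P w w^*) `^ t)) Lt
    /\ positive_definite_kernel (disc R) Lt.
Proof.
move=> nP P0 [N [[sN NE] [_ pN]]].
pose Q := conj2 N.
have QE w : cabs w < 1 -> Q w w^* = ddlog P w.
  by move=> /discE w1; rewrite /Q conj2E NE.
have nQ : bihol Q.
  apply: bihol_of_pd => // rho r0 r1.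
  have [B HB] := hasW_bounded (fun w hw => @hasW_ddlog P w nP P0 hw) r0 r1.
  exists B => w wr; rewrite NE; first exact: HB.
  by apply/discE; exact: le_lt_trans r1.
have pQ : pdT (disc R) (fun z w => Q z w^*).
  by apply: pd_ext pN => z w _ _; rewrite /Q conj2E.
have [Psi [nPsi pPsi dPsi]] := double_primitive nQ pQ.
pose g w := P w w^*; pose psi w := Psi w w^*.
have L2 := logW_bihol nP P0.
pose u w := log_of g w - psi w.
pose q w := dlog P w - D2 Psi w w^*.
have u_real w : cabs w < 1 -> (u w)^* = u w.
  by move=> w1; rewrite /u rmorphB/= conj_realC (psd_diag_real pPsi w1).
have uW w : cabs w < 1 -> hasW u w (q w)^* (q w).
  move=> w1; have [[p Hp] _] := L2 w w1.
  have H := hasWB Hp (hasW_diag nPsi w1).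
  apply: hasW_eq (H) _ (erefl _).
  apply: (hasW_real (d := 1 - cabs w) _ _ H); first by rewrite subr_gt0.
  by move=> z zw; apply: u_real; have := cabs_le_dist z w; lra.
(* d dbar u = 0, that is, conj q is holomorphic. *)
have qW w : cabs w < 1 -> exists s, hasW q w 0 s.
  move=> w1; have [_ [s Hs]] := L2 w w1.
  have := hasWB Hs (hasW_diag (bihol_D2 nPsi) w1).
  by rewrite dPsi ?cabs_conj// QE// subrr => H; eexists; exact: H.
have [F HF] := @primitive_disc R (fun w => (q w)^*) (fun w hw =>
  let: ex_intro s Hs := qW w hw in ex_intro _ s^* (hasW_eq (hasW_conjr Hs) (erefl _) (rmorph0 _))).
pose e w := u w - (F w + (F w)^*).
have e_cst w : cabs w < 1 -> e w = e 0.
  move=> w1; apply: (@hasD_cst_ball _ e 1) => //; first by rewrite cabs0.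
  move=> z z1; have H := hasWB (uW z z1) (hasWD (HF z z1) (hasW_conjr (HF z z1))).
  apply: hasW_eq H _ _; first by rewrite rmorph0 addr0 subrr.
  by rewrite conjCK add0r subrr.
have z1 : cabs (0 : C) < 1 by rewrite cabs0.
pose c := e 0.
have cr : c^* = c.
  have -> : c = u 0 - (F 0 + (F 0)^*) by [].
  move: (u 0) (u_real 0 z1) (F 0) => a ar b.
  by rewrite rmorphB rmorphD/= conjCK ar [b^* + b]addrC.
have logE w : cabs w < 1 -> log_of g w = (F w + c / 2) + (F w + c / 2)^* + psi w.
  move=> w1; have := e_cst w w1; rewrite -/c /e /u => H.
  rewrite rmorphD rmorphM fmorphV rmorph_nat/= cr.
  have -> : log_of g w = (log_of g w - psi w - (F w + (F w)^*)) + psi w + (F w + (F w)^*).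
    by ring.
  by rewrite H; field.
move=> t t0.
pose E z := cexp (t%:C%C * (F z + c / 2)).
pose Lt z w := E z * (E w)^* * cexp (t%:C%C * Psi z w^*).
exists Lt; have pLt : pdT (disc R) Lt.
  apply: pdM; first exact: pd_rank1.
  by apply: pd_cexp; apply: pdZ => //; rewrite lecR ltW.
have ED z : cabs z < 1 -> exists l, hasD E z l.
  move=> hz; have H := hasDZ t%:C%C (hasDD (HF z hz) (hasW_cst (c / 2) z)).
  exact: ex_intro _ _ (hasD_comp (g := fun z => t%:C%C * (F z + c / 2)) (cexp_hasD _) H).
have sLt : sesquiholomorphic (disc R) Lt.
  have [P1 P2 _] := nPsi; apply/sesqui_conj2; split=> z v hz hv.
  - have [l Hl] := ED z hz; have [m Hm] := P1 z v hz hv.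
    have Hc := hasD_comp (g := fun u => t%:C%C * Psi u v) (cexp_hasD _) (hasDZ t%:C%C Hm).
    have H := hasDM (hasDM Hl (hasW_cst (E v^*)^* z)) Hc.
    by eexists; apply: hasW_ext ltr01 _ H => x _; rewrite /conj2 /Lt conjCK.
  - have [l Hl] := ED v^* ltac:(by rewrite cabs_conj); have [m Hm] := P2 z v hz hv.
    have Hc := hasD_comp (g := fun u => t%:C%C * Psi z u) (cexp_hasD _) (hasDZ t%:C%C Hm).
    have H := hasDM (hasDM (hasW_cst (E z) v) (hasD_conjconj Hl)) Hc.
    by eexists; apply: hasW_ext ltr01 _ H => x _; rewrite /conj2 /Lt conjCK.
split; split=> // w /discE w1.
rewrite /Lt /E conj_cexp -!cexpD rmorphM/= conj_realC -!mulrDr -logE//.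
rewrite /log_of -rmorphM/= cexp_real /powR.
have [_ /gt_eqF->] := pos_real (P0 w w1).
by [].
Qed.

(** A bound of the powers that is uniform in the exponent [t], for its limit
    at 0. *)
Lemma powR_le1D (x t : R) : 0 < x -> 0 < t -> t < 1 -> x `^ t <= 1 + x.
Proof.
move=> x0 t0 t1; have [x1|x1] := leP x 1.
  apply: (@le_trans _ _ 1); last lra.
  rewrite -(powRr0 x) /powR gt_eqF// ler_expR mul0r.
  exact: mulr_ge0_le0 (ltW t0) (ln_le0 x1).
have : x `^ t <= x `^ 1 by rewrite ler_powR ?ltW.
by rewrite (powRr1 (ltW x0)); lra.
Qed.

(** Let N_t be 1 / t times the mixed derivative of the polarization of P^t. It
    is positive definite, as a limit of second differences, and on the
    diagonal it equals P^t (ddlog P + t |dlog P|^2), which is bounded on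
    compact discs uniformly in t < 1 and tends to ddlog P as t tends to 0. By
    [pd_bound] the N_t are bounded on compact sets uniformly in t, so they
    have a limit along an ultrafilter at 0, which is holomorphic in each
    variable and positive definite. *)
Lemma pd_ddlog P : bihol P -> (forall w, cabs w < 1 -> 0 < P w w^*) ->
    (forall t : R, 0 < t -> exists Lt,
      is_polarization (disc R) (fun w => real_complex R (complex.Re (P w w^*) `^ t)) Lt
      /\ positive_definite_kernel (disc R) Lt) ->
  positive_definite_function (disc R) (ddlog P).
Proof.
move=> nP P0 HL.
have /choice[Lt HLt] : forall t : R, exists Lt : C -> C -> C, 0 < t ->
    is_polarization (disc R) (fun w => real_complex R (complex.Re (P w w^*) `^ t)) Lt
      /\ positive_definite_kernel (disc R) Lt.
  move=> t; have [t0|t0] := pselect (0 < t); last by exists (fun _ _ => 0).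
  by have [Lt H] := HL t t0; exists Lt.
pose g w := P w w^*.
pose lg w := ln (complex.Re (g w)).
pose G (t : R) w : C := (expR (t * lg w))%:C%C.
pose Pt t := conj2 (Lt t).
have PtE t w : 0 < t -> cabs w < 1 -> Pt t w w^* = G t w.
  move=> t0 w1; rewrite /Pt conj2E (HLt t t0).1.2; last exact/discE.
  rewrite /powR /G; have [_ /gt_eqF->] := pos_real (P0 w w1).
  by [].
have GpowE t w : cabs w < 1 -> cabs (G t w) = complex.Re (g w) `^ t.
  move=> w1; rewrite /G cabs_real gtr0_norm ?expR_gt0// /powR.
  by have [_ /gt_eqF->] := pos_real (P0 w w1).
have G_le t w : 0 < t -> t < 1 -> cabs w < 1 -> cabs (G t w) <= 1 + cabs (g w).
  move=> t0 t1 w1; rewrite GpowE//; have [_ gp] := pos_real (P0 w w1).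
  apply: le_trans (powR_le1D gp t0 t1) _; rewrite lerD2l.
  by apply: le_trans (ler_norm _) (cabs_Re _).
have L2 := logW_bihol nP P0.
have GW t w : cabs w < 1 ->
    hasW (G t) w (t%:C%C * G t w * (dlog P w)^*) (t%:C%C * G t w * dlog P w).
  move=> w1; have [[p Hp] _] := L2 w w1.
  have pE : p = (dlog P w)^*.
    by apply: hasW_real ltr01 _ Hp => z _; rewrite conj_realC.
  have Ht := hasWZ t%:C%C Hp.
  have TE z : complex.Re (t%:C%C * log_of g z) = t * lg z.
    by rewrite /log_of -rmorphM.
  have cE (x : C) : (t%:C%C * x)^* = t%:C%C * x^* by rewrite rmorphM/= conj_realC.
  have He := @hasW_Re R expR (t%:C%C * log_of g w) _ (is_derive_expR _).
  have H := hasW_comp (g := fun w => t%:C%C * log_of g w) He Ht.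
  apply: hasW_eq (hasW_ext (g2 := G t) ltr01 (fun u _ => _) H) _ _.
  - by move=> u _; rewrite [LHS]/comp TE.
  - by rewrite TE pE cE -/(G t w); field.
  - by rewrite TE pE cE conjCK -/(G t w); field.
have [U UU U0] := ultra_at0 R.
have nPt t : 0 < t -> t < 1 -> bihol (Pt t).
  move=> t0 t1; apply: bihol_of_pd; first exact: (HLt t t0).2.
  move=> rho r0 r1; have [B HB] := hasW_bounded (g := g)
    (fun w hw => ex_intro _ _ (ex_intro _ _ (hasW_diag nP hw))) r0 r1.
  exists (1 + B) => w wr; have w1 := le_lt_trans wr r1.
  rewrite -conj2E -/(Pt t) PtE//; apply: le_trans (G_le t w t0 t1 w1) _.
  by rewrite lerD2l HB.
pose Nt t z v := t%:C%C^-1 * D1 (D2 (Pt t)) z v.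
(* The value of 1 / t times d dbar of exp (t lg). *)
pose dg t w := G t w * (ddlog P w + t%:C%C * ((dlog P w)^* * dlog P w)).
have NtE t w : 0 < t -> t < 1 -> cabs w < 1 -> Nt t w w^* = dg t w.
  move=> t0 t1 w1.
  have tn0 : t%:C%C != 0 :> C by rewrite -cabs_gt0 cabs_real gtr0_norm.
  have E2 z : cabs z < 1 -> D2 (Pt t) z z^* = t%:C%C * G t z * dlog P z.
    move=> hz; have H := hasW_diag (nPt t t0 t1) hz.
    suff /(hasW_uniq (GW t z hz))[_ ->] : hasW (G t) z (D1 (Pt t) z z^*) (D2 (Pt t) z z^*) by [].
    apply: (hasW_ext (d := 1 - cabs z) _ _ H); first by rewrite subr_gt0.
    by move=> x xz; rewrite PtE//; have := cabs_le_dist x z; lra.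
  have [_ [s Hs]] := L2 w w1.
  have H1 := hasW_diag (bihol_D2 (nPt t t0 t1)) w1.
  have {}H1 : hasW (fun z => t%:C%C * G t z * dlog P z) w
    (D1 (D2 (Pt t)) w w^*) (D2 (D2 (Pt t)) w w^*).
    apply: (hasW_ext (d := 1 - cabs w) _ _ H1); first by rewrite subr_gt0.
    by move=> x xz; rewrite E2//; have := cabs_le_dist x w; lra.
  have H2 := hasWM (hasWZ t%:C%C (GW t w w1)) Hs.
  have [E3 _] := hasW_uniq H2 H1.
  by rewrite /Nt -E3 /dg; field.
have Nt_bihol t : 0 < t -> t < 1 -> bihol (Nt t).
  move=> t0 t1; have [N1 N2 N3] := bihol_D1 (bihol_D2 (nPt t t0 t1)); split.
  - by move=> z v hz hv; have [l Hl] := N1 z v hz hv; exact: ex_intro _ _ (hasDZ _ Hl).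
  - by move=> z v hz hv; have [l Hl] := N2 z v hz hv; exact: ex_intro _ _ (hasDZ _ Hl).
  - move=> rho r0 r1; have [B HB] := N3 rho r0 r1; exists (cabs (t%:C%C^-1) * B) => z v zr vr.
    by rewrite cabsM ler_wpM2l ?cabs_ge0// HB.
have Nt_pd t : 0 < t -> t < 1 -> pdT (disc R) (fun z w => Nt t z w^*).
  move=> t0 t1; apply: pdZ.
    have -> : t%:C%C^-1 = (t^-1)%:C%C :> C by rewrite fmorphV.
    by rewrite lecR invr_ge0 ltW.
  (* Translation by s, replaced by the identity where it would leave the disc. *)
  pose phi (s : R) z := if `[< disc R (z + s%:C%C) >] then z + s%:C%C else z.
  apply: (@pd_lim _ _ _ _ U (fun s z w => (s%:C%C ^+ 2)^-1 *
    \sum_(b : bool) \sum_(c : bool) (if b then 1 else -1) * (if c then 1 else -1)^* *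
      Lt t (if b then phi s z else z) (if c then phi s w else w))).
    apply: filterS (U0 1 ltr01) => s /= /andP[s0 s1]; apply: pdZ.
      by rewrite -rmorphXn -fmorphV lecR invr_ge0 exprn_ge0 ?ltW.
    apply: (@pd_comb R C (disc R) C (disc R) (Lt t) _
      (fun (b : bool) z => if b then phi s z else z) (fun (b : bool) _ => if b then 1 else -1)).
      by move=> [] z // hz; rewrite /phi; case: asboolP.
    exact: (HLt t t0).2.2.
  move=> z w /discE hz /discE hw.
  have := limF_second_diff (U := U) _ U0 (nPt t t0 t1) hz (v := w^*) ltac:(by rewrite cabs_conj).
  move=> /(_ (@ultra_proper _ _ UU)); apply: limF_ext.
  have dd : 0 < Num.min (1 - cabs z) (1 - cabs w) by rewrite lt_min !subr_gt0 hz.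
  apply: filterS (U0 _ dd) => s /= /andP[s0]; rewrite lt_min => /andP[sz sw].
  have sE : cabs (s%:C%C : C) = s by rewrite cabs_real gtr0_norm.
  have E x : s < 1 - cabs x -> phi s x = x + s%:C%C.
    move=> sx; rewrite /phi asboolT//; apply/discE.
    by have := cabsD x s%:C%C; rewrite sE; lra.
  rewrite !big_bool /= !E// rmorphN conjC1 /Pt /conj2 !rmorphD/= !conjCK !conj_realC.
  congr (_ * _); ring.
have Nt_bound rho : 0 < rho -> rho < 1 -> exists B : R, forall t z v, 0 < t -> t < 1 ->
    cabs z <= rho -> cabs v <= rho -> cabs (Nt t z v) <= B.
  move=> r0 r1; have [B1 HB1] := hasW_bounded (g := g)
    (fun w hw => ex_intro _ _ (ex_intro _ _ (hasW_diag nP hw))) r0 r1.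
  have [B2 HB2] := hasW_bounded (g := dlog P)
    (fun w hw => let: conj _ (ex_intro s Hs) := L2 w hw in
       ex_intro _ _ (ex_intro _ s Hs)) r0 r1.
  have [B3 HB3] := hasW_bounded (fun w hw => @hasW_ddlog P w nP P0 hw) r0 r1.
  have diag t w : 0 < t -> t < 1 -> cabs w <= rho ->
      cabs (Nt t w w^*) <= (1 + B1) * (B3 + B2 * B2).
    move=> t0 t1 wr; have w1 := le_lt_trans wr r1.
    rewrite NtE// cabsM; apply: ler_pM; rewrite ?cabs_ge0//.
      by apply: le_trans (G_le t w t0 t1 w1) _; rewrite lerD2l HB1.
    apply: le_trans (cabsD _ _) _; apply: lerD; first exact: HB3.
    rewrite cabsM (cabsM (dlog P w)^*) cabs_conj cabs_real gtr0_norm//.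
    have := HB2 w wr; have := cabs_ge0 (dlog P w); set x := cabs _ => x0 xB.
    have : x * x <= B2 * B2 by apply: ler_pM.
    have : 0 <= x * x by rewrite mulr_ge0.
    nra.
  exists ((1 + B1) * (B3 + B2 * B2)) => t z v t0 t1 zr vr.
  have := @pd_bound _ _ (disc R) (fun z w => Nt t z w^*) z v^* (Nt_pd t t0 t1).
  move=> /(_ ltac:(by apply/discE; lra) ltac:(by apply/discE; rewrite cabs_conj; lra)).
  rewrite conjCK; have := diag t z t0 t1 zr.
  have := diag t v^* t0 t1 ltac:(by rewrite cabs_conj); rewrite conjCK; lra.
pose N z v : C := xget 0 [set l | limF U (fun t => Nt t z v) l].
have NL z v : cabs z < 1 -> cabs v < 1 -> limF U (fun t => Nt t z v) (N z v).
  move=> hz hv; pose m := Num.max (cabs z) (cabs v).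
  have zm : cabs z <= m by rewrite le_max lexx.
  have vm : cabs v <= m by rewrite le_max lexx orbT.
  have m1 : m < 1 by rewrite gt_max hz.
  have z0 := cabs_ge0 z.
  have [B HB] := Nt_bound ((1 + m) / 2) ltac:(lra) ltac:(lra).
  have [l Hl] : exists l, limF U (fun t => Nt t z v) l.
    apply: (@ultra_bounded _ _ _ _ B) => //.
    by apply: filterS (U0 1 ltr01) => t /= /andP[t0 t1]; apply: HB => //; lra.
  by rewrite /N; case: xgetP => [l' _ //|/(_ l)].
have nN : bihol N.
  apply: (@ultra_bihol _ _ U Nt) => // rho r0 r1.
  have [B HB] := Nt_bound rho r0 r1; exists B.
  apply: filterS (U0 1 ltr01) => t /= /andP[t0 t1] z v zr vr.
  have [N1 N2 _] := Nt_bihol t t0 t1.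
  have hz := le_lt_trans zr r1; have hv := le_lt_trans vr r1.
  by split; [exact: N1|exact: N2|exact: HB].
have pN : pdT (disc R) (fun z w => N z w^*).
  apply: (@pd_lim _ _ _ _ U (fun t z w => Nt t z w^*)).
    by apply: filterS (U0 1 ltr01) => t /= /andP[t0 t1]; exact: Nt_pd.
  by move=> z w /discE hz /discE hw; apply: NL => //; rewrite cabs_conj.
exists (fun z w => N z w^*); apply: polarization_bihol_pd => // w w1.
apply: (@limF_uniq _ _ U _ (fun t => Nt t w w^*)); first by apply: NL => //; rewrite cabs_conj.
pose c (t : R) := cexp (0 + t%:C%C * (lg w)%:C%C) *
  (ddlog P w + t%:C%C * ((dlog P w)^* * dlog P w)).
have c0 : c 0 = ddlog P w by rewrite /c !mul0r !addr0 cexp0 mul1r.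
have Hc := derRM (derR_compD (cexp_hasD _) (derR_lin 0 (lg w)%:C%C 0))
  (derR_lin (ddlog P w) ((dlog P w)^* * dlog P w) 0).
move=> e e0; have [d d0 Hd] := rcont_derR Hc e0.
have dd : 0 < Num.min d 1 by rewrite lt_min d0 ltr01.
apply: filterS (U0 _ dd) => t /= /andP[t0]; rewrite lt_min => /andP[td t1].
have := Hd t; rewrite subr0 gtr0_norm// => /(_ td).
rewrite -/(c t) -/(c 0) c0 NtE// /c /dg /G add0r -rmorphM/= cexp_real.
by [].
Qed.

End Powers.

(** * The open mapping theorem *)

Section OpenMapping.
Variables (R : realType) (H : completeNormedModType R[i]).
Local Notation C := R[i].
Implicit Types (x y : H) (e d c : R).

(** As for [cabs], estimates need the norm as a number of [R]. *)
Definition nr x : R := complex.Re `|x|.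

Lemma nrE x : `|x| = (nr x)%:C%C.
Proof.
have := ger0_Im (normr_ge0 x); rewrite /nr.
by case: `|x| => a b /= ->.
Qed.

Lemma nr_ge0 x : 0 <= nr x.
Proof. by rewrite -lecR -nrE normr_ge0. Qed.

Lemma nr0 : nr 0 = 0.
Proof. by rewrite /nr normr0. Qed.

Lemma nr_eq0 x : (nr x == 0) = (x == 0).
Proof.
by apply/eqP/eqP => [h|->]; [apply/eqP; rewrite -normr_eq0 nrE h|exact: nr0].
Qed.

Lemma nrZ (a : C) x : nr (a *: x) = cabs a * nr x.
Proof. by apply: (@complexI R); rewrite rmorphM/= -!nrE -cabsE normrZ. Qed.

Lemma nrN x : nr (- x) = nr x.
Proof. by rewrite /nr normrN. Qed.

Lemma nrBC x y : nr (x - y) = nr (y - x).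
Proof. by rewrite -nrN opprB. Qed.

Lemma nrD x y : nr (x + y) <= nr x + nr y.
Proof. by have := ler_normD x y; rewrite !nrE -rmorphD lecR. Qed.

Lemma nr_tri x y z : nr (x - z) <= nr (x - y) + nr (y - z).
Proof. by have := nrD (x - y) (y - z); rewrite addrA subrK. Qed.

Lemma nr_small x : (forall e, 0 < e -> nr x <= e) -> x = 0.
Proof.
move=> h; apply/eqP; rewrite -nr_eq0 eq_le nr_ge0 andbT.
by apply/ler_addgt0Pr => e e0; rewrite add0r h.
Qed.

Lemma half_pow (b : R) n : b / 2 ^+ n = b / 2 ^+ n.+1 + b / 2 ^+ n.+1.
Proof. by rewrite exprS; field; rewrite expf_neq0. Qed.

Lemma pow2_small (c e : R) : 0 < e -> exists N, forall n, (N <= n)%N -> c / 2 ^+ n < e.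
Proof.
move=> e0; have [N HN] := exp2_gt (c / e); exists N => n Nn.
rewrite ltr_pdivrMr ?exprn_gt0// mulrC -ltr_pdivrMr//.
by apply: lt_le_trans HN _; rewrite ler_weXn2l// ler1n.
Qed.

Lemma geometric_lim (u : nat -> H) (c : R) :
    (forall n, nr (u n.+1 - u n) <= c / 2 ^+ n) ->
  exists l, forall n, nr (l - u n) <= 2 * c / 2 ^+ n.
Proof.
move=> Hu.
have c0 : 0 <= c by have := Hu 0%N; rewrite expr0 divr1; apply: le_trans; exact: nr_ge0.
have step n k : nr (u (n + k)%N - u n) <= 2 * c / 2 ^+ n - 2 * c / 2 ^+ (n + k).
  elim: k => [|k IH]; first by rewrite addn0 !subrr nr0.
  rewrite addnS; have := nr_tri (u (n + k).+1) (u (n + k)%N) (u n).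
  have := Hu (n + k)%N; have := half_pow (2 * c) (n + k).
  have -> : 2 * c / 2 ^+ (n + k).+1 = c / 2 ^+ (n + k).
    by rewrite exprS; field; rewrite expf_neq0.
  lra.
have tail n m : (n <= m)%N -> nr (u m - u n) <= 2 * c / 2 ^+ n.
  move=> nm; have := step n (m - n)%N; rewrite subnKC//.
  have : 0 <= 2 * c / 2 ^+ m by rewrite divr_ge0 ?exprn_ge0// mulr_ge0.
  lra.
have cvu : cvg (u @ \oo).
  apply: cauchy_cvg; apply: cauchy_exP => e' /gt0_real_complex[e e0 ->].
  have [N HN] := pow2_small (2 * c) e0.
  exists (u N); exists N => // n /= Nn; rewrite -ball_normE/=.
  rewrite nrE ltcR nrBC; apply: le_lt_trans (tail N n Nn) _.
  exact: HN.
have /cvg_ex[l Hl] := cvu; exists l => n.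
apply/ler_addgt0Pr => e e0.
have /cvgrPdist_lt/(_ e%:C%C) := Hl; rewrite ltcR => /(_ e0)[N _ HN].
have := HN (maxn N n) (leq_maxl _ _); rewrite /= nrE ltcR => h.
have := nr_tri l (u (maxn N n)) (u n); have := tail n (maxn N n) (leq_maxr _ _).
lra.
Qed.

Variables (S : H -> H) (b : R).
Hypothesis linS : forall (a : C) x y, S (a *: x + y) = a *: S x + S y.
Hypothesis bS : forall x, nr (S x) <= b * nr x.
Hypothesis surjS : forall y, exists x, S x = y.

Let S0 : S 0 = 0.
Proof.
have := linS 1 0 0; rewrite !scale1r addr0 => h.
by apply: (@addrI _ (S 0)); rewrite addr0 -h.
Qed.

Let SB x y : S (x - y) = S x - S y.
Proof. by rewrite addrC -scaleN1r linS scaleN1r addrC. Qed.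

Let SZ (a : C) x : S (a *: x) = a *: S x.
Proof. by have := linS a x 0; rewrite !addr0 S0 addr0. Qed.

(** Baire's argument. Otherwise there are nested balls of radii at most 2^-n
    such that [S] maps no [x] with [nr x <= n] into the (n + 1)-st one, and
    their common point has no preimage. *)
Lemma baire_image : exists (N : nat) (y0 : H) (r : R), 0 < r /\
  forall y e, 0 < e -> nr (y - y0) + e <= r -> e <= r / 2 ->
    exists x, nr x <= N%:R /\ nr (S x - y) <= e.
Proof.
apply: contrapT => no.
have step (ns : nat * (H * R)) : exists s' : H * R, 0 < ns.2.2 ->
    [/\ 0 < s'.2, nr (s'.1 - ns.2.1) + s'.2 <= ns.2.2, s'.2 <= ns.2.2 / 2 &
     forall x, nr x <= ns.1%:R -> s'.2 < nr (S x - s'.1)].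
  case: ns => N [y0 r] /=; have [r0|nr0] := pselect (0 < r); last by exists (y0, r).
  apply: contrapT => no'; apply: no; exists N, y0, r; split=> // y e e0 h1 h2.
  apply: contrapT => no2; apply: no'; exists (y, e) => _; split=> //= x xN.
  by rewrite ltNge; apply/negP => h; apply: no2; exists x.
have [nxt Hnxt] := choice step.
pose fix s n : H * R := if n is m.+1 then nxt (m, s m) else (0, 1).
have sp n : 0 < (s n).2.
  elim: n => [|n IH]; first exact: ltr01.
  by case: (Hnxt (n, s n) IH).
have Hs n : [/\ nr ((s n.+1).1 - (s n).1) + (s n.+1).2 <= (s n).2,
    (s n.+1).2 <= (s n).2 / 2 &
    forall x, nr x <= n%:R -> (s n.+1).2 < nr (S x - (s n.+1).1)].
  by case: (Hnxt (n, s n) (sp n)).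
have rn n : (s n).2 <= 1 / 2 ^+ n.
  elim: n => [|n IH]; first by rewrite expr0 divr1.
  have [_ h _] := Hs n; apply: le_trans h _; have := half_pow 1 n.
  lra.
have [y Hy] := @geometric_lim (fun n => (s n).1) 1
  ltac:(by move=> n; have [h _ _] := Hs n; have := rn n; have := sp n.+1; lra).
have nest n k : nr ((s (n + k)%N).1 - (s n).1) <= (s n).2 - (s (n + k)%N).2.
  elim: k => [|k IH]; first by rewrite addn0 !subrr nr0.
  rewrite addnS; have [h _ _] := Hs (n + k)%N.
  have := nr_tri (s (n + k).+1).1 (s (n + k)%N).1 (s n).1; lra.
have yin n : nr (y - (s n).1) <= (s n).2.
  apply/ler_addgt0Pr => e e0; have [N HN] := pow2_small (2 * 1) e0.
  have := nr_tri y (s (n + N)%N).1 (s n).1; have := nest n N; have := sp (n + N)%N.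
  have := Hy (n + N)%N; have := HN (n + N)%N (leq_addl _ _); lra.
have [x Sx] := surjS y.
have [_ _ /(_ x)] := Hs (Num.truncn (nr x)).+1.
rewrite Sx ltNge yin => /(_ _)/negP; apply=> //.
by apply: ltW; exact: Num.Theory.truncnS_gt.
Qed.

(** By [baire_image] and linearity, every [y] is within half its norm of some
    [S x] with [nr x <= A * nr y]. Repeating this with the remainders, the
    corrections form a convergent geometric series. *)
Lemma open_mapping : exists2 K : R, 0 <= K &
  forall y, exists x, S x = y /\ nr x <= K * nr y.
Proof.
have [N [y0 [r [r0 HN]]]] := baire_image.
pose A := 4 * N%:R / r.
have A0 : 0 <= A by rewrite /A divr_ge0 ?mulr_ge0 ?(ltW r0).
have half y : exists x, nr x <= A * nr y /\ nr (y - S x) <= nr y / 2.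
  have [->|yn0] := eqVneq y 0.
    by exists 0; rewrite S0 subrr nr0 mulr0 mul0r.
  have ny : 0 < nr y by rewrite lt_def nr_eq0 yn0 nr_ge0.
  pose a := r / 2 / nr y.
  have a0 : 0 < a by rewrite !divr_gt0.
  have nz : nr (a%:C%C *: y) = r / 2.
    by rewrite nrZ cabs_real gtr0_norm// /a divfK// gt_eqF.
  have e0 : 0 < r / 8 by rewrite divr_gt0.
  have [x1 [n1 h1]] := HN (y0 + a%:C%C *: y) (r / 8) e0
    ltac:(rewrite [y0 + _]addrC addrK nz; lra) ltac:(lra).
  have [x2 [n2 h2]] := HN y0 (r / 8) e0 ltac:(rewrite subrr nr0; lra) ltac:(lra).
  exists (a^-1%:C%C *: (x1 - x2)); split.
    rewrite nrZ cabs_real gtr0_norm ?invr_gt0//.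
    have h : nr (x1 - x2) <= 2 * N%:R by have := nrD x1 (- x2); rewrite nrN; lra.
    have -> : A * nr y = a^-1 * (2 * N%:R) by rewrite /A /a; field; rewrite !gt_eqF.
    by rewrite ler_pM2l ?invr_gt0.
  have an0 : a%:C%C != 0 :> C by rewrite -cabs_gt0 cabs_real gtr0_norm.
  have -> : y - S (a^-1%:C%C *: (x1 - x2)) = a^-1%:C%C *:
     ((S x2 - y0) - (S x1 - (y0 + a%:C%C *: y))).
    rewrite SZ SB; have -> : (S x2 - y0) - (S x1 - (y0 + a%:C%C *: y)) =
      a%:C%C *: y - (S x1 - S x2).
      by rewrite !opprB addrA (addrA (S x2 - y0)) subrK (addrC (S x2)) addrA.
    by rewrite [RHS]scalerBr scalerA fmorphV mulVf// scale1r.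
  rewrite nrZ cabs_real gtr0_norm ?invr_gt0//.
  have h : nr (S x2 - y0 - (S x1 - (y0 + a%:C%C *: y))) <= r / 4.
    have := nrD (S x2 - y0) (- (S x1 - (y0 + a%:C%C *: y))); rewrite nrN; lra.
  have -> : nr y / 2 = a^-1 * (r / 4) by rewrite /a; field; rewrite !gt_eqF.
  by rewrite ler_pM2l ?invr_gt0.
clearbody A.
have [nx Hnx] := choice half.
exists (2 * A); first by rewrite mulr_ge0.
move=> y.
pose fix ys n : H := if n is m.+1 then ys m - S (nx (ys m)) else y.
have ysn n : nr (ys n) <= nr y / 2 ^+ n.
  elim: n => [|n IH]; first by rewrite expr0 divr1.
  have [_ h] := Hnx (ys n); apply: le_trans h _.
  by have := half_pow (nr y) n; lra.
pose fix xs n : H := if n is m.+1 then xs m + nx (ys m) else 0.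
have xsE n : S (xs n) = y - ys n.
  elim: n => [|n IH]; first by rewrite /= S0 subrr.
  rewrite /= addrC -[nx (ys n)]scale1r linS !scale1r IH opprB.
  by rewrite [LHS]addrA [S _ + y]addrC [RHS]addrA.
have [x Hx] := @geometric_lim xs (A * nr y) ltac:(move=> n /=;
  rewrite addrAC subrr add0r; case: (Hnx (ys n)) => h _; apply: le_trans h _;
  by rewrite -mulrA ler_wpM2l).
exists x; split; last by have := Hx 0%N; rewrite subr0 expr0 divr1 mulrA.
apply/subr0_eq/nr_small => e e0.
have b0 n : nr (S (x - xs n)) <= `|b| * (2 * (A * nr y) / 2 ^+ n).
  apply: le_trans (bS _) _; apply: le_trans (ler_wpM2r (nr_ge0 _) (ler_norm b)) _.
  by rewrite ler_wpM2l.
have [M' HM'] := pow2_small (`|b| * (2 * (A * nr y)) + nr y) e0.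
have -> : S x - y = S (x - xs M') - ys M'.
  by rewrite SB xsE opprB addrA addrAC addrK.
have := nrD (S (x - xs M')) (- ys M'); rewrite nrN.
have := b0 M'; have := ysn M'; have := HM' M' (leqnn _).
rewrite mulrDl mulrA; lra.
Qed.

End OpenMapping.

(** * Local boundedness of the reproducing kernel *)

Section LocalBound.
Variables (R : realType) (K : R[i] -> R[i] -> R[i]).
Variables (H : completeNormedModType R[i]) (ip : {dot H for @Num.conj R[i]}).
Variables (ev : H -> R[i] -> R[i]) (M Mstar : {linear H -> H}).
Hypothesis K_pd : positive_definite_kernel (disc R) K.
Hypothesis K_pos : forall w, disc R w -> 0 < K w w.
Hypothesis H_rkhs : is_rkhs (disc R) K ip ev.
Hypothesis M_mult : is_coordinate_mult (disc R) ev M.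
Hypothesis M_adj : is_adjoint ip M Mstar.
Hypothesis Mstar_B1 : in_B1 (disc R) Mstar.
Local Notation C := R[i].

Lemma ipZDl (a : C) (x y z : H) : ip (a *: x + y) z = a * ip x z + ip y z.
Proof. exact: linearPl. Qed.
Lemma ipZDr (a : C) (x y z : H) : ip z (a *: x + y) = a^* * ip z x + ip z y.
Proof. exact: linearPr. Qed.
Lemma ipC (x y : H) : ip x y = (ip y x)^*.
Proof. by rewrite hermC expr0 mul1r. Qed.

Lemma ip_nr (x : H) : ip x x = (nr x ^+ 2)%:C%C.
Proof. by have [h _ _ _] := H_rkhs; rewrite -h nrE -rmorphXn. Qed.

(** For every f, the inner product of f with Mstar kw is the value of M f at
    w, that is w times that of f with kw. *)
Lemma Mstar_kernel w (kw : H) : disc R w ->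
  (forall f : H, ip f kw = ev f w) -> Mstar kw = w^* *: kw.
Proof.
move=> w1 Hk; apply/subr0_eq; set x := _ - _.
suff : ip x x = 0.
  rewrite ip_nr => /(@complexI R)/eqP; rewrite sqrf_eq0 nr_eq0 => /eqP; exact.
rewrite {2}/x addrC -scaleNr ipZDr rmorphN/= conjCK -M_adj !Hk (M_mult x w1).
by rewrite mulNr addNr.
Qed.

(** Let k_w denote the kernel function at w, r the component of k_w orthogonal
    to k_z0, and S = Mstar - conj z0. Since S is onto and its kernel is the
    line of k_z0, every solution x of S x = S r has norm at least that of r,
    and the open mapping theorem provides one of norm at most Q |S r| = Q |w -
    z0| |k_w|. For w near z0 this is at most half of |k_w|, whence |k_w| <= 2
    |K(z0, w)| / K(z0, z0) |k_z0|, and K(z0, w) is bounded for w near z0 by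
    continuity. *)
Lemma kernel_local_bound z0 : cabs z0 < 1 -> exists d B : R, 0 < d /\
  forall w, cabs (w - z0) < d -> cabs (K w w) <= B.
Proof.
move=> hz0; have dz0 : disc R z0 by apply/discE.
have [_ evP _ Hker] := H_rkhs.
have [k0 k0E k0P] := Hker z0 dz0.
have dz0' : disc R z0^* by apply/discE; rewrite cabs_conj.
have [_ [[bM HbM] [_ Hsurj Hdim _]]] := Mstar_B1.
pose S := shifted Mstar z0^*.
have linS (a : C) x y : S (a *: x + y) = a *: S x + S y.
  rewrite /S /shifted linearP scalerDr !scalerBr opprD addrACA; congr (_ + _ + _).
  by rewrite !scalerA mulrC.
have bS x : nr (S x) <= (complex.Re bM + cabs z0^*) * nr x.
  rewrite mulrDl; have := nrD (Mstar x) (- (z0^* *: x)); rewrite nrN nrZ => h.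
  apply: le_trans h _; rewrite lerD2r.
  have := HbM x; rewrite !nrE; case: bM {HbM} => a b; rewrite lecE/= => /andP[_].
  by rewrite mulr0 subr0.
have surjS y : exists x, S x = y.
  have := Hsurj _ dz0'; move=> /seteqP[_ /(_ y I)[x _ <-]]; by exists x.
have [Q Q0 HQ] := open_mapping linS bS surjS.
have Sk0 : S k0 = 0 by rewrite /S /shifted (Mstar_kernel dz0 k0P) subrr.
have K00 : 0 < K z0 z0 := K_pos dz0.
have k0k0 : ip k0 k0 = K z0 z0 by rewrite k0P k0E.
have k0n : k0 != 0.
  apply/eqP => E; move: K00; rewrite -k0k0 E.
  by rewrite ip_nr nr0 expr0n ltxx.
have kerS x : S x = 0 -> exists c : C, x = c *: k0.
  move=> Sx; have [e en0 AE] := Hdim _ dz0'.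
  have [c1 _ c1E] : range (fun c : C => c *: e) k0 by rewrite -AE.
  have [c2 _ c2E] : range (fun c : C => c *: e) x by rewrite -AE.
  have c1n : c1 != 0 by apply/eqP => E; move: k0n; rewrite -c1E E scale0r eqxx.
  by exists (c2 / c1); rewrite -c1E scalerA divfK.
have [[_ Kanti] _] := K_pd.
have /derivable_hasD[l Hl] := Kanti z0 dz0 z0 dz0.
have [d1 [d10 Hd1]] := hasW_local_bound Hl.
pose d := Num.min (Num.min d1 (1 - cabs z0)) (2 * Q + 1)^-1.
have Q1 : 0 < 2 * Q + 1 by lra.
pose B0 := 2 * ((cabs (K z0 z0) + 1) / cabs (K z0 z0)) * nr k0.
exists d, (B0 ^+ 2); split.
  by rewrite !lt_min d10 subr_gt0 hz0 invr_gt0.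
move=> w; rewrite !lt_min => /andP[/andP[wd1 wd2] wd3].
have hw : cabs w < 1 by have := cabs_le_dist w z0; lra.
have dw : disc R w by apply/discE.
have [kw kwE kwP] := Hker w dw.
have KwE : K w w = (nr kw ^+ 2)%:C%C by rewrite -(kwE w dw) -kwP ip_nr.
pose al := K z0 w / K z0 z0.
pose r := kw - al *: k0.
have rk0 : ip r k0 = 0.
  rewrite /r addrC -scaleNr ipZDl !k0P (kwE _ dz0) (k0E _ dz0) /al.
  by rewrite mulNr divfK ?addNr// gt_eqF.
have Sr : S r = (w^* - z0^*) *: kw.
  rewrite /r addrC -scaleNr linS Sk0 scaler0 add0r /S /shifted.
  by rewrite (Mstar_kernel dw kwP) scalerBl.
have nSr : nr (S r) = cabs (w - z0) * nr kw.
  by rewrite Sr nrZ -rmorphB cabs_conj.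
have [x [Sx nx]] := HQ (S r).
have [c cE] : exists c : C, x - r = c *: k0.
  apply: kerS; rewrite addrC -scaleN1r linS Sx scaleN1r addNr//.
have rx : nr r <= nr x.
  rewrite -ler_sqr ?nnegrE ?nr_ge0// -lecR -!ip_nr.
  have -> : x = c *: k0 + r by rewrite -cE subrK.
  rewrite ipZDl !ipZDr rk0 mulr0 add0r (ipC k0 r) rk0 conjC0 addr0 mulrA.
  by rewrite lerDr -normCK mulr_ge0 ?exprn_ge0// ltW// k0k0.
have rkw : nr r <= nr kw / 2.
  apply: le_trans rx _; apply: le_trans nx _; rewrite nSr.
  have h : (2 * Q + 1) * cabs (w - z0) < 1.
    by rewrite mulrC -ltr_pdivlMr// div1r.
  have : Q * (cabs (w - z0) * nr kw) <= 2^-1 * nr kw.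
    rewrite mulrA ler_wpM2r ?nr_ge0//.
    by have := cabs_ge0 (w - z0); lra.
  lra.
have kw_le : nr kw <= 2 * (cabs al * nr k0).
  have : nr kw <= nr r + cabs al * nr k0.
    by rewrite -nrZ; have := nrD r (al *: k0); rewrite subrK.
  lra.
have al_le : cabs al <= (cabs (K z0 z0) + 1) / cabs (K z0 z0).
  rewrite /al cabsM cabsV ler_wpM2r ?invr_ge0 ?cabs_ge0//.
  by have := Hd1 w wd1; rewrite !cabs_conj.
rewrite KwE cabs_real ger0_norm ?exprn_ge0 ?nr_ge0//.
rewrite lerXn2r ?nnegrE ?nr_ge0//.
  by rewrite /B0 !mulr_ge0 ?nr_ge0 ?invr_ge0 ?addr_ge0 ?cabs_ge0.
by apply: le_trans kw_le _; rewrite /B0 mulrA ler_wpM2r ?nr_ge0// ler_pM2l.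
Qed.

Lemma rkhs_kernel_bihol : bihol (conj2 K).
Proof.
apply: bihol_of_pd => //; apply: local_bounded => w hw; exact: kernel_local_bound.
Qed.

End LocalBound.

(** * Curvature inequality and infinite divisibility *)

Lemma pdf_ext (R : realType) (G1 G2 : R[i] -> R[i]) : (forall w, cabs w < 1 -> G1 w = G2 w) ->
  positive_definite_function (disc R) G1 <-> positive_definite_function (disc R) G2.
Proof.
move=> E; split=> -[L [[sL LE] pL]]; exists L; split=> //; split=> // w w1;
  by rewrite LE// E//; apply/discE.
Qed.

Theorem corollary4p2 (R : realType) (K : R[i] -> R[i] -> R[i])
    (K_pd : positive_definite_kernel (disc R) K)
    (K_pos : forall w, disc R w -> 0 < K w w)
    (H : completeNormedModType R[i]) (ip : {dot H for @Num.conj R[i]})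
    (ev : H -> R[i] -> R[i]) (H_rkhs : is_rkhs (disc R) K ip ev)
    (M Mstar : {linear H -> H})
    (M_mult : is_coordinate_mult (disc R) ev M)
    (M_adj : is_adjoint ip M Mstar)
    (Mstar_B1 : in_B1 (disc R) Mstar) :
  (positive_definite_function (disc R)
     (ddbar_log (fun w => (1 - `|w| ^+ 2) * K w w))
   <-> pd_le (disc R) (curvature_Mstar K) curvature_Sstar)
  /\
  (positive_definite_function (disc R)
     (ddbar_log (fun w => (1 - `|w| ^+ 2) * K w w))
   <-> infinitely_divisible_contraction K).
Proof.
have nK := rkhs_kernel_bihol K_pd K_pos H_rkhs M_mult M_adj Mstar_B1.
pose P (z v : R[i]) := (1 - z * v) * conj2 K z v.
have nP : bihol P by apply: bihol_mul nK; exact: bihol_1B.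
have s0 (w : R[i]) : cabs w < 1 -> 0 < 1 - w * w^*.
  move=> w1; rewrite -normCK cabsE -rmorphXn subr_gt0 -(rmorph1 (real_complex R)) ltcR.
  by rewrite expr_lt1 ?cabs_ge0.
have KE w : conj2 K w w^* = K w w by exact: conj2E.
have K0 (w : R[i]) : cabs w < 1 -> 0 < conj2 K w w^*.
  by move=> w1; rewrite KE; apply/K_pos/discE.
have P0 (w : R[i]) : cabs w < 1 -> 0 < P w w^*.
  by move=> w1; rewrite mulr_gt0 ?s0 ?K0.
have gE : (fun w => (1 - `|w| ^+ 2) * K w w) = (fun w => P w w^*).
  by apply/funext => w; rewrite /P KE normCK.
have LP := logW_bihol nP P0; have LK := logW_bihol nK K0.
have LS := logW_bihol (@bihol_1B R) s0.
have E1 w : cabs w < 1 -> ddbar_log (fun w => (1 - `|w| ^+ 2) * K w w) w = ddlog P w.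
  by move=> w1; rewrite gE (logW_ddbar LP w1).
split; last first.
  rewrite (pdf_ext E1).
  have PK (w : R[i]) : P w w^* = (1 - w * w^*) * K w w by rewrite /P KE.
  have PKt t : (fun w => real_complex R (complex.Re (P w w^*) `^ t)) =
      (fun w : R[i] => real_complex R (complex.Re ((1 - w * w^*) * K w w) `^ t)).
    by apply/funext => w; rewrite PK.
  split=> [H1|[_ _ H2]].
    split.
    - have := bihol_sesqui nP; congr sesquiholomorphic.
      by apply/funext => z; apply/funext => w; rewrite /P /conj2 conjCK.
    - by move=> w /discE w1; rewrite -PK P0.
    - move=> t t0; have [Lt HLt] := pd_powers nP P0 H1 t0; exists Lt.
      by rewrite -PKt.
  apply: (pd_ddlog nP P0) => t t0; have [Lt HLt] := H2 t t0; exists Lt.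
  by rewrite PKt.
apply: pdf_ext => w w1; rewrite E1// /curvature_Sstar /curvature_Mstar /curvature.
have Kfun : (fun w => K w w) = (fun w => conj2 K w w^*).
  by apply/funext => z; rewrite KE.
(* The curvature of the shift is minus that of w |-> 1 - |w|^2. *)
have LSV : logW (fun w : R[i] => 1 / (1 - `|w| ^+ 2))
   (fun w => - dlog (fun z v => 1 - z * v) w) (fun w => - ddlog (fun z v => 1 - z * v) w).
  apply: logWN LS _ => z z1.
  rewrite -log_ofV ?s0//; congr (log_of _ z); apply/funext => u.
  by rewrite div1r normCK.
rewrite (logW_ddbar LSV w1) Kfun (logW_ddbar LK w1) !opprK.
have LP2 := logWD LS LK (fun z z1 => @log_ofM R (fun u => 1 - u * u^*)
  (fun u => conj2 K u u^*) z (s0 z z1) (K0 z z1)).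
rewrite -(logW_ddbar LP w1).
exact: logW_ddbar LP2 w1.
Qed.
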